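(* Let $X \subset \mathbb{C}P^N$ be a projective manifold with small dual and let $\Sigma \subset X$ be a smooth hyperplane section of $X$. Then the Stein manifold $X \setminus \Sigma$ is subcritical. In fact $$\mathrm{ind}(X \setminus \Sigma) \leq \dim_{\mathbb{C}}(X) - \mathrm{def}(X).$$
   Context: $X\subset\mathbb{C}P^N$ is a smooth (connected) embedded complex projective variety. Its dual variety is $X^*=\{H\in(\mathbb{C}P^N)^* \mid H \text{ is somewhere tangent to } X\}$, its defect is $\mathrm{def}(X)=\mathrm{codim}_{\mathbb{C}}(X^* )-1$, and it has small dual if $\mathrm{def}(X)>0$. Let $Y$ be a Stein manifold with complex structure $J$. A function $\varphi:Y\to\mathbb{R}$ is plurisubharmonic if $-dd^{\mathbb C}\varphi$ is a Kähler form on $Y$, where $d^{\mathbb C}\varphi=d\varphi\circ J$; it is exhausting if it is proper and bounded from below. For a plurisubharmonic Morse function $\varphi$, $\mathrm{ind}_{\max}(\varphi)=\max\{\mathrm{ind}_z(\varphi)\mid z\in\mathrm{Crit}(\varphi)\}$ is the maximal Morse index (always $\le\dim_{\mathbb C}Y$). The subcriticality index is $$\mathrm{ind}(Y)=\min\{\mathrm{ind}_{\max}(\varphi)\mid\varphi:Y\to\mathbb{R}\text{ is a plurisubharmonic exhausting Morse function}\}.$$ $Y$ is subcritical if $\mathrm{ind}(Y)<\dim_{\mathbb C}(Y)$. *)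

(* Defs.v *)
From HB Require Import structures.
From mathcomp Require Import all_boot all_order all_algebra.
From mathcomp Require Import complex.
From mathcomp Require mpoly.
From mathcomp Require Import all_classical all_reals all_analysis.
Import Order.TTheory GRing.Theory Num.Theory.
Import numFieldNormedType.Exports.
(* The notations of mpoly clash with those of analysis. *)
Import (canonicals, coercions) mpoly.

Set Implicit Arguments.
Unset Strict Implicit.
Unset Printing Implicit Defensive.

Local Open Scope classical_set_scope.
Local Open Scope ring_scope.

(* C^n as a normed space over R: a point z is the pair (Re z, Im z).          *)
Notation Cspace R n := ('rV[R]_n * 'rV[R]_n)%type.

(* Multiplication by i, i.e., the standard complex structure of C^n.          *)
Definition Jmul (R : realType) (n : nat) (z : Cspace R n) : Cspace R n :=
  (- z.2, z.1).

Definition cvec (R : realType) (n : nat) (z : Cspace R n) : 'rV[R[i]]_n :=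
  \row_j Complex (z.1 0 j) (z.2 0 j).

Section Smoothness.
Variable R : realType.

(* 'd f x is the Fréchet derivative over R; in finite dimension, continuity   *)
(* of x |-> 'd f x v for every v is continuity of x |-> 'd f x.               *)
Fixpoint Ck (V W : normedModType R) (k : nat) (U : set V) (f : V -> W) : Prop :=
  if k is k'.+1 then
    (forall x, U x -> differentiable f x) /\
    (forall v, Ck k' U (fun x => 'd f x v))
  else forall x, U x -> {for x, continuous f}.

Definition smooth_on (V W : normedModType R) (U : set V) (f : V -> W) : Prop :=
  forall k, Ck k U f.

(* Smooth, with C-linear differential (the Cauchy-Riemann equations).         *)
Definition holomorphic_on (n m : nat) (U : set (Cspace R n))
    (f : Cspace R n -> Cspace R m) : Prop :=
  smooth_on U f /\
  forall x, U x -> forall v, 'd f x (Jmul v) = Jmul ('d f x v).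

End Smoothness.

Section ProjectiveSpace.
Variables (R : realType) (N : nat).

Definition CP : Type := {L : {vspace 'rV[R[i]]_N.+1} | \dim L == 1%N}.

HB.instance Definition _ := Choice.on CP.

(* The nonzero vectors of C^(N+1) spanning a line in A.                       *)
Definition cone (A : set CP) : set (Cspace R N.+1) :=
  [set z | exists2 p, A p & <[cvec z]>%VS = val p].

(* The quotient topology of C^(N+1) \ {0} -> CP^N.                            *)
Definition CP_open (A : set CP) : Prop := open (cone A).

Let cvec0 (z : Cspace R N.+1) : (cvec z == 0) = (z == 0).
Proof.
apply/eqP/eqP => [|->]; last by apply/rowP => j; rewrite !mxE.
case: z => x y /rowP z0; congr pair; apply/rowP => j;
  by have := z0 j; rewrite !mxE => -[].
Qed.

Let CP_openT : CP_open setT.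
Proof.
rewrite /CP_open (_ : cone setT = ~` [set 0]); last first.
  apply/seteqP; split => z /=.
    case=> p _ zp z0; have := valP p.
    by rewrite -zp dim_vline cvec0 z0 eqxx.
  move=> /eqP z0; have d1 : \dim <[cvec z]>%VS == 1%N.
    by rewrite dim_vline cvec0 z0.
  by exists (exist _ <[cvec z]>%VS d1).
apply: closed_openC; apply: accessible_closed_set1.
by apply: hausdorff_accessible; exact: norm_hausdorff.
Qed.

Let CP_openI : setI_closed CP_open.
Proof.
move=> A B oA oB; rewrite /CP_open (_ : cone (A `&` B) = cone A `&` cone B).
  exact: openI.
apply/seteqP; split => z.
  by case=> p [Ap Bp] zp; split; exists p.
case=> -[p Ap zp] [q Bq zq]; exists p => //; split => //.
by have -> : p = q by apply: val_inj; rewrite -zp -zq.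
Qed.

Let CP_open_bigU (I : Type) (f : I -> set CP) :
  (forall i, CP_open (f i)) -> CP_open (\bigcup_i f i).
Proof.
move=> of_; rewrite /CP_open (_ : cone _ = \bigcup_i cone (f i)).
  by apply: bigcup_open => i _; exact: of_.
apply/seteqP; split => z.
  by case=> p [i _ fip] zp; exists i => //; exists p.
by case=> i _ [p fip zp]; exists p => //; exists i.
Qed.

HB.instance Definition _ :=
  isOpenTopological.Build CP CP_openT CP_openI CP_open_bigU.

End ProjectiveSpace.

Section Submanifolds.
Variables (R : realType) (N : nat).
Implicit Types (S X Y : set (CP R N)).

Definition is_lift (n : nat) (U : set (Cspace R n)) (f : Cspace R n -> CP R N)
    (psi : Cspace R n -> Cspace R N.+1) : Prop :=
  holomorphic_on U psi /\ forall u, U u -> <[cvec (psi u)]>%VS = val (f u).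

(* f : U -> S is a holomorphic parametrization of an open subset of S, i.e.,  *)
(* the inverse of a holomorphic chart: a holomorphic immersion which is a     *)
(* homeomorphism onto an open subset of S.  The kernel of the differential    *)
(* of f = [psi] at u is the set of v such that d(psi)_u(v) is a multiple of   *)
(* psi(u).                                                                    *)
Definition chart (n : nat) S (U : set (Cspace R n)) (f : Cspace R n -> CP R N)
    : Prop :=
  [/\ open U,
      f @` U `<=` S,
      set_inj U f,
      forall V, open V -> V `<=` U -> exists2 A, open A & f @` V = S `&` A &
      exists2 psi, is_lift U f psi &
        forall u, U u -> forall v,
          cvec ('d psi u v) \in <[cvec (psi u)]>%VS -> v = 0].

(* S is a (not necessarily closed) embedded complex submanifold of CP^N, of   *)
(* pure complex dimension n.                                                  *)
Definition complex_submanifold (n : nat) S : Prop :=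
  forall p, S p -> exists U f u, [/\ @chart n S U f, U u & f u = p].

Definition algebraic_set S : Prop :=
  exists2 s : seq (mpoly.mpoly N.+1 R[i]),
    forall P, P \in s -> exists d, P \is mpoly.ishomog1 d (@mpoly.mdeg N.+1) &
    S = [set p : CP R N | forall z : 'rV[R[i]]_N.+1, z \in val p ->
         forall P, P \in s -> mpoly.meval (z 0) P = 0].

Definition projective_manifold (n : nat) X : Prop :=
  [/\ X !=set0, connected X, algebraic_set X & complex_submanifold n X].

(* The complex codimension of Z, where dim Z is the largest dimension of a    *)
(* nonempty complex submanifold contained in Z, and dim set0 = -1.            *)
Definition codim (Z : set (CP R N)) : nat :=
  (N.+1 - \max_(d < N.+1 | `[< exists S,
       [/\ S !=set0, complex_submanifold d S & S `<=` Z] >]) d.+1)%N.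

(* The dual projective space is again represented by CP R N: the point        *)
(* [a_0 : ... : a_N] stands for the hyperplane a_0 z_0 + ... + a_N z_N = 0.   *)
Definition in_hyperplane (a : CP R N) (z : 'rV[R[i]]_N.+1) : Prop :=
  forall w : 'rV[R[i]]_N.+1, w \in val a -> z *m w^T = 0.

Definition hyperplane (a : CP R N) : set (CP R N) :=
  [set p : CP R N | forall z : 'rV[R[i]]_N.+1, z \in val p -> in_hyperplane a z].

(* T_p X is contained in T_p H for the hyperplane H given by a; on the level  *)
(* of lifts, the affine cones of these tangent spaces are compared.           *)
Definition tangent_at (n : nat) X (a p : CP R N) : Prop :=
  hyperplane a p /\
  exists U f psi u, [/\ @chart n X U f, is_lift U f psi, U u, f u = p &
    forall v, in_hyperplane a (cvec ('d psi u v))].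

Definition dual_variety (n : nat) X : set (CP R N) :=
  [set a | exists2 p, X p & tangent_at n X a p].

Definition defect (n : nat) X : int := (codim (dual_variety n X))%:Z - 1.

Definition small_dual (n : nat) X : Prop := 0 < defect n X.

(* The scheme X \cap H is smooth of codimension 1 in X exactly when H is      *)
(* nowhere tangent to X.                                                      *)
Definition smooth_hyperplane_section (n : nat) X (Sigma : set (CP R N))
    : Prop :=
  exists2 a, Sigma = X `&` hyperplane a &
    forall p, Sigma p -> ~ tangent_at n X a p.

End Submanifolds.

(* Differential forms on an open subset of C^n: a 1-form is a map alpha x v,  *)
(* a 2-form a map omega x u v.  Exterior derivatives are evaluated on         *)
(* constant vector fields, whose brackets vanish.                             *)
Section Forms.
Variables (R : realType) (n : nat).
Let V : normedModType R := Cspace R n.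

Definition dC (phi : V -> R) (x v : V) : R := 'd phi x (Jmul v).

Definition ext1 (alpha : V -> V -> R) (x u v : V) : R :=
  'd (alpha ^~ v) x u - 'd (alpha ^~ u) x v.

Definition ext2 (omega : V -> V -> V -> R) (x u v w : V) : R :=
  'd (fun y => omega y v w) x u - 'd (fun y => omega y u w) x v
  + 'd (fun y => omega y u v) x w.

Definition kahler_form (U : set V) (omega : V -> V -> V -> R) : Prop :=
  [/\ forall u v, smooth_on U (fun x => omega x u v),
      forall x, U x -> forall u v a w,
        omega x (a *: u + w) v = a * omega x u v + omega x w v /\
        omega x u v = - omega x v u,
      forall x, U x -> forall u v w, ext2 omega x u v w = 0,
      forall x, U x -> forall u v, omega x (Jmul u) (Jmul v) = omega x u v &
      forall x, U x -> forall v, v != 0 -> 0 < omega x v (Jmul v)].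

Definition critical (phi : V -> R) (x : V) : Prop := forall v, 'd phi x v = 0.

Definition hessian (phi : V -> R) (x u v : V) : R :=
  'd (fun y => 'd phi y v) x u.

Definition nondegenerate (phi : V -> R) (x : V) : Prop :=
  forall u, (forall v, hessian phi x u v = 0) -> u = 0.

Definition morse_index (phi : V -> R) (x : V) : nat :=
  \max_(k < (2 * n).+1 | `[< exists2 W : {vspace Cspace R n}, \dim W = k &
       forall w, w \in W -> w != 0 -> hessian phi x w w < 0 >]) k.

End Forms.

(* Functions on a submanifold Y of dimension n are represented by functions   *)
(* on CP^N, of which only the values on Y are used; differential notions are  *)
(* read in all holomorphic charts of Y.                                       *)
Section SteinMorse.
Variables (R : realType) (N n : nat).
Implicit Types (Y : set (CP R N)) (phi : CP R N -> R).

Definition plurisubharmonic Y phi : Prop :=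
  forall (U : set (Cspace R n)) f, chart Y U f ->
    smooth_on U (phi \o f) /\
    kahler_form U (fun x u v => - ext1 (dC (phi \o f)) x u v).

Definition exhausting Y phi : Prop :=
  (forall K, compact K -> compact (Y `&` phi @^-1` K)) /\
  exists c, forall p, Y p -> c <= phi p.

Definition morse Y phi : Prop :=
  forall (U : set (Cspace R n)) f x, chart Y U f -> U x ->
    critical (phi \o f) x -> nondegenerate (phi \o f) x.

Definition psh_exhausting_morse Y phi : Prop :=
  [/\ plurisubharmonic Y phi, exhausting Y phi & morse Y phi].

Definition ind_max Y phi : nat :=
  \max_(k < (2 * n).+1 | `[< exists (U : set (Cspace R n)) f x,
       [/\ chart Y U f, U x, critical (phi \o f) x &
           morse_index (phi \o f) x = k] >]) k.

(* ind(Y) = d; in particular the set of which d is the minimum is not empty.  *)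
Definition is_ind Y (d : nat) : Prop :=
  (exists2 phi, psh_exhausting_morse Y phi & ind_max Y phi = d) /\
  forall phi, psh_exhausting_morse Y phi -> (d <= ind_max Y phi)%N.

(* Y admits a proper holomorphic embedding into some C^m (a proper injective  *)
(* immersion is an embedding).                                                *)
Definition stein Y : Prop :=
  complex_submanifold n Y /\
  exists m (F : CP R N -> Cspace R m),
    [/\ forall (U : set (Cspace R n)) f, chart Y U f ->
          holomorphic_on U (F \o f) /\
          forall u, U u -> forall v, 'd (F \o f) u v = 0 -> v = 0,
        set_inj Y F &
        forall K, compact K -> compact (Y `&` F @^-1` K)].

Definition subcritical Y : Prop :=
  exists2 d, is_ind Y d & (d < n)%N.

End SteinMorse.

(* Main.v *)
(* Let alpha be an equation of the hyperplane that cuts out Sigma.  Then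
   Y = X \ Sigma is a closed submanifold of the affine space {z . alpha = 1},
   and the squared distance to a point c is a plurisubharmonic exhausting
   function on Y, which is Morse for generic c (Sard and Baire).  At a critical
   point its Hessian is 2 (metric + Re Q), where Q is the second fundamental form
   in the conormal direction conj(z - c).  Multiplication by i turns Re Q into
   - Re Q, so a real subspace on which the Hessian is negative definite has
   dimension at most rank Q.  On the other hand, moving a tangent hyperplane
   along X and inside the conormal fibre parametrizes a submanifold of X^* of
   dimension N - 1 - n + rank Q; hence
   rank Q <= n + 1 - codim X^* = n - def X. *)
From HB Require Import structures.
Require Import Defs.
From mathcomp Require Import all_boot all_order all_algebra.
From mathcomp Require Import complex ring lra.
From mathcomp Require mpoly.
From mathcomp Require Import all_classical all_reals all_analysis.
Import Order.TTheory GRing.Theory Num.Theory.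
Import numFieldNormedType.Exports.
Import (canonicals, coercions) mpoly.

Set Implicit Arguments.
Unset Strict Implicit.
Unset Printing Implicit Defensive.

Local Open Scope classical_set_scope.
Local Open Scope ring_scope.

(** * Differentials and C^k functions *)

(** Two facts of differential topology are obtained from estimates. That an immersed germ is a
    submanifold comes from an affine chart of projective space in which the immersion is tangent to
    the identity: it differs from the identity by a map of Lipschitz constant 1/2, so it expands
    distances by at least 1/2, and injectivity, openness and immersivity follow together. Sard's
    theorem is proved by counting grid points. Charts are the other obstacle: plurisubharmonicity,
    index and nondegeneracy are statements about all holomorphic charts. The first two are verified
    in an arbitrary chart, but genericity of the center fixes countably many charts, so
    nondegeneracy has to be transported. Transition maps are only shown to be differentiable at a
    point; Hessians are therefore compared through second-order Taylor expansions, not by the chain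
    rule. As [codim] is defined by submanifolds contained in X^*, one submanifold of large dimension
    bounds it. The conormal vector may vanish at a critical point; then Q = 0, and the bound codim
    X^* <= n + 1 takes over. *)

Section Differentials.
Variables (R : realType) (V W : normedModType R).
Implicit Types (f g : V -> W) (x v : V).

Lemma diff_eps f x : differentiable f x -> forall e, 0 < e ->
  \forall h \near 0, `|f (h + x) - f x - 'd f x h| <= e * `|h|.
Proof.
move=> /diff_locally /eqaddoP fo e e0; have := fo e e0.
by apply: filterS => h; rewrite !fctE opprD addrA.
Qed.

Lemma eps_diff f x (L : {linear V -> W}) : continuous L ->
  (forall e, 0 < e ->
     \forall h \near 0, `|f (h + x) - f x - L h| <= e * `|h|) ->
  is_diff x f L.
Proof.
move=> Lc fL; have fo : f \o shift x = cst (f x) + L +o_ 0 id.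
  apply/eqaddoP => e e0; have := fL e e0.
  by apply: filterS => h; rewrite !fctE opprD addrA.
have dE := diff_unique Lc fo; apply: DiffDef => //.
by apply/diff_locallyP; rewrite dE.
Qed.

Lemma near_eq_is_diff f g x : (\near x, f x = g x) -> differentiable f x ->
  is_diff x g ('d f x).
Proof.
move=> fg df; apply: eps_diff; first exact: diff_continuous.
move=> e e0; have := diff_eps df e0; apply: filter_app.
have : \forall h \near (0 : V), f (h + x) = g (h + x).
  by have := fg; rewrite (near_shift 0 x)/=; apply: filterS => h; rewrite subr0.
apply: filterS => h /= -> /=.
by have -> : f x = g x by exact: nbhs_singleton fg.
Qed.

Lemma diff_eq_on (U : set V) f g x : open U -> U x ->
  (forall y, U y -> f y = g y) -> differentiable f x ->
  is_diff x g ('d f x).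
Proof.
move=> oU Ux fg; apply: near_eq_is_diff.
by apply: filterS fg _; exact: open_nbhs_nbhs.
Qed.

Lemma diff_dirE f x v : differentiable f x -> 'd f x v = 'D_v f x.
Proof. by move=> df; rewrite deriveE. Qed.

End Differentials.

Section DifferentialRules.
Variables (R : realType) (V W W' : normedModType R).

Lemma diffDE (f g : V -> W) x v : differentiable f x -> differentiable g x ->
  'd (fun y => f y + g y) x v = 'd f x v + 'd g x v.
Proof. by move=> df dg; rewrite -[fun y => _]/(f + g) diffD. Qed.

Lemma diffNE (f : V -> W) x v : differentiable f x ->
  'd (fun y => - f y) x v = - 'd f x v.
Proof. by move=> df; rewrite -[fun y => _]/(- f) diffN. Qed.

Lemma diffME (f g : V -> R) x v : differentiable f x -> differentiable g x ->
  'd (fun y => f y * g y) x v = f x * 'd g x v + g x * 'd f x v.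
Proof. by move=> df dg; rewrite -[fun y => _]/(f * g) diffM. Qed.

Lemma diff_compE (f : V -> W) (g : W -> W') x v : differentiable f x ->
  differentiable g (f x) -> 'd (fun y => g (f y)) x v = 'd g (f x) ('d f x v).
Proof. by move=> df dg; rewrite -[fun y => _]/(g \o f) diff_comp. Qed.

Lemma differentiable_lin_comp (L : {linear W -> W'}) (f : V -> W) x :
  continuous L -> differentiable f x -> differentiable (fun y => L (f y)) x.
Proof.
move=> Lc df; apply: (differentiable_comp df); exact: linear_differentiable.
Qed.

Lemma diff_linE (L : {linear W -> W'}) (f : V -> W) x v : continuous L ->
  differentiable f x -> 'd (fun y => L (f y)) x v = L ('d f x v).
Proof.
move=> Lc df; rewrite diff_compE ?diff_lin //.
by apply: linear_differentiable; exact: Lc.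
Qed.

Lemma diff_sumE (I : Type) (r : seq I) (P : pred I) (f : I -> V -> W) x v :
  (forall i, P i -> differentiable (f i) x) ->
  differentiable (fun y => \sum_(i <- r | P i) f i y) x /\
  'd (fun y => \sum_(i <- r | P i) f i y) x v = \sum_(i <- r | P i) 'd (f i) x v.
Proof.
move=> df; elim: r => [|i r [dIH IH]].
  under eq_fun do rewrite big_nil; rewrite big_nil.
  by split; [exact: differentiable_cst|rewrite (diff_cst 0 x)].
under eq_fun do rewrite big_cons; rewrite big_cons.
case: (boolP (P i)) => [Pi|_]; last by split.
have dfi := df i Pi; split; first exact: differentiableD dfi dIH.
by rewrite diffDE // IH.
Qed.

End DifferentialRules.

Lemma diffVE (R : realType) (V : normedModType R) (f : V -> R) x v : differentiable f x -> f x != 0 ->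
  'd (fun y => (f y)^-1) x v = - ((f x)^-1 * (f x)^-1 * 'd f x v).
Proof.
by move=> df f0; rewrite (diffV df f0) [LHS]mulNr expr2 invfM.
Qed.

Section MkLinear.
Variables (R : nzRingType) (U V : lmodType R) (f : U -> V) (fl : linear f).
Definition mklinear_fun : U -> V := f.
HB.instance Definition _ := GRing.isLinear.Build R U V *:%R mklinear_fun fl.
Definition mklinear : {linear U -> V} := mklinear_fun.
End MkLinear.

Section CkTheory.
Variables (R : realType) (V : normedModType R).
Implicit Types (U : set V) (W : normedModType R) (k : nat).

Lemma Ck_eq W k U (f g : V -> W) : open U -> (forall x, U x -> f x = g x) ->
  Ck k U f -> Ck k U g.
Proof.
move=> oU; elim: k f g => [|k IH] f g fg.
  move=> cf x Ux; suff : g @ x --> g x by [].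
  rewrite -(fg x Ux); apply: cvg_trans (cf x Ux); apply: near_eq_cvg.
  by apply: filterS fg _; exact: open_nbhs_nbhs.
move=> [df Cf]; split=> [x Ux|v].
  exact: (@ex_diff _ _ _ _ _ _ _ (diff_eq_on oU Ux fg (df _ Ux))).
apply: IH (Cf v) => x Ux.
by rewrite (@diff_val _ _ _ _ _ _ _ (diff_eq_on oU Ux fg (df _ Ux))).
Qed.

Lemma CkS W k U (f : V -> W) : Ck k.+1 U f -> Ck k U f.
Proof.
elim: k f => [|k IH] f.
  by move=> [df _] x Ux; exact/differentiable_continuous/df.
by move=> [df Cf]; split=> // v; apply: IH; exact: Cf.
Qed.

Lemma Ck_cst W k U (w : W) : open U -> Ck k U (fun=> w).
Proof.
move=> oU; elim: k w => [|k IH] w /=; first by move=> x Ux; exact: cvg_cst.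
split=> [x _|v]; first exact: differentiable_cst.
apply: (Ck_eq oU) (IH 0) => x _; by rewrite (diff_cst w x).
Qed.

Lemma Ck_lin W W' k U (L : {linear W -> W'}) (f : V -> W) :
  open U -> continuous L -> Ck k U f -> Ck k U (fun x => L (f x)).
Proof.
move=> oU Lc; elim: k f => [|k IH] f /=.
  by move=> cf x Ux; apply: continuous_comp; [exact: cf|exact: Lc].
move=> [df Cf]; split=> [x Ux|v].
  by apply: (differentiable_comp (df x Ux)); exact: linear_differentiable.
apply: (Ck_eq oU) (IH _ (Cf v)) => x Ux.
by rewrite diff_linE //; exact: df.
Qed.

Lemma Ck_add W k U (f g : V -> W) : open U -> Ck k U f -> Ck k U g ->
  Ck k U (fun x => f x + g x).
Proof.
move=> oU; elim: k f g => [|k IH] f g /=.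
  by move=> cf cg x Ux; apply: cvgD; [exact: cf|exact: cg].
move=> [df Cf] [dg Cg]; split=> [x Ux|v].
  by apply: differentiableD; [exact: df|exact: dg].
apply: (Ck_eq oU) (IH _ _ (Cf v) (Cg v)) => x Ux.
by rewrite diffDE; [|exact: df|exact: dg].
Qed.

Lemma Ck_opp W k U (f : V -> W) : open U -> Ck k U f -> Ck k U (fun x => - f x).
Proof. by move=> oU; apply: (@Ck_lin _ _ _ _ -%R) => // x; exact: oppr_continuous. Qed.

Lemma Ck_scalel W k U (w : W) (f : V -> R) : open U -> Ck k U f ->
  Ck k U (fun x => f x *: w).
Proof.
move=> oU; have l : linear (fun r : R => r *: w).
  by move=> a u v; rewrite scalerDl scalerA.
by apply: (@Ck_lin _ _ _ _ (mklinear l)) => //; exact: scalel_continuous.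
Qed.

Lemma Ck_sum W k U (I : Type) (r : seq I) (P : pred I) (f : I -> V -> W) :
  open U -> (forall i, P i -> Ck k U (f i)) ->
  Ck k U (fun x => \sum_(i <- r | P i) f i x).
Proof.
move=> oU Cf; elim: r => [|i r IH].
  by under eq_fun do rewrite big_nil; exact: Ck_cst.
under eq_fun do rewrite big_cons; case: (boolP (P i)) => // Pi.
by apply: Ck_add => //; exact: Cf.
Qed.

Lemma Ck_mul k U (f g : V -> R) : open U -> Ck k U f -> Ck k U g ->
  Ck k U (fun x => f x * g x).
Proof.
move=> oU; elim: k f g => [|k IH] f g.
  by move=> cf cg x Ux; apply: cvgM; [exact: cf|exact: cg].
move=> Cf Cg; have [df Df] := Cf; have [dg Dg] := Cg; split=> [x Ux|v].
  by apply: differentiableM; [exact: df|exact: dg].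
apply: (Ck_eq oU (f := fun x => f x * 'd g x v + g x * 'd f x v)).
  by move=> x Ux; rewrite diffME; [|exact: df|exact: dg].
apply: Ck_add => //; apply: IH.
- exact: CkS Cf.
- exact: Dg.
- exact: CkS Cg.
- exact: Df.
Qed.

(** The derivative of 1/f involves only 1/f and the derivative of f, so the induction on k
    closes. *)
Lemma Ck_inv k U (f : V -> R) : open U -> (forall x, U x -> f x != 0) ->
  Ck k U f -> Ck k U (fun x => (f x)^-1).
Proof.
move=> oU f0; elim: k => [|k IH].
  by move=> cf x Ux; apply: cvgV; [exact: f0|exact: cf].
move=> Cf; have [df Df] := Cf; split=> [x Ux|v].
  by apply: differentiableV; [exact: df|exact: f0].
apply: (Ck_eq oU (f := fun x => - ((f x)^-1 * (f x)^-1 * 'd f x v))).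
  by move=> x Ux; have dfx := df x Ux; have fx0 := f0 x Ux; rewrite diffVE.
apply: Ck_opp => //; apply: Ck_mul => //; last exact: Df.
by apply: Ck_mul => //; apply: IH; exact: CkS.
Qed.

End CkTheory.

(** Stated for affine maps because the derivative of f (a + L x) along v is the derivative of f
    along the constant direction L v, composed with the same affine map: the induction closes
    without a chain rule for C^k. *)
Lemma Ck_aff (R : realType) (V V' W : normedModType R) k (U : set V)
    (L : {linear V' -> V}) (a : V) (f : V -> W) : open U -> continuous L ->
  Ck k U f -> Ck k ((fun x => a + L x) @^-1` U) (fun x => f (a + L x)).
Proof.
move=> oU Lc; have dA x : is_diff x (fun x => a + L x) L.
  have dL : is_diff x L L by apply: DiffDef; [exact: linear_differentiable|exact: diff_lin].
  have := is_diffD (@is_diff_cst _ _ _ a x) dL.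
  by rewrite add0r.
have Ac : continuous (fun x => a + L x).
  by move=> x; apply: differentiable_continuous; exact: ex_diff.
have oU' : open ((fun x => a + L x) @^-1` U) by apply: open_comp.
elim: k f => [|k IH] f /=.
  move=> cf x Ux; apply: (@continuous_comp _ _ _ (fun x => a + L x) f).
    exact: Ac.
  exact: cf.
move=> [df Cf]; split=> [x Ux|v].
  apply: (@differentiable_comp _ _ _ _ (fun x => a + L x) f); last exact: df.
  exact: ex_diff.
apply: (Ck_eq oU') (IH _ (Cf (L v))) => x Ux.
have dAx := dA x; rewrite (diff_compE (f := fun x => a + L x)) ?diff_val //.
by apply: df; exact: Ux.
Qed.

(* The sealed copy dd of 'd keeps unification from unfolding differentials. *)
HB.lock Definition dd (R : realType) (V W : normedModType R) (f : V -> W)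
  (x v : V) : W := 'd f x v.
Canonical dd_unlockable := Unlockable dd.unlock.

Lemma ddE (R : realType) (V W : normedModType R) (f : V -> W) x v :
  dd f x v = 'd f x v.
Proof. by rewrite unlock. Qed.

Section DirectionalDerivative.
Variables (R : realType) (V W W' : normedModType R).
Implicit Types (f g : V -> W) (x v w : V) (U : set V).

Lemma ddfE f v : (fun x => dd f x v) = (fun x => 'd f x v).
Proof. by apply/funext => x; exact: ddE. Qed.

Lemma dd_linear f x : linear (dd f x).
Proof. by move=> a v w; rewrite !ddE linearP. Qed.

HB.instance Definition _ f x :=
  GRing.isLinear.Build R V W *:%R (dd f x) (dd_linear f x).

Lemma ddDl f x v w : dd f x (v + w) = dd f x v + dd f x w.
Proof. exact: linearD. Qed.

Lemma ddZl f x a v : dd f x (a *: v) = a *: dd f x v.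
Proof. exact: linearZ. Qed.

Lemma dd0l f x : dd f x 0 = 0. Proof. exact: linear0. Qed.

Lemma dd_eq_on U f g x v : open U -> U x -> (forall y, U y -> f y = g y) ->
  differentiable f x -> differentiable g x /\ dd g x v = dd f x v.
Proof.
move=> oU Ux fg df; have dg := diff_eq_on oU Ux fg df.
by split; [exact: ex_diff|rewrite !ddE diff_val].
Qed.

Lemma dd_cst (c : W) x v : dd (fun=> c) x v = 0.
Proof. by rewrite ddE (diff_cst c x). Qed.

Lemma ddD f g x v : differentiable f x -> differentiable g x ->
  dd (fun y => f y + g y) x v = dd f x v + dd g x v.
Proof. by move=> df dg; rewrite !ddE; exact: diffDE. Qed.

Lemma ddN f x v : differentiable f x -> dd (fun y => - f y) x v = - dd f x v.
Proof. by move=> df; rewrite !ddE; exact: diffNE. Qed.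

Lemma ddM (f g : V -> R) x v : differentiable f x -> differentiable g x ->
  dd (fun y => f y * g y) x v = f x * dd g x v + g x * dd f x v.
Proof. by move=> df dg; rewrite !ddE; exact: diffME. Qed.

Lemma dd_comp f (g : W -> W') x v : differentiable f x -> differentiable g (f x) ->
  dd (fun y => g (f y)) x v = dd g (f x) (dd f x v).
Proof. by move=> df dg; rewrite !ddE; exact: diff_compE. Qed.

Lemma dd_lin (L : {linear W -> W'}) f x v : continuous L -> differentiable f x ->
  dd (fun y => L (f y)) x v = L (dd f x v).
Proof. by move=> Lc df; rewrite !ddE; exact: diff_linE. Qed.

Lemma dd_sum (I : Type) (r : seq I) (P : pred I) (f : I -> V -> W) x v :
  (forall i, P i -> differentiable (f i) x) ->
  dd (fun y => \sum_(i <- r | P i) f i y) x v = \sum_(i <- r | P i) dd (f i) x v.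
Proof.
move=> df; rewrite ddE (diff_sumE r v df).2; apply: eq_bigr => i _.
by rewrite ddE.
Qed.

Lemma differentiable_bigsum (I : Type) (r : seq I) (P : pred I)
    (f : I -> V -> W) x :
  (forall i, P i -> differentiable (f i) x) ->
  differentiable (fun y => \sum_(i <- r | P i) f i y) x.
Proof. by move=> df; exact: (diff_sumE r 0 df).1. Qed.

Lemma Ck_dd k U f v : Ck k.+1 U f -> Ck k U (fun x => dd f x v).
Proof. by move=> [_ Cf]; rewrite ddfE; exact: Cf. Qed.

Lemma Ck_differentiable k U f x : Ck k.+1 U f -> U x -> differentiable f x.
Proof. by move=> [df _]; exact: df. Qed.

Lemma smooth_differentiable U f x : smooth_on U f -> U x -> differentiable f x.
Proof. by move=> sf; exact: Ck_differentiable (sf 1). Qed.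

Lemma smooth_dd U f v : smooth_on U f -> smooth_on U (fun x => dd f x v).
Proof. by move=> sf k; exact: Ck_dd (sf k.+1). Qed.

End DirectionalDerivative.

(** * Mean values and symmetry of second derivatives *)

Section MeanValue.
Variables (R : realType) (V : normedModType R).
Implicit Types (f : V -> R) (x y h u v : V).

Lemma diff_epsD (W : normedModType R) (f : V -> W) x : differentiable f x ->
  forall e : R, 0 < e -> exists2 d : R, 0 < d & forall h, `|h| < d ->
    `|f (h + x) - f x - dd f x h| <= e * `|h|.
Proof.
rewrite (_ : dd f x = 'd f x); last by apply/funext => v; exact: ddE.
by move=> df e e0; have /nbhs_norm0P[d d0 H] := diff_eps df e0; exists d.
Qed.

Lemma mvt_line f x h :
  (forall t : R, 0 <= t <= 1 -> differentiable f (x + t *: h)) ->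
  exists2 t : R, 0 <= t <= 1 & f (x + h) - f x = dd f (x + t *: h) h.
Proof.
move=> df; pose F (t : R) := f (x + t *: h).
have dF (t : R) : 0 <= t <= 1 -> differentiable F t /\ 'd F t 1 = 'd f (x + t *: h) h.
  move=> /df dft.
  have dl : is_diff t (fun s : R => x + s *: h) (fun s => s *: h).
    have := is_diffD (@is_diff_cst _ _ _ x t) (is_diff_scalel t h).
    by rewrite add0r.
  split; first by apply: (@differentiable_comp _ _ _ _ (fun s : R => x + s *: h) f).
  rewrite (diff_compE (f := fun s : R => x + s *: h)) //.
  by rewrite diff_val scale1r.
have [|||t t01] := @MVT_segment R F (fun t => 'd F t 1) 0 1.
- exact: ler01.
- move=> t; rewrite in_itv /= => /andP[t0 t1].
  have [dFt _] : differentiable F t /\ 'd F t 1 = 'd f (x + t *: h) h.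
    by apply: dF; rewrite !ltW.
  by rewrite diff_dirE //; apply: derivableP; exact: diff_derivable.
- apply/continuous_within_itvP; first exact: ltr01.
  split.
  + move=> t; rewrite in_itv /= => /andP[t0 t1]; apply: differentiable_continuous.
    by apply (fun H => (dF t H).1); rewrite !ltW.
  + apply: cvg_at_right_filter; apply: differentiable_continuous.
    by apply (fun H => (dF 0 H).1); rewrite lexx ler01.
  + apply: cvg_at_left_filter; apply: differentiable_continuous.
    by apply (fun H => (dF 1 H).1); rewrite lexx ler01.
move: t01; rewrite in_itv /= => t01; have [_ ->] := dF t t01.
by rewrite /F scale1r scale0r addr0 subr0 mulr1 => E; exists t; rewrite ?ddE.
Qed.

Lemma lip_ball f x0 (r C : R) :
  (forall y, `|y - x0| <= r ->
    differentiable f y /\ forall v, `|dd f y v| <= C * `|v|) ->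
  forall x y, `|x - x0| <= r -> `|y - x0| <= r -> `|f y - f x| <= C * `|y - x|.
Proof.
move=> df x y xr yr.
have seg (t : R) : 0 <= t <= 1 -> `|x + t *: (y - x) - x0| <= r.
  case/andP => t0 t1.
  have -> : x + t *: (y - x) - x0 = (1 - t) *: (x - x0) + t *: (y - x0).
    have -> : y - x = (y - x0) - (x - x0) by rewrite opprB addrA subrK.
    by rewrite scalerBr scalerBl scale1r addrAC [RHS]addrAC -[RHS]addrA.
  apply: (le_trans (ler_normD _ _)); rewrite !normrZ.
  rewrite (ger0_norm t0) ger0_norm ?subr_ge0 //.
  apply: (@le_trans _ _ ((1 - t) * r + t * r)).
    by apply: lerD; apply: ler_wpM2l; rewrite ?subr_ge0.
  by rewrite -mulrDl subrK mul1r.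
have [t t01] := @mvt_line f x (y - x) (fun t H => (df _ (seg t H)).1).
by rewrite [x + (y - x)]addrC subrK => ->; apply: (df _ (seg t t01)).2.
Qed.

End MeanValue.

Section Schwarz.
Variables (R : realType) (V : normedModType R).
Variables (U : set V) (f : V -> R) (x : V).
Hypotheses (oU : open U) (Ux : U x) (df : forall y, U y -> differentiable f y).

(** The mean value theorem along u, applied to G y = f (y + t v) - f y, turns the second difference
    into t times a difference of values of F, the derivative along u; expanding F at x at both
    points leaves t^2 times the mixed derivative. *)
Let second_difference u v : differentiable (fun y => dd f y u) x ->
  forall e : R, 0 < e -> exists2 d : R, 0 < d & forall t : R, 0 < t < d ->
  `|f (x + t *: u + t *: v) - f (x + t *: u) - f (x + t *: v) + f x
    - t ^+ 2 * dd (fun y => dd f y u) x v| <= e * t ^+ 2.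
Proof.
move=> dF e e0; set F := fun y => dd f y u.
pose M := `|u| + `|v| + 1.
have M0 : 0 < M by rewrite /M ltr_wpDl // addr_ge0.
have e'0 : 0 < e / (2 * M) by rewrite divr_gt0 // mulr_gt0.
have [d1 d10 H1] := diff_epsD dF e'0.
have /nbhs_normP[d2 d20 H2] : nbhs x U by exact: open_nbhs_nbhs.
(* For a, b in [0, 1] the displacement t a u + t b v has norm at most t M, so it stays inside U and
   in the range where F is expanded. *)
exists (Num.min d1 d2 / M); first by rewrite divr_gt0 // lt_min d10.
move=> t /andP[t0]; rewrite ltr_pdivlMr // lt_min => /andP[td1 td2].
have uvM (a b : R) : 0 <= a <= 1 -> 0 <= b <= 1 ->
    `|(t * a) *: u + (t * b) *: v| <= t * M.
  move=> /andP[a0 a1] /andP[b0 b1].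
  apply: (le_trans (ler_normD _ _)); rewrite !normrZ.
  rewrite !ger0_norm ?mulr_ge0 ?(ltW t0) // -!mulrA -mulrDr.
  apply: ler_wpM2l; first exact: ltW.
  apply: (@le_trans _ _ (`|u| + `|v|)); last by rewrite lerDl.
  by apply: lerD; rewrite ler_piMl.
have inU (a b : R) : 0 <= a <= 1 -> 0 <= b <= 1 -> U (x + (t * a) *: u + (t * b) *: v).
  move=> ha hb; apply: H2 => /=; rewrite -addrA opprD addNKr normrN.
  exact: le_lt_trans (uvM a b ha hb) td2.
have h0 : 0 <= (0 : R) <= 1 by rewrite lexx ler01.
have h1 : 0 <= (1 : R) <= 1 by rewrite lexx ler01.
have FE (a b : R) : 0 <= a <= 1 -> 0 <= b <= 1 ->
   `|F (x + (t * a) *: u + (t * b) *: v) - F x - dd F x ((t * a) *: u + (t * b) *: v)|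
     <= e / 2 * t.
  move=> ha hb; rewrite -[x + _ + _]addrA [x + _]addrC.
  apply: (le_trans (H1 _ (le_lt_trans (uvM a b ha hb) td1))).
  apply: (@le_trans _ _ (e / (2 * M) * (t * M))).
    by apply: ler_wpM2l; [exact: ltW|exact: uvM].
  by rewrite le_eqVlt; apply/orP; left; apply/eqP; field; rewrite gt_eqF.
pose G y := f (y + t *: v) - f y.
have dshift y : is_diff y (fun z => z + t *: v) id.
  have := is_diffD (is_diff_id y) (@is_diff_cst _ _ _ (t *: v) y).
  by rewrite addr0.
have dG (a : R) : 0 <= a <= 1 -> differentiable G (x + (t * a) *: u) /\
    dd G (x + (t * a) *: u) u = F (x + (t * a) *: u + t *: v) - F (x + (t * a) *: u).
  move=> ha; have df1 : differentiable f (x + (t * a) *: u + t *: v).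
    by apply: df; rewrite -[t in t *: v]mulr1; exact: inU.
  have df0 : differentiable f (x + (t * a) *: u).
    by apply: df; have := inU a 0 ha h0; rewrite mulr0 scale0r addr0.
  have dsh := dshift (x + (t * a) *: u).
  have dg : differentiable (fun y => f (y + t *: v)) (x + (t * a) *: u).
    by apply: (@differentiable_comp _ _ _ _ (fun y => y + t *: v) f).
  split; first exact: differentiableB.
  rewrite ddD //; last exact: differentiableN.
  by rewrite ddN // (dd_comp (f := fun y => y + t *: v)) // [dd _ _ u]ddE diff_val.
have [a ha] : exists2 a : R, 0 <= a <= 1 &
    G (x + t *: u) - G x = dd G (x + (t * a) *: u) (t *: u).
  have [|a ha] := @mvt_line _ _ G x (t *: u).
    by move=> a ha; rewrite scalerA mulrC; exact: (dG a ha).1.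
  by rewrite scalerA [a * t]mulrC => ?; exists a.
have [_ Ga] := dG a ha; rewrite ddZl Ga /G => GE.
have -> : f (x + t *: u + t *: v) - f (x + t *: u) - f (x + t *: v) + f x =
    f (x + t *: u + t *: v) - f (x + t *: u) - (f (x + t *: v) - f x).
  by rewrite opprB addrA addrAC.
rewrite GE; have A1 := FE a 1 ha h1; have A0 := FE a 0 ha h0.
move: A1 A0; rewrite mulr1 mulr0 scale0r !addr0 [in dd F x (_ + _)]linearD /=.
rewrite [in dd F x (t *: v)]linearZ /= /GRing.scale /=.
set p := F (x + _ + _); set q := F (x + _); set L := dd F x _; set D := dd F x v.
move=> A1 A0; rewrite expr2 -mulrA -mulrBr normrM (gtr0_norm t0).
rewrite mulrA [e * t]mulrC -mulrA; apply: ler_wpM2l; first exact: ltW.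
have -> : p - q - t * D = (p - F x - (L + t * D)) - (q - F x - L) by ring.
apply: (le_trans (ler_normB _ _)); apply: (le_trans (lerD A1 A0)).
by rewrite -mulrDl -splitr.
Qed.

(** The second difference is symmetric in u and v, so t^2 times either mixed derivative approximates
    it within e t^2 / 2. *)
Lemma schwarz u v :
  differentiable (fun y => dd f y u) x -> differentiable (fun y => dd f y v) x ->
  dd (fun y => dd f y u) x v = dd (fun y => dd f y v) x u.
Proof.
move=> du dv; apply/eqP; rewrite -subr_eq0 -normr_eq0 eq_le normr_ge0 andbT.
apply/ler_addgt0Pl => e e0; rewrite addr0.
have e20 : 0 < e / 2 by rewrite divr_gt0.
have [d1 d10 H1] := second_difference v du e20.
have [d2 d20 H2] := second_difference u dv e20.
pose t := Num.min d1 d2 / 2.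
have t0 : 0 < t by rewrite divr_gt0 // lt_min d10.
have t1 : t < d1 by rewrite /t ltr_pdivrMr // gt_min ltr_pMr // ltr1n.
have t2 : t < d2.
  by rewrite /t ltr_pdivrMr // gt_min [X in _ || X]ltr_pMr // ltr1n orbT.
have := H1 t; rewrite t0 t1 => /(_ isT) {}H1.
have := H2 t; rewrite t0 t2 => /(_ isT) {}H2.
have t20 : 0 < t ^+ 2 by rewrite exprn_gt0.
rewrite -(ler_pM2l t20) -{1}(gtr0_norm t20) -normrM mulrBr.
move: H1 H2; rewrite [x + t *: v + _]addrAC.
set p := f _; set q := f (x + t *: u); set r := f (x + t *: v).
set A := t ^+ 2 * _; set B := t ^+ 2 * _ => H1 H2.
have -> : A - B = (p - r - q + f x - B) - (p - q - r + f x - A) by ring.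
apply: (le_trans (ler_normB _ _)); apply: (le_trans (lerD H2 H1)).
by rewrite -mulrDl -splitr mulrC.
Qed.

End Schwarz.

Lemma smooth_schwarz (R : realType) (V : normedModType R) (U : set V)
    (f : V -> R) x u v : open U -> U x -> smooth_on U f ->
  dd (fun y => dd f y u) x v = dd (fun y => dd f y v) x u.
Proof.
move=> oU Ux sf; apply: (schwarz oU Ux).
- by move=> y; exact: smooth_differentiable.
- exact: smooth_differentiable (smooth_dd u sf) Ux.
- exact: smooth_differentiable (smooth_dd v sf) Ux.
Qed.

(** * Real coordinates and estimates on boxes *)

Section Coordinates.
Variables (R : realType) (n : nat).
Let V : normedModType R := Cspace R n.
Implicit Types (v w : V) (k : 'I_(n + n)).

(** One index set for all real coordinates: the real parts first, then the imaginary parts. *)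
Definition crd k v : R := row_mx v.1 v.2 0 k.

Definition ebase k : V := (lsubmx (delta_mx 0 k), rsubmx (delta_mx 0 k)).

Definition of_crd (x : 'rV[R]_(n + n)) : V := (lsubmx x, rsubmx x).

Lemma crd_lin k : linear (crd k : V -> R).
Proof.
move=> a v w; rewrite /crd -[a *: v + w]/(a *: v.1 + w.1, a *: v.2 + w.2) /=.
by rewrite -add_row_mx -scale_row_mx !mxE.
Qed.

HB.instance Definition _ k := GRing.isLinear.Build R V R *:%R (crd k) (crd_lin k).

Lemma crd_lshift v (i : 'I_n) : crd (lshift n i) v = v.1 0 i.
Proof. by rewrite /crd row_mxEl. Qed.

Lemma crd_rshift v (i : 'I_n) : crd (rshift n i) v = v.2 0 i.
Proof. by rewrite /crd row_mxEr. Qed.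

Lemma crd_ext v w : (forall k, crd k v = crd k w) -> v = w.
Proof.
case: v w => [x y] [x' y'] H; have E : row_mx x y = row_mx x' y'.
  by apply/rowP => k; exact: H.
by have [-> ->] := eq_row_mx E.
Qed.

Lemma crd_of x k : crd k (of_crd x) = x 0 k.
Proof. by rewrite /crd /= hsubmxK. Qed.

Lemma crd_ebase k l : crd k (ebase l) = (k == l)%:R.
Proof. by rewrite /crd /= hsubmxK mxE. Qed.

Lemma crd_sum v : v = \sum_k crd k v *: ebase k.
Proof.
apply: crd_ext => k; rewrite raddf_sum /= (bigD1 k) //= big1 ?addr0.
  by rewrite linearZ /= crd_ebase eqxx [LHS](esym (mulr1 _)).
move=> l lk; rewrite linearZ /= crd_ebase eq_sym (negbTE lk).
by rewrite [LHS]mulr0.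
Qed.

Lemma mx_norm_coord (x : 'rV[R]_n) i : `|x 0 i| <= `|x|.
Proof.
have /mapP[j Hj ->] : `|x ord0 i| \in [seq `|x z.1 z.2| | z : 'I_1 * 'I_n].
  by apply/mapP; exists (ord0, i) => //=; rewrite mem_enum.
by rewrite [leRHS]/Num.norm /= mx_normrE; apply/bigmax_geP; right => /=; exists j.
Qed.

Lemma mx_norm_le (x : 'rV[R]_n) b : 0 <= b -> (forall i, `|x 0 i| <= b) ->
  `|x| <= b.
Proof.
move=> b0 H; rewrite [leLHS]/Num.norm /= mx_normrE; apply/bigmax_leP; split => //=.
by case=> i j _ /=; rewrite ord1.
Qed.

Lemma crd_le k v : `|crd k v| <= `|v|.
Proof.
rewrite /crd -[k]splitK; case: (fintype.split k) => i /=.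
  by rewrite row_mxEl; apply: (le_trans (mx_norm_coord _ _)); rewrite prod_normE le_max lexx.
by rewrite row_mxEr; apply: (le_trans (mx_norm_coord _ _)); rewrite prod_normE le_max lexx orbT.
Qed.

Lemma norm_crd v b : 0 <= b -> (forall k, `|crd k v| <= b) -> `|v| <= b.
Proof.
move=> b0 H; rewrite prod_normE ge_max; apply/andP; split.
  by apply: mx_norm_le => // i; rewrite -crd_lshift; exact: H.
by apply: mx_norm_le => // i; rewrite -crd_rshift; exact: H.
Qed.

Lemma lin_cont (W : normedModType R) (L : {linear V -> W}) : continuous L.
Proof.
apply/linear_bounded_continuous/linear_boundedP.
exists (\sum_k `|L (ebase k)|); split; first exact: num_real.
move=> M HM v; rewrite [in L v](crd_sum v) linear_sum.
apply: (le_trans (ler_norm_sum _ _ _)).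
apply: (@le_trans _ _ ((\sum_k `|L (ebase k)|) * `|v|)); last by apply: ler_wpM2r => //; exact: ltW.
rewrite mulr_suml; apply: ler_sum => k _.
by rewrite linearZ /= normrZ mulrC; apply: ler_wpM2l => //; exact: crd_le.
Qed.

Lemma lin_crd (W : lmodType R) (L : {linear V -> W}) v :
  L v = \sum_k crd k v *: L (ebase k).
Proof. by rewrite {1}(crd_sum v) linear_sum; apply: eq_bigr => k _; rewrite linearZ. Qed.

Lemma lin_crdR (L : {linear V -> R}) v : L v = \sum_k crd k v * L (ebase k).
Proof. exact: lin_crd. Qed.

Lemma lin_boundR (L : {linear V -> R}) (e : R) : 
  (forall k, `|L (ebase k)| <= e) -> forall v, `|L v| <= (n + n)%:R * e * `|v|.
Proof.
move=> H v; rewrite lin_crdR; apply: (le_trans (ler_norm_sum _ _ _)).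
apply: (@le_trans _ _ (\sum_(k < n + n) e * `|v|)).
  apply: ler_sum => k _; rewrite normrM mulrC.
  by apply: ler_pM => //; exact: crd_le.
by rewrite sumr_const card_ord -mulrA mulr_natl.
Qed.

Lemma lin_subR (L L' : {linear V -> R}) v :
  `|L v - L' v| <= (\sum_k `|L (ebase k) - L' (ebase k)|) * `|v|.
Proof.
rewrite (lin_crdR L) (lin_crdR L') -sumrB.
apply: (le_trans (ler_norm_sum _ _ _)).
rewrite mulr_suml; apply: ler_sum => k _; rewrite -mulrBr normrM mulrC.
by apply: ler_wpM2l => //; exact: crd_le.
Qed.

Definition closed_box (x : V) (r : R) : set V := [set y | `|y - x| <= r].

Lemma closed_box_compact x r : compact (closed_box x r).
Proof.
pose A (a : 'rV[R]_n) := [set b : 'rV[R]_n | `|b - a| <= r].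
have cA a : compact (A a).
  apply: bounded_closed_compact.
    exists (r + `|a|); split; first exact: num_real.
    move=> M HM b Ab; apply: ltW; apply: le_lt_trans HM.
    by rewrite -[b](subrK a); apply: (le_trans (ler_normD _ _)); rewrite lerD2r.
  rewrite (_ : A a = closed_ball_ Num.norm a r); first exact: closed_closed_ball_.
  by apply/seteqP; split => y; rewrite /A /closed_ball_ /= distrC.
apply: (subclosed_compact _ (compact_setX (cA x.1) (cA x.2))).
  rewrite (_ : closed_box x r = closed_ball_ Num.norm x r); first exact: closed_closed_ball_.
  by apply/seteqP; split => y; rewrite /closed_box /closed_ball_ /= distrC.
move=> y; rewrite /closed_box /= prod_normE ge_max => /andP[] //.
Qed.

Lemma Ck_coords (V' : normedModType R) (p : nat) (U : set V') (f : V' -> V) : open U ->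
  (forall j, Ck p U (fun x => crd j (f x))) -> Ck p U f.
Proof.
move=> oU H; apply: (Ck_eq oU (f := fun x => \sum_j crd j (f x) *: ebase j)).
  by move=> x _; rewrite -crd_sum.
by apply: Ck_sum => // j _; apply: Ck_scalel.
Qed.

Lemma Ck_crd (V' : normedModType R) (p : nat) (U : set V') (f : V' -> V) j : open U ->
  Ck p U f -> Ck p U (fun x => crd j (f x)).
Proof. by move=> oU; apply: Ck_lin => //; exact: lin_cont. Qed.

Lemma dd_crd (V' : normedModType R) (f : V' -> V) x h j : differentiable f x ->
  dd (fun y => crd j (f y)) x h = crd j (dd f x h).
Proof. by move=> df; rewrite dd_lin //; exact: lin_cont. Qed.

End Coordinates.

Section Estimates.
Variables (R : realType) (n : nat).
Let V : normedModType R := Cspace R n.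
Implicit Types (U : set V) (f : V -> R) (x y : V).

Lemma open_closed_box U x : open U -> U x ->
  exists2 r : R, 0 < r & closed_box x r `<=` U.
Proof.
move=> oU Ux; have /nbhs_normP[d d0 H] : nbhs x U by exact: open_nbhs_nbhs.
exists (d / 2); first by rewrite divr_gt0.
move=> y /= yd; apply: H => /=; rewrite distrC; apply: le_lt_trans yd _.
by rewrite ltr_pdivrMr // ltr_pMr // ltr1n.
Qed.

Lemma lip_small U f x0 (e : R) : open U -> U x0 -> Ck 1 U f ->
  (forall v, dd f x0 v = 0) -> 0 < e ->
  exists2 r : R, 0 < r & forall x y, `|x - x0| <= r -> `|y - x0| <= r ->
    `|f y - f x| <= e * `|y - x|.
Proof.
move=> oU Ux0 C1 df0 e0; have cf v := Ck_dd v C1; have [df _] := C1.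
(* [lin_boundR] costs a factor n + n; the successor keeps the denominator nonzero when n = 0. *)
pose e' := e / (n + n).+1%:R; have e'0 : 0 < e' by rewrite divr_gt0.
have near_k k : \forall y \near x0, `|dd f y (ebase R k)| <= e'.
  have c : dd f y (ebase R k) @[y --> x0] --> (0 : R).
    by rewrite -(df0 (ebase R k)); exact: cf.
  have /cvgr0_norm_le := c; exact.
have nU := open_nbhs_nbhs (conj oU Ux0).
have /nbhs_normP[d d0 H] :
    nbhs x0 (U `&` [set y | forall k, `|dd f y (ebase R k)| <= e']).
  exact: filterI nU (filter_forall _ near_k).
exists (d / 2); first by rewrite divr_gt0.
apply: lip_ball => y yd; have [|Uy Hy] := H y.
  rewrite /= distrC; apply: le_lt_trans yd _.
  by rewrite ltr_pdivrMr // ltr_pMr // ltr1n.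
split=> [|v]; first exact: df.
apply: (le_trans (lin_boundR Hy v)); apply: ler_wpM2r => //.
by rewrite /e' mulrCA ler_piMr ?(ltW e0) // ler_pdivrMr // mul1r ler_nat.
Qed.

Lemma compact_bound (K : set V) f : compact K ->
  (forall x, K x -> {for x, continuous f}) ->
  exists2 C : R, 0 <= C & forall x, K x -> `|f x| <= C.
Proof.
move=> cK cf; have [[x Kx]|K0] := pselect (K !=set0); last first.
  by exists 0 => // x Kx; exfalso; apply: K0; exists x.
have cfK : {within K, continuous (fun y => `|f y|)}.
  apply: continuous_in_subspaceT => y /[!inE] Ky.
  by apply: (@continuous_comp _ _ _ f Num.norm); [exact: cf|exact: norm_continuous].
have [c /[!inE] Kc H] := compact_EVT_max (ex_intro _ x Kx) cK cfK.
by exists `|f c| => // y Ky; apply: H; rewrite inE.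
Qed.

Lemma lipschitz_box U f x0 (r : R) : open U -> closed_box x0 r `<=` U -> Ck 1 U f ->
  exists2 C : R, 0 <= C & forall x y, closed_box x0 r x -> closed_box x0 r y ->
    `|f y - f x| <= C * `|y - x|.
Proof.
move=> oU KU C1; have cf v := Ck_dd v C1; have [df _] := C1.
have H k : exists C : R, 0 <= C /\ forall x, closed_box x0 r x -> `|dd f x (ebase R k)| <= C.
  have [C C0 HC] := compact_bound (@closed_box_compact R n x0 r)
    (fun x Kx => cf (ebase R k) x (KU x Kx)).
  by exists C.
have [C HC] := choice H; pose D := \sum_k C k.
have D0 : 0 <= D by apply: sumr_ge0 => k _; exact: (HC k).1.
exists ((n + n)%:R * D); first by rewrite mulr_ge0.
apply: lip_ball => y Ky; split=> [|v]; first exact/df/KU.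
apply: lin_boundR => k; apply: (le_trans ((HC k).2 y Ky)).
by rewrite /D (bigD1 k) //= lerDl sumr_ge0 // => l _; exact: (HC l).1.
Qed.

Lemma box_seg x0 (r t : R) x y : closed_box x0 r x -> closed_box x0 r y ->
  0 <= t <= 1 -> closed_box x0 r (x + t *: (y - x)).
Proof.
rewrite /closed_box /= => xr yr /andP[t0 t1].
have -> : x + t *: (y - x) - x0 = (1 - t) *: (x - x0) + t *: (y - x0).
  have -> : y - x = (y - x0) - (x - x0) by rewrite opprB addrA subrK.
  by rewrite scalerBr scalerBl scale1r addrAC [RHS]addrAC -[RHS]addrA.
apply: (le_trans (ler_normD _ _)); rewrite !normrZ.
rewrite (ger0_norm t0) ger0_norm ?subr_ge0 //.
apply: (@le_trans _ _ ((1 - t) * r + t * r)).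
  by apply: lerD; apply: ler_wpM2l; rewrite ?subr_ge0.
by rewrite -mulrDl subrK mul1r.
Qed.

(** The mean value theorem replaces the increment by a derivative at an intermediate point, and the
    partial derivatives are Lipschitz on the box. *)
Lemma taylor_box U f x0 (r : R) : open U -> closed_box x0 r `<=` U -> Ck 2 U f ->
  exists2 C : R, 0 <= C & forall x y, closed_box x0 r x -> closed_box x0 r y ->
    `|f y - f x - dd f x (y - x)| <= C * `|y - x| ^+ 2.
Proof.
move=> oU KU Cf; have C1f v := Ck_dd v Cf; have [df _] := Cf.
have H k : exists C : R, 0 <= C /\ forall x y, closed_box x0 r x -> closed_box x0 r y ->
    `|dd f y (ebase R k) - dd f x (ebase R k)| <= C * `|y - x|.
  by have [C C0 HC] := lipschitz_box oU KU (C1f (ebase R k)); exists C.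
have [C HC] := choice H; pose D := \sum_k C k.
have D0 : 0 <= D by apply: sumr_ge0 => k _; exact: (HC k).1.
exists D; first exact: D0.
move=> x y Kx Ky.
have [t t01] := @mvt_line _ _ f x (y - x)
  (fun t t01 => df _ (KU _ (box_seg Kx Ky t01))).
rewrite [x + (y - x)]addrC subrK => ->; set z := x + _.
have Kz : closed_box x0 r z by exact: box_seg.
have zx : `|z - x| <= `|y - x|.
  rewrite /z addrAC subrr add0r normrZ; case/andP: t01 => t0 t1.
  by rewrite ger0_norm // ler_piMl.
clearbody z; apply: (le_trans (lin_subR (dd f z) (dd f x) (y - x))).
rewrite expr2 mulrA; apply: ler_wpM2r; first exact: normr_ge0.
rewrite /D mulr_suml; apply: ler_sum => k _.
apply: (le_trans ((HC k).2 x z Kx Kz)); apply: ler_wpM2l; first exact: (HC k).1.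
exact: zx.
Qed.

End Estimates.

(** * Holomorphic functions *)

Section ComplexNumbers.
Variable R : realType.
Implicit Types (x y : R[i]) (a : R).

Definition iC : R[i] := Complex 0 1.

Lemma cplx_ext x y : complex.Re x = complex.Re y -> complex.Im x = complex.Im y -> x = y.
Proof. by case: x => a b; case: y => c d /= -> ->. Qed.

Lemma cReD x y : complex.Re (x + y) = complex.Re x + complex.Re y.
Proof. by case: x; case: y. Qed.
Lemma cImD x y : complex.Im (x + y) = complex.Im x + complex.Im y.
Proof. by case: x; case: y. Qed.
Lemma cReM x y : complex.Re (x * y) =
  complex.Re x * complex.Re y - complex.Im x * complex.Im y.
Proof. by case: x; case: y. Qed.
Lemma cImM x y : complex.Im (x * y) =
  complex.Re x * complex.Im y + complex.Im x * complex.Re y.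
Proof. by case: x; case: y. Qed.
Lemma cReN x : complex.Re (- x) = - complex.Re x. Proof. by case: x. Qed.
Lemma cReV x : complex.Re x^-1 =
  complex.Re x / (complex.Re x ^+ 2 + complex.Im x ^+ 2).
Proof. by case: x. Qed.
Lemma cImV x : complex.Im x^-1 =
  - (complex.Im x / (complex.Re x ^+ 2 + complex.Im x ^+ 2)).
Proof. by case: x. Qed.
Lemma csqn_neq0 x : x != 0 -> complex.Re x ^+ 2 + complex.Im x ^+ 2 != 0.
Proof.
apply: contra_neq => /eqP; rewrite paddr_eq0 ?sqr_ge0 // !sqrf_eq0.
by case/andP => /eqP re0 /eqP im0; apply: cplx_ext.
Qed.

End ComplexNumbers.
Arguments iC {R}.

Section CspaceVectors.
Variable R : realType.
Implicit Types n m : nat.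

Definition uncvec n (z : 'rV[R[i]]_n) : Cspace R n :=
  (map_mx (@complex.Re R) z, map_mx (@complex.Im R) z).

Lemma uncvecK n : cancel (@uncvec n) (@cvec R n).
Proof. by move=> z; apply/rowP => j; rewrite !mxE; case: (z 0 j). Qed.

Lemma cvecK n : cancel (@cvec R n) (@uncvec n).
Proof. by case=> x y; congr pair; apply/rowP => j; rewrite !mxE. Qed.

Lemma cvec_inj n : injective (@cvec R n). Proof. exact: can_inj (@cvecK n). Qed.

Lemma cvecD n (v w : Cspace R n) : cvec (v + w) = cvec v + cvec w.
Proof. by apply/rowP => j; rewrite !mxE. Qed.

Lemma cvec0 n : cvec (0 : Cspace R n) = 0.
Proof. by apply/rowP => j; rewrite !mxE. Qed.

Lemma cvecZ n (a : R) (v : Cspace R n) : cvec (a *: v) = Complex a 0 *: cvec v.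
Proof.
by apply/rowP => j; rewrite !mxE; apply: cplx_ext => /=;
   rewrite ?mul0r ?subr0 ?addr0.
Qed.

Lemma cvecJ n (v : Cspace R n) : cvec (Jmul v) = iC *: cvec v.
Proof.
by apply/rowP => j; rewrite !mxE; apply: cplx_ext => /=;
   rewrite !mul0r mul1r ?sub0r ?add0r.
Qed.

Lemma JmulK n (v : Cspace R n) : Jmul (Jmul v) = - v.
Proof. by case: v. Qed.

Lemma JmulD n (v w : Cspace R n) : Jmul (v + w) = Jmul v + Jmul w.
Proof. by rewrite /Jmul /= opprD. Qed.

Lemma JmulZ n a (v : Cspace R n) : Jmul (a *: v) = a *: Jmul v.
Proof. by apply: cvec_inj; rewrite cvecZ !cvecJ cvecZ !scalerA mulrC. Qed.

Definition cbase n (j : 'I_n) : Cspace R n := uncvec (delta_mx 0 j).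

Lemma cvec_cbase n (j : 'I_n) : cvec (cbase j) = delta_mx 0 j.
Proof. exact: uncvecK. Qed.

Lemma cspace_sum n (v : Cspace R n) :
  v = \sum_j (v.1 0 j *: cbase j + v.2 0 j *: Jmul (cbase j)).
Proof.
apply: cvec_inj; rewrite (big_morph _ (@cvecD n) (@cvec0 n)).
under eq_bigr => j _ do rewrite cvecD !cvecZ cvecJ cvec_cbase scalerA -scalerDl.
rewrite {1}[cvec v]row_sum_delta; apply: eq_bigr => j _; congr (_ *: _).
by rewrite mxE; apply: cplx_ext => /=; rewrite !(mul0r, mulr0, mulr1, subr0, addr0, add0r).
Qed.

End CspaceVectors.

Section HolomorphicFunctions.
Variables (R : realType) (n : nat).
Let V : normedModType R := Cspace R n.
Implicit Types (U : set V) (g h : V -> R[i]) (x v : V).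

Definition cRe g : V -> R := fun x => complex.Re (g x).
Definition cIm g : V -> R := fun x => complex.Im (g x).

Definition Dc g x v : R[i] := Complex (dd (cRe g) x v) (dd (cIm g) x v).

Variant cdiff g x : Prop :=
  CDiff of differentiable (cRe g) x & differentiable (cIm g) x.

(** Scalar counterpart of [holomorphic_on], with values in R[i], where products and inverses make
    sense. *)
Variant hol U g : Prop :=
  Hol of smooth_on U (cRe g) & smooth_on U (cIm g) &
    forall x, U x -> forall v, Dc g x (Jmul v) = iC * Dc g x v.

Lemma hol_cdiff U g x : hol U g -> U x -> cdiff g x.
Proof. by move=> [re im _] Ux; split; [apply: (re 1).1|apply: (im 1).1]. Qed.

Lemma Dc_eq U g h x v : open U -> U x -> (forall y, U y -> g y = h y) ->
  cdiff g x -> Dc h x v = Dc g x v.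
Proof.
move=> oU Ux gh [dre dim].
have [_ re] := @dd_eq_on _ _ _ U (cRe g) (cRe h) x v oU Ux
  (fun y Uy => congr1 (@complex.Re R) (gh y Uy)) dre.
have [_ im] := @dd_eq_on _ _ _ U (cIm g) (cIm h) x v oU Ux
  (fun y Uy => congr1 (@complex.Im R) (gh y Uy)) dim.
by rewrite /Dc re im.
Qed.

Lemma hol_eq U g h : open U -> (forall y, U y -> g y = h y) -> hol U g -> hol U h.
Proof.
move=> oU gh hg; have [re im cr] := hg; split.
- by move=> k; apply: (Ck_eq oU) (re k) => y Uy; rewrite /cRe gh.
- by move=> k; apply: (Ck_eq oU) (im k) => y Uy; rewrite /cIm gh.
move=> x Ux v; rewrite !(Dc_eq _ oU Ux gh) ?cr //; exact: hol_cdiff Ux.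
Qed.

Lemma DcD g h x v : cdiff g x -> cdiff h x ->
  cdiff (fun y => g y + h y) x /\
  Dc (fun y => g y + h y) x v = Dc g x v + Dc h x v.
Proof.
move=> [rg ig] [rh ih].
have re : cRe (fun y => g y + h y) = fun y => cRe g y + cRe h y.
  by apply/funext => y; exact: cReD.
have im : cIm (fun y => g y + h y) = fun y => cIm g y + cIm h y.
  by apply/funext => y; exact: cImD.
split; first by split; rewrite ?re ?im; exact: differentiableD.
by rewrite /Dc re im (ddD v rg rh) (ddD v ig ih).
Qed.

Lemma DcM g h x v : cdiff g x -> cdiff h x ->
  cdiff (fun y => g y * h y) x /\
  Dc (fun y => g y * h y) x v = g x * Dc h x v + h x * Dc g x v.
Proof.
move=> [rg ig] [rh ih].
have re : cRe (fun y => g y * h y) = fun y => cRe g y * cRe h y + - (cIm g y * cIm h y).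
  by apply/funext => y; exact: cReM.
have im : cIm (fun y => g y * h y) = fun y => cRe g y * cIm h y + cIm g y * cRe h y.
  by apply/funext => y; exact: cImM.
have [d1 d2 d3 d4] : [/\ differentiable (fun y => cRe g y * cRe h y) x,
    differentiable (fun y => cIm g y * cIm h y) x,
    differentiable (fun y => cRe g y * cIm h y) x &
    differentiable (fun y => cIm g y * cRe h y) x].
  by split; exact: differentiableM.
have d5 : differentiable (fun y => - (cIm g y * cIm h y)) x by exact: differentiableN.
split; first by split; rewrite ?re ?im; exact: differentiableD.
rewrite /Dc re im (ddD v d1 d5) (ddD v d3 d4) (ddN v d2).
rewrite (ddM v rg rh) (ddM v ig ih) (ddM v rg ih) (ddM v ig rh).
by apply: cplx_ext; rewrite ?cReD ?cImD ?cReM ?cImM /=; rewrite /cRe /cIm; ring.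
Qed.

Lemma hol_cst U c : open U -> hol U (fun=> c).
Proof.
move=> oU; split; [by move=> k; exact: Ck_cst..|].
move=> x Ux v; rewrite /Dc /cRe /cIm !dd_cst /=.
by apply: cplx_ext; rewrite ?cReM ?cImM /= !mulr0 ?subr0 ?addr0.
Qed.

Lemma Dc_cst c x v : Dc (fun=> c) x v = 0.
Proof. by rewrite /Dc /cRe /cIm !dd_cst. Qed.

Lemma hol_add U g h : open U -> hol U g -> hol U h -> hol U (fun x => g x + h x).
Proof.
move=> oU hg hh; have [rg ig cg] := hg; have [rh ih ch] := hh; split.
- move=> k; apply: (Ck_eq oU) (Ck_add oU (rg k) (rh k)) => x _; by rewrite -cReD.
- move=> k; apply: (Ck_eq oU) (Ck_add oU (ig k) (ih k)) => x _; by rewrite -cImD.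
move=> x Ux v; have dg := hol_cdiff hg Ux; have dh := hol_cdiff hh Ux.
by rewrite !(DcD _ dg dh).2 cg // ch // mulrDr.
Qed.

Lemma hol_mul U g h : open U -> hol U g -> hol U h -> hol U (fun x => g x * h x).
Proof.
move=> oU hg hh; have [rg ig cg] := hg; have [rh ih ch] := hh; split.
- move=> k; apply: (Ck_eq oU) (Ck_add oU (Ck_mul oU (rg k) (rh k))
    (Ck_opp oU (Ck_mul oU (ig k) (ih k)))) => x _; by rewrite -cReM.
- move=> k; apply: (Ck_eq oU) (Ck_add oU (Ck_mul oU (rg k) (ih k))
    (Ck_mul oU (ig k) (rh k))) => x _; by rewrite -cImM.
move=> x Ux v; have dg := hol_cdiff hg Ux; have dh := hol_cdiff hh Ux.
by rewrite !(DcM _ dg dh).2 cg // ch // mulrDr !mulrA ![_ * iC]mulrC.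
Qed.

Lemma hol_opp U g : open U -> hol U g -> hol U (fun x => - g x).
Proof.
move=> oU hg; apply: (hol_eq oU) (hol_mul oU (hol_cst (-1) oU) hg) => x _.
by rewrite mulN1r.
Qed.

Lemma hol_sum U (I : Type) (r : seq I) (P : pred I) (g : I -> V -> R[i]) :
  open U -> (forall i, P i -> hol U (g i)) -> hol U (fun x => \sum_(i <- r | P i) g i x).
Proof.
move=> oU hg; elim: r => [|i r IH].
  by under eq_fun do rewrite big_nil; exact: hol_cst.
under eq_fun do rewrite big_cons; case: (boolP (P i)) => [Pi|_]; last exact: IH.
exact: hol_add oU (hg i Pi) IH.
Qed.

Lemma hol_prod U (I : Type) (r : seq I) (P : pred I) (g : I -> V -> R[i]) :
  open U -> (forall i, P i -> hol U (g i)) -> hol U (fun x => \prod_(i <- r | P i) g i x).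
Proof.
move=> oU hg; elim: r => [|i r IH].
  by under eq_fun do rewrite big_nil; exact: hol_cst.
under eq_fun do rewrite big_cons; case: (boolP (P i)) => [Pi|_]; last exact: IH.
exact: hol_mul oU (hg i Pi) IH.
Qed.

Lemma hol_inv U g : open U -> (forall x, U x -> g x != 0) -> hol U g ->
  hol U (fun x => (g x)^-1).
Proof.
move=> oU g0 hg; have [rg ig cg] := hg.
have n0 x : U x -> cRe g x * cRe g x + cIm g x * cIm g x != 0.
  by move=> Ux; have := csqn_neq0 (g0 x Ux); rewrite !expr2.
have sn k : Ck k U (fun x => (cRe g x * cRe g x + cIm g x * cIm g x)^-1).
  by apply: Ck_inv => //; apply: Ck_add => //; exact: Ck_mul.
have re k : Ck k U (cRe (fun x => (g x)^-1)).
  by apply: (Ck_eq oU) (Ck_mul oU (rg k) (sn k)) => x _; rewrite -!expr2 -cReV.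
have im k : Ck k U (cIm (fun x => (g x)^-1)).
  by apply: (Ck_eq oU) (Ck_opp oU (Ck_mul oU (ig k) (sn k))) => x _; rewrite -!expr2 -cImV.
split; [exact: re|exact: im|] => x Ux v; have dg := hol_cdiff hg Ux.
have dV : cdiff (fun x => (g x)^-1) x by split; [exact: (re 1).1|exact: (im 1).1].
(* The Cauchy-Riemann equations for 1/g are read off from the product rule for g (1/g) = 1. *)
have gg w : g x * Dc (fun y => (g y)^-1) x w = - ((g x)^-1 * Dc g x w).
  apply/eqP; rewrite -addr_eq0 -(DcM w dg dV).2; apply/eqP.
  rewrite (Dc_eq _ oU Ux (g := fun=> 1)) ?Dc_cst //.
    by move=> y Uy; rewrite divff // g0.
  by apply: hol_cdiff (hol_cst 1 oU) Ux.
apply: (mulfI (g0 x Ux)); rewrite gg mulrCA gg cg //.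
by rewrite mulrN mulrCA.
Qed.

(** By Schwarz the derivative along Jmul w can be taken first; there the Cauchy-Riemann equations of
    g apply, and differentiating them along v gives those of the directional derivative. *)
Lemma hol_Dc U g v : open U -> hol U g -> hol U (fun x => Dc g x v).
Proof.
move=> oU [rg ig cg]; split; [exact: smooth_dd|exact: smooth_dd|].
move=> x Ux w; rewrite /Dc.
rewrite -[cRe (fun _ => _)]/(fun y => dd (cRe g) y v).
rewrite -[cIm (fun _ => _)]/(fun y => dd (cIm g) y v).
rewrite !(smooth_schwarz v _ oU Ux) //.
have CR y : U y -> dd (cRe g) y (Jmul w) = - dd (cIm g) y w /\
                   dd (cIm g) y (Jmul w) = dd (cRe g) y w.
  move=> Uy; have := cg y Uy w; rewrite /Dc => /[dup].
  move=> /(congr1 (@complex.Re R)) /= E1 /(congr1 (@complex.Im R)) /= E2.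
  by rewrite E1 E2 !mul0r !mul1r sub0r add0r.
have dIm := smooth_differentiable (smooth_dd w ig) Ux.
have dRe := smooth_differentiable (smooth_dd w rg) Ux.
have [_ ->] := dd_eq_on v oU Ux (fun y Uy => esym (CR y Uy).1) (differentiableN dIm).
have [_ ->] := dd_eq_on v oU Ux (fun y Uy => esym (CR y Uy).2) dRe.
rewrite ddN //.
by apply: cplx_ext => /=; rewrite !mul0r !mul1r ?sub0r ?add0r.
Qed.

Lemma DcDl g x v w : Dc g x (v + w) = Dc g x v + Dc g x w.
Proof. by rewrite /Dc !ddDl. Qed.

Lemma Dc0 g x : Dc g x 0 = 0.
Proof. by rewrite /Dc !dd0l. Qed.

Lemma DcZl g x (a : R) v : Dc g x (a *: v) = Complex a 0 * Dc g x v.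
Proof.
rewrite /Dc !ddZl /=;
by apply: cplx_ext => /=; rewrite mul0r ?subr0 ?addr0.
Qed.

Lemma Dc_cbase U g x v : hol U g -> U x ->
  Dc g x v = \sum_j cvec v 0 j * Dc g x (cbase R j).
Proof.
move=> [_ _ cg] Ux; rewrite {1}(cspace_sum v) (big_morph _ (DcDl g x) (Dc0 g x)).
apply: eq_bigr => j _; rewrite DcDl !DcZl cg // mulrA -mulrDl; congr (_ * _).
by rewrite mxE; apply: cplx_ext => /=; rewrite !(mul0r, mulr0, mulr1, subr0, addr0, add0r).
Qed.

End HolomorphicFunctions.

Section HolomorphicMaps.
Variables (R : realType) (n m : nat).
Let V : normedModType R := Cspace R n.
Let W : normedModType R := Cspace R m.
Implicit Types (U : set V) (G : V -> W).

Lemma hol_coord U G j : open U -> holomorphic_on U G ->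
  hol U (fun x => cvec (G x) 0 j).
Proof.
move=> oU [sG cG].
have re : cRe (fun x => cvec (G x) 0 j) = (fun x => crd (lshift m j) (G x)).
  by apply/funext => x; rewrite /cRe mxE crd_lshift.
have im : cIm (fun x => cvec (G x) 0 j) = (fun x => crd (rshift m j) (G x)).
  by apply/funext => x; rewrite /cIm mxE crd_rshift.
split; [by rewrite re => k; exact: Ck_crd oU (sG k)|by rewrite im => k; exact: Ck_crd oU (sG k)|].
move=> x Ux v; have dG : differentiable G x by apply: (sG 1).1.
rewrite /Dc re im !(dd_crd _ _ dG) !ddE (cG x Ux) !crd_lshift !crd_rshift.
by apply: cplx_ext => /=; rewrite ?mxE !mul0r !mul1r ?sub0r ?add0r.
Qed.

Lemma Dc_coord G j x v : differentiable G x ->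
  Dc (fun y => cvec (G y) 0 j) x v = cvec (dd G x v) 0 j.
Proof.
move=> dG.
have re : cRe (fun x => cvec (G x) 0 j) = (fun x => crd (lshift m j) (G x)).
  by apply/funext => y; rewrite /cRe mxE crd_lshift.
have im : cIm (fun x => cvec (G x) 0 j) = (fun x => crd (rshift m j) (G x)).
  by apply/funext => y; rewrite /cIm mxE crd_rshift.
by rewrite /Dc re im !(dd_crd _ _ dG) crd_lshift crd_rshift mxE.
Qed.

Lemma holomorphic_coords U G : open U ->
  (forall j, hol U (fun x => cvec (G x) 0 j)) -> holomorphic_on U G.
Proof.
move=> oU hG; have sG : smooth_on U G.
  move=> k; apply: Ck_coords => // l; rewrite -[l]splitK; case: (fintype.split l) => j /=.
    have [re _ _] := hG j; apply: (Ck_eq oU) (re k) => x _.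
    by rewrite /cRe mxE crd_lshift.
  have [_ im _] := hG j; apply: (Ck_eq oU) (im k) => x _.
  by rewrite /cIm mxE crd_rshift.
split=> // x Ux v; have dG : differentiable G x by apply: (sG 1).1.
apply: cvec_inj; apply/rowP => j; have [_ _ cr] := hG j.
by rewrite -!ddE cvecJ [RHS]mxE -!(Dc_coord _ _ dG) cr.
Qed.

Lemma hol_aff U (g : V -> R[i]) (L : {linear W -> V}) a :
  open U -> (forall v, L (Jmul v) = Jmul (L v)) -> hol U g ->
  hol ((fun x => a + L x) @^-1` U) (fun x => g (a + L x)) /\
  forall x v, U (a + L x) -> Dc (fun y => g (a + L y)) x v = Dc g (a + L x) (L v).
Proof.
move=> oU LJ hg; have [rg ig cg] := hg; have Lc := @lin_cont _ _ _ L.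
have dA x : is_diff x (fun x => a + L x) L.
  have dL : is_diff x L L by apply: DiffDef; [exact: linear_differentiable|exact: diff_lin].
  have := is_diffD (@is_diff_cst _ _ _ a x) dL.
  by rewrite add0r.
have D x v : U (a + L x) -> Dc (fun y => g (a + L y)) x v = Dc g (a + L x) (L v).
  move=> Ux; have [re im] := hol_cdiff hg Ux; have dAx := dA x.
  rewrite /Dc -[cRe (fun _ => _)]/(fun y => cRe g (a + L y)).
  rewrite -[cIm (fun _ => _)]/(fun y => cIm g (a + L y)).
  by rewrite !(dd_comp (f := fun y => a + L y)) // ![dd (fun y => a + L y) _ _]ddE !diff_val.
split=> //; split; [by move=> k; apply: Ck_aff (rg k)|by move=> k; apply: Ck_aff (ig k)|].
by move=> x Ux v; rewrite !D // LJ cg.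
Qed.

End HolomorphicMaps.

Section FiniteRadius.
Variable R : realType.

Lemma finite_radius (I : finType) (P : I -> R -> Prop) :
  (forall i r s, 0 < s -> s <= r -> P i r -> P i s) ->
  (forall i, exists2 r : R, 0 < r & P i r) -> exists2 r : R, 0 < r & forall i, P i r.
Proof.
move=> mono H; have H' i : exists r : R, 0 < r /\ P i r.
  by have [r r0 Pr] := H i; exists r.
have [f Hf] := choice H'; pose r := \big[Num.min/1]_i f i.
have r0 : 0 < r by apply/bigmin_gtP; split=> // i _; exact: (Hf i).1.
exists r => // i; apply: (mono i (f i)) => //; last exact: (Hf i).2.
exact: bigmin_le_cond.
Qed.

Lemma lip_small_vec n m (U : set (Cspace R n)) (f : Cspace R n -> Cspace R m)
    x0 (e : R) : open U -> U x0 -> Ck 1 U f -> (forall v, dd f x0 v = 0) -> 0 < e ->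
  exists2 r : R, 0 < r & forall x y, `|x - x0| <= r -> `|y - x0| <= r ->
    `|f y - f x| <= e * `|y - x|.
Proof.
move=> oU Ux0 Cf df0 e0.
pose P (k : 'I_(m + m)) (r : R) := forall x y, `|x - x0| <= r -> `|y - x0| <= r ->
    `|crd k (f y) - crd k (f x)| <= e * `|y - x|.
have [||r r0 H] := @finite_radius _ P.
- move=> i r s s0 sr Pr x y xs ys; apply: Pr; exact: le_trans sr.
- move=> k; apply: (lip_small oU Ux0) => //; first exact: Ck_crd.
  move=> v; rewrite dd_crd ?df0 ?linear0 //; exact: Ck_differentiable Cf Ux0.
exists r => // x y xr yr; apply: norm_crd => [|k].
  by rewrite mulr_ge0 // ltW.
by rewrite linearB; exact: H.
Qed.

(** If the differential killed a nonzero v, the increment of f along t v would be o(t), whereas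
    expansion makes it at least c t |v|. *)
Lemma expanding_dd_inj (V W : normedModType R) (f : V -> W) u (c r : R) :
  0 < c -> 0 < r -> differentiable f u ->
  (forall y, `|y - u| < r -> c * `|y - u| <= `|f y - f u|) ->
  forall v, dd f u v = 0 -> v = 0.
Proof.
move=> c0 r0 df H v dv; apply/eqP/negPn/negP => v0.
have nv0 : 0 < `|v| by rewrite normr_gt0.
have c20 : 0 < c / 2 by rewrite divr_gt0.
have [d d0 Hd] := diff_epsD df c20.
pose t := Num.min r d / 2 / `|v|.
have t0 : 0 < t by rewrite !divr_gt0 // lt_min r0.
have tv : `|t *: v| = Num.min r d / 2.
  by rewrite normrZ gtr0_norm // /t divfK // gt_eqF.
have m0 : 0 < Num.min r d by rewrite lt_min r0.
have tm : `|t *: v| < Num.min r d.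
  by rewrite tv ltr_pdivrMr // ltr_pMr // ltr1n.
move: (tm); rewrite lt_min => /andP[tr td].
have := Hd _ td; rewrite ddZl dv scaler0 subr0 => H1.
have := H (t *: v + u); rewrite addrK => /(_ tr) H2.
have := le_trans H2 H1; rewrite ler_pM2r; last by rewrite tv divr_gt0.
by rewrite leNgt ltr_pdivrMr // ltr_pMr // ltr1n.
Qed.

End FiniteRadius.

Section HolomorphicMatrix.
Variables (R : realType) (n : nat).
Implicit Types (U : set (Cspace R n)).

Lemma hol_neq0_open U g : open U -> hol U g -> open [set x | U x /\ g x != 0].
Proof.
move=> oU [rg ig _].
pose s x := cRe g x * cRe g x + cIm g x * cIm g x.
have sE x : (s x != 0) = (g x != 0).
  apply/idP/idP; last by move=> /csqn_neq0; rewrite !expr2.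
  by apply: contra_neq; rewrite /s /cRe /cIm => ->; rewrite /= mulr0 addr0.
have sc : Ck 0 U s.
  by apply: Ck_add => //; apply: Ck_mul => //; first [exact: rg | exact: ig].
rewrite openE => x [Ux gx]; rewrite /interior.
have nU : nbhs x U by exact: open_nbhs_nbhs.
have ns : \forall y \near x, s y != 0.
  have := sc x Ux; rewrite /prop_for /continuous_at => sx.
  by apply: cvgr_neq0 sx _; rewrite sE.
by apply: filterS2 nU ns => y Uy; rewrite sE.
Qed.

Lemma hol_mulmx U m p (B : Cspace R n -> Cspace R m) (A : 'M[R[i]]_(m, p)) k :
  open U -> holomorphic_on U B -> hol U (fun x => (cvec (B x) *m A) 0 k).
Proof.
move=> oU hB; apply: (hol_eq oU (g := fun x => \sum_j cvec (B x) 0 j * A j k)).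
  by move=> x _; rewrite mxE.
apply: hol_sum => // j _; apply: hol_mul => //; last exact: hol_cst.
exact: hol_coord.
Qed.

Lemma cdiff_sum (I : Type) (r : seq I) (P : pred I) (g : I -> Cspace R n -> R[i]) x v :
  (forall i, P i -> cdiff (g i) x) ->
  cdiff (fun y => \sum_(i <- r | P i) g i y) x /\
  Dc (fun y => \sum_(i <- r | P i) g i y) x v = \sum_(i <- r | P i) Dc (g i) x v.
Proof.
move=> dg; have cdiff0 : cdiff (fun _ : Cspace R n => 0 : R[i]) x.
  by split; exact: differentiable_cst.
elim: r => [|i r [dIH IH]].
  under eq_fun do rewrite big_nil; rewrite big_nil Dc_cst; split => //.
under eq_fun do rewrite big_cons; rewrite big_cons.
case: (boolP (P i)) => [Pi|_]; last by split.
by have [? ->] := DcD v (dg i Pi) dIH; rewrite IH.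
Qed.

Lemma Dc_mulmx m p (B : Cspace R n -> Cspace R m) (A : 'M[R[i]]_(m, p)) k x v :
  differentiable B x ->
  Dc (fun x => (cvec (B x) *m A) 0 k) x v = (cvec (dd B x v) *m A) 0 k.
Proof.
move=> dB; rewrite mxE.
have -> : (fun x => (cvec (B x) *m A) 0 k) = fun x => \sum_j cvec (B x) 0 j * A j k.
  by apply/funext => y; rewrite mxE.
have dc j : cdiff (fun y => cvec (B y) 0 j) x.
  split.
    have -> : cRe (fun x => cvec (B x) 0 j) = (fun x => crd (lshift m j) (B x)).
      by apply/funext => y; rewrite /cRe mxE crd_lshift.
    by apply: differentiable_lin_comp => //; exact: lin_cont.
  have -> : cIm (fun x => cvec (B x) 0 j) = (fun x => crd (rshift m j) (B x)).
    by apply/funext => y; rewrite /cIm mxE crd_rshift.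
  by apply: differentiable_lin_comp => //; exact: lin_cont.
have dA j : cdiff (fun _ : Cspace R n => A j k) x by split; exact: differentiable_cst.
rewrite (cdiff_sum _ v (fun j _ => (DcM v (dc j) (dA j)).1)).2.
apply: eq_bigr => j _; rewrite (DcM v (dc j) (dA j)).2 Dc_cst mulr0 add0r mulrC.
by rewrite Dc_coord.
Qed.

End HolomorphicMatrix.

(** * Submanifolds of projective space *)

Section ProjectivePoints.
Variables (R : realType) (N : nat).
Implicit Types (z w : 'rV[R[i]]_N.+1).

Lemma dim_line1 z : z != 0 -> \dim <[z]>%VS == 1%N.
Proof. by move=> z0; rewrite dim_vline z0. Qed.

Lemma delta_neq0 : delta_mx 0 0 != 0 :> 'rV[R[i]]_N.+1.
Proof.
apply/eqP => /rowP /(_ 0); rewrite !mxE eqxx /= => /eqP.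
by rewrite oner_eq0.
Qed.

(** At z = 0 the value is junk, the line spanned by the first basis vector. *)
Definition CPpt z : CP R N :=
  insubd (exist _ <[_]>%VS (dim_line1 delta_neq0) : CP R N) <[z]>%VS.

Lemma CPptE z : z != 0 -> val (CPpt z) = <[z]>%VS.
Proof. by move=> z0; rewrite val_insubd dim_line1. Qed.

Lemma eq_lineP z w : z != 0 -> <[z]>%VS = <[w]>%VS -> exists2 c, c != 0 & z = c *: w.
Proof.
move=> z0 zw; have /vlineP[c cE] : z \in <[w]>%VS by rewrite -zw memv_line.
exists c => //; apply: contra_neq z0 => c0; by rewrite cE c0 scale0r.
Qed.

Lemma line_scale z (c : R[i]) : c != 0 -> <[c *: z]>%VS = <[z]>%VS.
Proof.
move=> c0; apply/eqP; rewrite eqEsubv -!memvE memvZ ?memv_line //=.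
by rewrite -{1}(scalerK c0 z) memvZ ?memv_line.
Qed.

End ProjectivePoints.

Lemma Ck_sub (R : realType) (V W : normedModType R) k (U U' : set V) (f : V -> W) :
  U' `<=` U -> Ck k U f -> Ck k U' f.
Proof.
move=> sU; elim: k f => [|k IH] f; first by move=> H x /sU; exact: H.
move=> [df Cf]; split=> [x /sU|v]; first exact: df.
exact: IH (Cf v).
Qed.

Lemma hol_sub (R : realType) n (U U' : set (Cspace R n)) g :
  U' `<=` U -> hol U g -> hol U' g.
Proof.
move=> sU [rg ig cg]; split.
- by move=> k; exact: Ck_sub (rg k).
- by move=> k; exact: Ck_sub (ig k).
- by move=> x /sU; exact: cg.
Qed.

Lemma holomorphic_sub (R : realType) n m (U U' : set (Cspace R n))
    (f : Cspace R n -> Cspace R m) :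
  U' `<=` U -> holomorphic_on U f -> holomorphic_on U' f.
Proof.
move=> sU [sf cf]; split; first by move=> k; exact: Ck_sub (sf k).
by move=> x /sU; exact: cf.
Qed.

Lemma cvec_dd_sum (R : realType) (n m : nat) (O : set (Cspace R n))
    (f : Cspace R n -> Cspace R m) x v : open O -> O x ->
  holomorphic_on O f -> cvec (dd f x v) = cvec v *m \matrix_i cvec (dd f x (cbase R i)).
Proof.
move=> oO Ox hf; have df : differentiable f x by apply: (hf.1 1).1.
apply/rowP => j; rewrite -Dc_coord // (Dc_cbase _ (hol_coord j oO hf) Ox) mxE.
by apply: eq_bigr => i _; rewrite !mxE Dc_coord // mxE.
Qed.

Lemma subrACAC (V : zmodType) (a b c d : V) : a - b - (c - d) = a - c - (b - d).
Proof. by rewrite !opprB [d - c]addrC addrACA [- b + d]addrC. Qed.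

(** Here a and b stand for the increments of a map and of the identity: a perturbation of the
    identity with Lipschitz constant 1/2 expands distances by at least 1/2. *)
Lemma half_expand (R : realType) (V : normedModType R) (a b : V) :
  `|a - b| <= 2^-1 * `|b| -> 2^-1 * `|b| <= `|a|.
Proof.
have := ler_normB a (a - b); rewrite opprB addrC subrK => H1 H2.
lra.
Qed.

(** * Immersed germs are submanifolds *)

Section EmbeddedGerm.
Variables (R : realType) (D N : nat).
Let V : normedModType R := Cspace R D.
Let E : normedModType R := Cspace R N.+1.
Variables (U : set V) (B : V -> E) (den : E -> R[i]) (aff : E -> V).
Hypotheses (oU : open U) (hB : holomorphic_on U B).
Hypothesis den_scale : forall z z' c, cvec z = c *: cvec z' -> den z = c * den z'.
Hypothesis aff_scale : forall z z' c, c != 0 -> cvec z = c *: cvec z' ->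
  aff z = aff z'.
Hypothesis open_aff : forall w e, open [set z | den z != 0 /\ `|aff z - w| < e].
Hypothesis denB : forall x, U x -> den (B x) != 0.
Hypothesis expand : forall x y, U x -> U y ->
  2^-1 * `|y - x| <= `|aff (B y) - aff (B x)|.
Hypothesis imm : forall x, U x -> forall v,
  cvec (dd B x v) \in <[cvec (B x)]>%VS -> v = 0.

Let g x := CPpt (cvec (B x)).

Let den_neq0 z : den z != 0 -> cvec z != 0.
Proof.
apply: contra_neq => z0; have -> : den z = 0 * den z by apply: den_scale; rewrite scale0r.
by rewrite mul0r.
Qed.

Let BE0 x : U x -> cvec (B x) != 0.
Proof. by move=> /denB; exact: den_neq0. Qed.

Let gE x : U x -> val (g x) = <[cvec (B x)]>%VS.
Proof. by move=> Ux; rewrite CPptE // BE0. Qed.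

Let g_inj : set_inj U g.
Proof.
move=> y z; rewrite !inE => Uy Uz gyz.
have : <[cvec (B y)]>%VS = <[cvec (B z)]>%VS by rewrite -!gE // gyz.
move=> /(eq_lineP (BE0 Uy))[c c0 /(aff_scale c0) yz].
have := expand Uy Uz; rewrite yz subrr normr0.
by rewrite pmulr_rle0 ?invr_gt0 // normr_le0 subr_eq0 => /eqP.
Qed.

(** A consists of the points whose affine coordinate is close to that of B y for some y in W. By
    [expand], a point of U with image in A is close to such a y, hence lies in W. *)
Let g_open W : open W -> W `<=` U -> exists2 A, open A & g @` W = g @` U `&` A.
Proof.
move=> oW sW.
have /choice[eps Heps] : forall y, exists e : R, W y ->
    0 < e /\ forall z, `|z - y| < e -> W z.
  move=> y; have [Wy|nWy] := pselect (W y); last by exists 0.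
  have /nbhs_normP[e e0 We] : nbhs y W by exact: open_nbhs_nbhs.
  by exists e => _; split=> // z zy; apply: We => /=; rewrite distrC.
(* Half of [eps y] makes up for the factor 1/2 in [expand]. *)
pose C y := [set z : E | den z != 0 /\ `|aff z - aff (B y)| < eps y / 2].
pose A := [set q : CP R N | exists z, [/\ <[cvec z]>%VS = val q,
   den z != 0 & exists2 y, W y & C y z]].
have cA : cone A = \bigcup_(y in W) C y.
  apply/seteqP; split=> z.
    case=> q [z' [z'q z'0 [y Wy [_ Hz']]]] zq; exists y; first exact: Wy.
    have [|c c0 zz'] := @eq_lineP _ _ (cvec z') (cvec z) (den_neq0 z'0).
      by rewrite z'q zq.
    have dE := den_scale zz'; have aE := aff_scale c0 zz'.
    move: z'0; rewrite dE mulf_eq0 negb_or => /andP[_ dz].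
    by split; [exact: dz|rewrite -aE].
  case=> y Wy [dz Hz].
  have zE := CPptE (den_neq0 dz).
  exists (CPpt (cvec z)); last by rewrite zE.
  by exists z; split; [rewrite zE|exact: dz|exists y].
exists A.
  by rewrite /open /= /CP_open cA; apply: bigcup_open => y Wy; exact: open_aff.
apply/seteqP; split=> q.
  case=> y Wy <-; have Uy := sW _ Wy; split; first by exists y.
  exists (B y); split; [by rewrite gE|exact: denB|exists y; first exact: Wy].
  split; first exact: denB.
  by rewrite subrr normr0 divr_gt0 //; exact: (Heps y Wy).1.
case=> -[y Uy <-] [z [zq _ [w Ww [dz Hz]]]]; exists y => //.
rewrite gE // in zq; have [c c0 zy] := eq_lineP (den_neq0 dz) zq.
rewrite (aff_scale c0 zy) in Hz; apply: (Heps w Ww).2.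
have := le_lt_trans (expand (sW _ Ww) Uy) Hz.
by rewrite mulrC ltr_pM2r // invr_gt0.
Qed.

Lemma embedded_germ : complex_submanifold D (g @` U).
Proof.
move=> p [x Ux <-]; exists U, g, x; split=> //; split=> //.
exists B; first by split=> // y Uy; rewrite gE.
by move=> y Uy v; rewrite -ddE; exact: imm.
Qed.

End EmbeddedGerm.

Lemma holomorphic_id (R : realType) n : holomorphic_on setT (@id (Cspace R n)).
Proof.
split=> [k|z _ v]; last by rewrite (@diff_val _ _ _ _ _ _ _ (is_diff_id z)).
case: k => [|k]; first by move=> z _; exact: cvg_id.
split=> [z _|v]; first exact: (@ex_diff _ _ _ _ _ _ _ (is_diff_id z)).
apply: (Ck_eq openT (f := fun=> v)); last exact/Ck_cst/openT.
by move=> z _; rewrite (@diff_val _ _ _ _ _ _ _ (is_diff_id z)).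
Qed.

Section ImmersedGerm.
Variables (R : realType) (D N : nat).
Let V : normedModType R := Cspace R D.
Let E : normedModType R := Cspace R N.+1.
Variables (U : set V) (B : V -> E) (x0 : V).
Hypotheses (oU : open U) (Ux0 : U x0) (hB : holomorphic_on U B).

Let dB x : U x -> differentiable B x.
Proof. by move=> Ux; apply: (hB.1 1).1. Qed.

(* A is a left inverse of the linear map whose rows are B x0 and its partial
   derivatives: its first column is the denominator of an affine chart in which
   B is tangent to the identity at x0. *)
Variable A : 'M[R[i]]_(N.+1, 1 + D).
Hypothesis A0 : cvec (B x0) *m A = row_mx 1 0.
Hypothesis dA : forall v, cvec (dd B x0 v) *m A = row_mx 0 (cvec v).

Let den (z : E) : R[i] := (cvec z *m A) 0 (lshift D 0).
Let nu (z : E) (j : 'I_D) : R[i] := (cvec z *m A) 0 (rshift 1 j).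
Let aff (z : E) : V := uncvec (\row_j ((den z)^-1 * nu z j)).
Let H (x : V) : V := aff (B x).

Let den_scale z z' c : cvec z = c *: cvec z' -> den z = c * den z'.
Proof. by move=> zz'; rewrite /den zz' -scalemxAl mxE. Qed.

Let aff_scale z z' c : c != 0 -> cvec z = c *: cvec z' -> aff z = aff z'.
Proof.
move=> c0 zz'; have dE := den_scale zz'; congr uncvec; apply/rowP => j.
have nE : nu z j = c * nu z' j by rewrite /nu zz' -scalemxAl [LHS]mxE.
by rewrite [LHS]mxE [RHS]mxE dE nE invfM mulrACA mulVf // mul1r.
Qed.

Let hden : hol U (fun x => den (B x)). Proof. exact: hol_mulmx. Qed.
Let hnu j : hol U (fun x => nu (B x) j). Proof. exact: hol_mulmx. Qed.

Let U1 : set V := [set x | U x /\ den (B x) != 0].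
Let oU1 : open U1. Proof. exact: hol_neq0_open. Qed.
Let sU1 : U1 `<=` U. Proof. by move=> x []. Qed.

Let den0 : den (B x0) = 1.
Proof. by rewrite /den A0 row_mxEl mxE eqxx. Qed.
Let U1x0 : U1 x0. Proof. by split=> //; rewrite den0 oner_eq0. Qed.

Let hdenV : hol U1 (fun x => (den (B x))^-1).
Proof. by apply: hol_inv => // [x []//|]; exact: hol_sub hden. Qed.

Let hH : holomorphic_on U1 H.
Proof.
apply: holomorphic_coords => // j.
apply: (hol_eq oU1 (g := fun x => (den (B x))^-1 * nu (B x) j)).
  by move=> x _; rewrite uncvecK mxE.
by apply: hol_mul => //; exact: hol_sub (hnu j).
Qed.

Let dH x : U1 x -> differentiable H x.
Proof. by move=> Ux; apply: (hH.1 1).1. Qed.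

Let den_H x j : U1 x -> den (B x) * cvec (H x) 0 j = nu (B x) j.
Proof. by case=> _ n0; rewrite uncvecK mxE mulrA divff // mul1r. Qed.

(** Leibniz rule for [den_H], which avoids differentiating a quotient. At x0 it shows that H is
    tangent to the identity; at other points it relates dH v = 0 to dB v being a multiple of B. *)
Let den_dH x v j : U1 x ->
  den (B x) * cvec (dd H x v) 0 j + cvec (H x) 0 j * (cvec (dd B x v) *m A) 0 (lshift D 0)
  = (cvec (dd B x v) *m A) 0 (rshift 1 j).
Proof.
move=> U1x; have [Ux _] := U1x.
have hc := hol_coord j oU1 hH; have hd := hol_sub sU1 hden.
rewrite -(Dc_mulmx A (lshift D 0) v (dB Ux)) -(Dc_mulmx A (rshift 1 j) v (dB Ux)).
rewrite -(Dc_coord j v (dH U1x)).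
rewrite -(DcM v (hol_cdiff hd U1x) (hol_cdiff hc U1x)).2.
symmetry; apply: (Dc_eq v oU1 U1x); last first.
  exact: hol_cdiff (hol_mul oU1 hd hc) U1x.
by move=> y U1y; exact: den_H.
Qed.

Let dHx0 v : dd H x0 v = v.
Proof.
apply: cvec_inj; apply/rowP => j; have := den_dH v j U1x0.
rewrite dA row_mxEl row_mxEr den0 mul1r [in X in _ * X]mxE mulr0 addr0.
by move=> ->.
Qed.

Let open_aff w (e : R) : open [set z | den z != 0 /\ `|aff z - w| < e].
Proof.
have hid := @holomorphic_id R N.+1.
have hd : hol setT den by exact: (hol_mulmx A (lshift D 0) openT hid).
pose E1 := [set z : E | setT z /\ den z != 0].
have oE1 : open E1 by exact: hol_neq0_open openT hd.
have ha : holomorphic_on E1 aff.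
  apply: holomorphic_coords => // j.
  apply: (hol_eq oE1 (g := fun z => (den z)^-1 * nu z j)).
    by move=> z _; rewrite uncvecK mxE.
  apply: hol_mul => //.
    by apply: hol_inv => // [z []//|]; apply: hol_sub hd.
  by apply: (hol_sub (U := setT)) => //; exact: (hol_mulmx A (rshift 1 j) openT hid).
rewrite openE => z [dz Hz]; rewrite /interior.
have E1z : E1 z by split.
have nE : nbhs z E1 by exact: open_nbhs_nbhs.
have ca : {for z, continuous aff} by exact: (ha.1 0).
have ca' : `|aff t - w| @[t --> z] --> `|aff z - w|.
  by apply: cvg_norm; apply: cvgB; [exact: ca|exact: cvg_cst].
have nH := cvgr_lt _ ca' _ Hz.
by apply: filterS2 nE (nH _) => t [_ dt] Ht; split.
Qed.

(** H minus the identity has zero differential at x0, hence Lipschitz constant 1/2 on a small ball,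
    where H expands by 1/2. This estimate gives [embedded_germ] both its expansion and its immersion
    hypothesis. *)
Lemma immersed_germ : exists U', [/\ open U', U' x0, U' `<=` U,
  forall x, U' x -> cvec (B x) != 0 &
  complex_submanifold D ((fun x => CPpt (cvec (B x))) @` U')].
Proof.
have [r1 r10 K1] := open_closed_box oU1 U1x0.
pose f x := H x - x.
have Cf : Ck 1 U1 f.
  apply: Ck_add => //; first exact: hH.1.
  apply: (Ck_opp (f := id) oU1).
  by apply: (Ck_sub _ ((@holomorphic_id R D).1 1)).
have df0 v : dd f x0 v = 0.
  have di : is_diff x0 (fun x : V => - x) -%R by exact: is_diffN.
  rewrite ddD; [|exact: dH|exact: ex_diff].
  by rewrite dHx0 [X in _ + X]ddE diff_val subrr.
have h20 : 0 < 2^-1 :> R by rewrite invr_gt0.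
have [r2 r20 L2] := lip_small_vec oU1 U1x0 Cf df0 h20.
pose r := Num.min r1 r2; have r0 : 0 < r by rewrite lt_min r10.
pose U' := ball x0 r.
have U'r x : U' x -> `|x - x0| <= r by rewrite /U' -ball_normE /= distrC => /ltW.
have U'U1 : U' `<=` U1.
  move=> x /U'r xr; apply: K1; rewrite /closed_box /=; apply: le_trans xr _.
  by rewrite ge_min lexx.
have oU' : open U' by exact: ball_open.
have U'x0 : U' x0 by exact: ballxx.
have expand x y : U' x -> U' y -> 2^-1 * `|y - x| <= `|H y - H x|.
  move=> /U'r xr /U'r yr.
  have rr2 : r <= r2 by rewrite /r ge_min lexx orbT.
  have := L2 x y (le_trans xr rr2) (le_trans yr rr2).
  by rewrite /f subrACAC; exact: half_expand.
have sU' : U' `<=` U by move=> x /U'U1 /sU1.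
have dB' x : U' x -> den (B x) != 0 by move=> /U'U1 [].
exists U'; split; [exact: oU'|exact: U'x0|exact: sU'| |].
  move=> x /dB'; apply: contra_neq; rewrite /den => ->; by rewrite mul0mx mxE.
apply: (embedded_germ oU' (holomorphic_sub sU' hB) den_scale aff_scale open_aff dB' expand).
move=> u U'u v dv; have U1u := U'U1 _ U'u; have du := dB' u U'u.
have /nbhs_normP[s s0 Hs] : nbhs u U' by exact: open_nbhs_nbhs.
apply: (@expanding_dd_inj _ _ _ H u 2^-1 s h20 s0 (dH U1u)).
  move=> y ys; apply: expand; [exact: U'u|apply: Hs => /=]; by rewrite distrC.
apply: cvec_inj; apply/rowP => j; rewrite cvec0 [RHS]mxE.
(* If dB v = c B u, the Leibniz rule reads den dH + H c den = c nu = c den H, so dH v = 0. *)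
move: dv => /vlineP[c cE].
have cA k : (cvec (dd B u v) *m A) 0 k = c * (cvec (B u) *m A) 0 k.
  by rewrite cE -scalemxAl [LHS]mxE.
have := den_dH v j U1u; rewrite !cA.
rewrite -/(den (B u)) -/(nu (B u) j) -(den_H j U1u) mulrCA [cvec (H u) 0 j * _]mulrC.
rewrite -[RHS]add0r => /addIr /eqP.
by rewrite mulf_eq0 (negbTE du) => /eqP.
Qed.

End ImmersedGerm.

(** M is row free because a relation between its rows would make a derivative of B a multiple of the
    nonzero vector B x0. A right inverse of M provides the affine chart. *)
Lemma immersed_germ_exists (R : realType) (D N : nat) (U : set (Cspace R D))
    (B : Cspace R D -> Cspace R N.+1) (x0 : Cspace R D) :
  open U -> U x0 -> holomorphic_on U B -> cvec (B x0) != 0 ->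
  (forall v, cvec (dd B x0 v) \in <[cvec (B x0)]>%VS -> v = 0) ->
  exists U', [/\ open U', U' x0, U' `<=` U,
    forall x, U' x -> cvec (B x) != 0 &
    complex_submanifold D ((fun x => CPpt (cvec (B x))) @` U')].
Proof.
move=> oU Ux0 hB B0 imm.
pose M : 'M[R[i]]_(1 + D, N.+1) :=
  col_mx (cvec (B x0)) (\matrix_(i < D) cvec (dd B x0 (cbase R i))).
have M_free : row_free M.
  rewrite -kermx_eq0; apply/rowV0P => c /sub_kermxP.
  rewrite -(hsubmxK c) mul_row_col; set y := rsubmx c; set a := lsubmx c => aE.
  have yE : y = cvec (uncvec y) by rewrite uncvecK.
  have v0 : uncvec y = 0.
    apply: imm; rewrite (cvec_dd_sum _ oU Ux0 hB) -yE; apply/vlineP.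
    exists (- a 0 0); apply/eqP; rewrite scaleNr -addr_eq0 addrC.
    by rewrite -mul_scalar_mx -mx11_scalar; exact/eqP.
  move: aE; rewrite yE v0 cvec0 mul0mx addr0 [a]mx11_scalar mul_scalar_mx => /eqP.
  by rewrite scaler_eq0 (negbTE B0) orbF => /eqP ->; rewrite raddf0 row_mx0.
have [A MA] := row_freeP M_free.
move: MA; rewrite /M mul_col_mx scalar_mx_block block_mxEv => /eq_col_mx[A0 A1].
apply: (immersed_germ oU Ux0 hB (A := A)) => [//|v].
by rewrite (cvec_dd_sum _ oU Ux0 hB) -mulmxA A1 mul_mx_row mulmx0 mulmx1.
Qed.

(** * Matrices of holomorphic functions *)

Section HolomorphicMatrices.
Variables (R : realType) (n : nat) (U : set (Cspace R n)).
Hypothesis oU : open U.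

Definition holmx p q (M : Cspace R n -> 'M[R[i]]_(p, q)) :=
  forall i j, hol U (fun x => M x i j).

Lemma holmx_cst p q (A : 'M[R[i]]_(p, q)) : holmx (fun=> A).
Proof. by move=> i j; exact: hol_cst. Qed.

Lemma holmx_mul p q r (M : Cspace R n -> 'M[R[i]]_(p, q)) (M' : Cspace R n -> 'M[R[i]]_(q, r)) :
  holmx M -> holmx M' -> holmx (fun x => M x *m M' x).
Proof.
move=> hM hM' i j; apply: (hol_eq oU (g := fun x => \sum_k M x i k * M' x k j)).
  by move=> x _; rewrite mxE.
by apply: hol_sum => // k _; exact: hol_mul.
Qed.

Lemma holmx_add p q (M M' : Cspace R n -> 'M[R[i]]_(p, q)) :
  holmx M -> holmx M' -> holmx (fun x => M x + M' x).
Proof.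
move=> hM hM' i j; apply: (hol_eq oU (g := fun x => M x i j + M' x i j)).
  by move=> x _; rewrite mxE.
exact: hol_add.
Qed.

Lemma holmx_scale p q (g : Cspace R n -> R[i]) (M : Cspace R n -> 'M[R[i]]_(p, q)) :
  hol U g -> holmx M -> holmx (fun x => g x *: M x).
Proof.
move=> hg hM i j; apply: (hol_eq oU (g := fun x => g x * M x i j)).
  by move=> x _; rewrite mxE.
exact: hol_mul.
Qed.

Lemma hol_det p (M : Cspace R n -> 'M[R[i]]_p) :
  holmx M -> hol U (fun x => \det (M x)).
Proof.
move=> hM; apply: hol_sum => // s _; apply: hol_mul => //; first exact: hol_cst.
by apply: hol_prod => // i _; exact: hM.
Qed.

Lemma holmx_adj p (M : Cspace R n -> 'M[R[i]]_p) :
  holmx M -> holmx (fun x => \adj (M x)).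
Proof.
move=> hM i j; apply: (hol_eq oU (g := fun x => cofactor (M x) j i)).
  by move=> x _; rewrite mxE.
apply: hol_mul => //; first exact: hol_cst.
apply: hol_det => k l.
apply: (hol_eq oU (g := fun x => M x (lift j k) (lift i l))).
  by move=> x _; rewrite !mxE.
exact: hM.
Qed.

Lemma holmx_id (A : 'M[R[i]]_(n, n)) q (C : 'M[R[i]]_(n, q)) :
  holmx (fun x => cvec x *m C).
Proof.
move=> i j; rewrite ord1; apply: (hol_mulmx C j oU (B := @id (Cspace R n))).
exact: holomorphic_sub (@holomorphic_id R n).
Qed.

Lemma holomorphic_uncvec q (M : Cspace R n -> 'rV[R[i]]_q) :
  holmx M -> holomorphic_on U (fun x => uncvec (M x)).
Proof.
move=> hM; apply: holomorphic_coords => // j.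
by apply: (hol_eq oU) (hM 0 j) => x _; rewrite uncvecK.
Qed.

End HolomorphicMatrices.

Lemma dd_line (R : realType) (V W : normedModType R) (f : V -> W) x v w :
  differentiable f x -> (forall t : R, f (t *: v + x) = f x + t *: w) -> dd f x v = w.
Proof.
move=> df fl; apply/eqP; rewrite eq_sym -subr_eq0 -normr_eq0 eq_le normr_ge0 andbT.
apply/ler_addgt0Pl => e e0; rewrite addr0.
have e'0 : 0 < e / (`|v| + 1) by rewrite divr_gt0 // ltr_wpDl.
have [d d0 Hd] := diff_epsD df e'0.
have v10 : 0 < `|v| + 1 by rewrite ltr_wpDl.
pose t := d / 2 / (`|v| + 1).
have t0 : 0 < t by rewrite !divr_gt0.
have td : `|t *: v| < d.
  rewrite normrZ gtr0_norm // /t mulrAC ltr_pdivrMr //.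
  apply: (@le_lt_trans _ _ (d * `|v|)); last by rewrite ltr_pM2l // ltrDl.
  by apply: ler_wpM2r => //; rewrite ler_pdivrMr // ler_pMr // ler1n.
clearbody t; have := Hd _ td; rewrite fl [f x + _]addrC addrK ddZl -scalerBr !normrZ.
rewrite (gtr0_norm t0) mulrCA ler_pM2l // => H; apply: (le_trans H).
by rewrite mulrAC ler_pdivrMr // ler_pM2l // lerDl.
Qed.

(** * The second fundamental form and the dual variety *)

Section SecondFundamentalForm.
Variables (R : realType) (N n : nat).
Let V : normedModType R := Cspace R n.
Let E : normedModType R := Cspace R N.+1.
Variables (X : set (CP R N)) (U : set V) (f : V -> CP R N) (G : V -> E).
Hypothesis chartf : chart X U f.
Hypothesis liftG : is_lift U f G.
Hypothesis immG : forall u, U u -> forall v,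
  cvec (dd G u v) \in <[cvec (G u)]>%VS -> v = 0.

Let oU : open U. Proof. by case: chartf. Qed.
Let hG : holomorphic_on U G. Proof. by case: liftG. Qed.
Let spanG u : U u -> <[cvec (G u)]>%VS = val (f u).
Proof. by case: liftG => _; apply. Qed.
Let dG u : U u -> differentiable G u. Proof. by move=> Uu; apply: (hG.1 1).1. Qed.

Lemma lift_neq0 u : U u -> cvec (G u) != 0.
Proof.
move=> Uu; have := valP (f u); rewrite -spanG // dim_vline.
by case: (_ != 0).
Qed.

(* A hyperplane is tangent at u iff it contains the rows of jet u. *)
Definition jet u : 'M[R[i]]_(1 + n, N.+1) :=
  col_mx (cvec (G u)) (\matrix_(i < n) cvec (dd G u (cbase R i))).

Lemma jet_free u : U u -> row_free (jet u).
Proof.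
move=> Uu; rewrite -kermx_eq0; apply/rowV0P => c /sub_kermxP.
rewrite -(hsubmxK c) mul_row_col; set y := rsubmx c; set a := lsubmx c => aE.
have yE : y = cvec (uncvec y) by rewrite uncvecK.
have v0 : uncvec y = 0.
  apply: (immG Uu); rewrite (cvec_dd_sum _ oU Uu hG) -yE; apply/vlineP.
  exists (- a 0 0); apply/eqP; rewrite scaleNr -addr_eq0 addrC.
  by rewrite -mul_scalar_mx -mx11_scalar; exact/eqP.
move: aE; rewrite yE v0 cvec0 mul0mx addr0 [a]mx11_scalar mul_scalar_mx => /eqP.
by rewrite scaler_eq0 (negbTE (lift_neq0 Uu)) orbF => /eqP ->; rewrite raddf0 row_mx0.
Qed.

Lemma jet_tangent (b : 'rV[R[i]]_N.+1) u : U u -> b *m (jet u)^T = 0 ->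
  cvec (G u) *m b^T = 0 /\ forall v, cvec (dd G u v) *m b^T = 0.
Proof.
move=> Uu /(congr1 trmx); rewrite trmx_mul trmxK trmx0 mul_col_mx => H.
have [-> H2] := eq_col_mx (etrans H (esym (@col_mx0 _ 1 n 1))).
by split=> // v; rewrite (cvec_dd_sum _ oU Uu hG) -mulmxA H2 mulmx0.
Qed.

Lemma tangent_jet (b : 'rV[R[i]]_N.+1) u : cvec (G u) *m b^T = 0 ->
  (forall v, cvec (dd G u v) *m b^T = 0) -> b *m (jet u)^T = 0.
Proof.
move=> H1 H2; apply: trmx_inj; rewrite trmx_mul trmxK trmx0 mul_col_mx H1.
rewrite (_ : _ *m b^T = 0) ?col_mx0 //; apply/row_matrixP => i.
by rewrite row_mul rowK H2 row0.
Qed.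

Lemma jetEl u k i : (jet u)^T k (lshift n i) = cvec (G u) 0 k.
Proof. by rewrite [LHS]mxE [LHS]col_mxEu ord1. Qed.

Lemma jetEr u k j : (jet u)^T k (rshift 1 j) = cvec (dd G u (cbase R j)) 0 k.
Proof. by rewrite [LHS]mxE [LHS]col_mxEd [LHS]mxE. Qed.

Lemma holmx_jet : holmx U (fun u => (jet u)^T).
Proof.
move=> k i; rewrite -(splitK i); case: (fintype.split i) => j /=.
  apply: (hol_eq oU) (hol_coord k oU hG) => u _.
  by rewrite jetEl.
apply: (hol_eq oU (g := fun u => Dc (fun y => cvec (G y) 0 k) u (cbase R j))).
  by move=> u Uu; rewrite jetEr Dc_coord //; exact: dG.
by apply: hol_Dc => //; exact: hol_coord.
Qed.

(* The second fundamental form in the direction of the conormal vector b. *)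
Definition sff (u : V) (b : 'rV[R[i]]_N.+1) : 'M[R[i]]_n := \matrix_(i, j)
  \sum_k b 0 k * Dc (fun y => Dc (fun z => cvec (G z) 0 k) y (cbase R j)) u (cbase R i).

Lemma jet_dual_variety u b : U u -> b != 0 -> b *m (jet u)^T = 0 ->
  dual_variety n X (CPpt b).
Proof.
move=> Uu b0 bj; have [H1 H2] := jet_tangent Uu bj.
have inH z : z *m b^T = 0 -> in_hyperplane (CPpt b) z.
  move=> zb w; rewrite CPptE // => /vlineP[c ->].
  by rewrite linearZ /= -scalemxAr zb scaler0.
have [_ fX _ _ _] := chartf.
exists (f u); first by apply: fX; exists u.
split.
  move=> z; rewrite -spanG // => /vlineP[c ->]; apply: inH.
  by rewrite -scalemxAl H1 scaler0.
exists U, f, G, u; split=> // v; rewrite -ddE; exact: inH.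
Qed.

Variables (u0 : V) (b0 : 'rV[R[i]]_N.+1).
Hypotheses (Uu0 : U u0) (b0_neq0 : b0 != 0) (bj0 : b0 *m (jet u0)^T = 0).

(** Writes v Q as a derivative of the jet along v, the form in which Q appears when the tangency
    identity beta K = 0 of [codim_dual_variety] is differentiated. *)
Lemma sffE v : (cvec v *m sff u0 b0) =
  \row_j \sum_k b0 0 k * Dc (fun y => (jet y)^T k (rshift 1 j)) u0 v.
Proof.
apply/rowP => j; rewrite !mxE.
have hk k : hol U (fun y => Dc (fun z => cvec (G z) 0 k) y (cbase R j)).
  by apply: hol_Dc => //; exact: hol_coord.
under eq_bigr => i _ do rewrite [sff _ _ _ _]mxE mulr_sumr.
rewrite exchange_big /=; apply: eq_bigr => k _.
rewrite (_ : Dc (fun y => (jet y)^T k (rshift 1 j)) u0 v =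
   Dc (fun y => Dc (fun z => cvec (G z) 0 k) y (cbase R j)) u0 v).
  rewrite (Dc_cbase _ (hk k) Uu0) mulr_sumr; apply: eq_bigr => i _.
  by rewrite mulrCA.
apply: (Dc_eq _ oU Uu0); last exact: hol_cdiff (hk k) Uu0.
by move=> y Uy; rewrite jetEr Dc_coord //; exact: dG.
Qed.

Let r := \rank (sff u0 b0).
Let Kr := kermx (jet u0)^T.
(** The projective dimension of the linear system of hyperplanes tangent at u0. *)
Let d := \rank (Kr :\: b0)%MS.

Let dE : (d + n.+1 = N)%N.
Proof.
have b0K : (b0 <= Kr)%MS by apply/sub_kermxP.
have := mxrank_cap_compl Kr b0; rewrite (capmx_idPr b0K).
rewrite rank_rV b0_neq0 /Kr mxrank_ker mxrank_tr (eqP (jet_free Uu0)) -/d.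
have := rank_leq_col (jet u0); rewrite (eqP (jet_free Uu0)) => nN.
by rewrite !add1n subSS => E1; rewrite -addSnnS E1 subnK.
Qed.

(** Parameters x = (s, t) move the point to u0 + s F and the conormal vector to b0 + t T, which is
    then corrected to a vector beta tangent at the new point. Where the derivative of beta is a
    multiple of b0, differentiating beta K = 0 gives s F Q = 0, hence s = 0; then t T is a multiple
    of b0, hence t = 0. So beta immerses a germ of dimension r + d into X^*. *)
Lemma codim_dual_variety : (codim (dual_variety n X) + r <= n.+1)%N.
Proof.
(* The rows of F span a space of directions on which Q is injective. *)
have [F FE] : exists F : 'M[R[i]]_(r, n), F *m col_base (sff u0 b0) = 1%:M.
  exact/row_fullP/col_base_full.
have [L0 L0E] : exists L0 : 'M[R[i]]_(1 + n, N.+1), L0 *m (jet u0)^T = 1%:M.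
  have [C CE] := row_freeP (jet_free Uu0); exists C^T.
  by rewrite -trmx_mul CE trmx1.
pose T := row_base (Kr :\: b0)%MS.
pose FF : 'M[R[i]]_(r + d, n) := col_mx F 0.
pose TT : 'M[R[i]]_(r + d, N.+1) := col_mx 0 T.
have L_lin : linear (fun x : Cspace R (r + d) => uncvec (cvec x *m FF) : Cspace R n).
  by move=> a x y; apply: cvec_inj; rewrite uncvecK !cvecD !cvecZ !uncvecK mulmxDl scalemxAl.
pose L := mklinear L_lin.
have LE x : L x = uncvec (cvec x *m FF) by [].
have LJ x : L (Jmul x) = Jmul (L x).
  by rewrite !LE; apply: cvec_inj; rewrite uncvecK !cvecJ uncvecK scalemxAl.
pose U' := (fun x => u0 + L x) @^-1` U.
have oU' : open U'.
  apply: open_comp => // x _; apply: cvgD; first exact: cvg_cst.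
  exact: (@lin_cont _ _ _ L).
pose K x := (jet (u0 + L x))^T.
pose M x := L0 *m K x.
pose bb (x : Cspace R (r + d)) := b0 + cvec x *m TT.
(* This is the projection bb - bb K M^-1 L0 of bb to the kernel of K, multiplied by det M: with the
   adjugate it is holomorphic even where M is singular, and tangency holds at every x. *)
pose beta x := \det (M x) *: bb x - bb x *m K x *m \adj (M x) *m L0.
have hK : holmx U' K by move=> i j; exact: (hol_aff u0 oU LJ (holmx_jet i j)).1.
have hM : holmx U' M by apply: holmx_mul => //; exact: holmx_cst.
have hbb : holmx U' bb.
  by apply: holmx_add => //; [exact: holmx_cst|exact: (holmx_id oU' 0)].
have hbeta : holmx U' beta.
  apply: holmx_add => //; first by apply: holmx_scale => //; exact: hol_det.
  move=> i j; apply: (hol_eq oU' (g := fun x => - (bb x *m K x *m \adj (M x) *m L0) i j)).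
    by move=> x _; rewrite [RHS]mxE.
  apply: hol_opp => //; move: i j.
  apply: holmx_mul => //; last exact: holmx_cst.
  by apply: holmx_mul => //; [exact: holmx_mul|exact: holmx_adj].
have betaK x : beta x *m K x = 0.
  rewrite /beta mulmxBl -scalemxAl -!mulmxA (_ : L0 *m K x = M x) //.
  by rewrite mul_adj_mx mul_mx_scalar -scalemxAr subrr.
have K0 : K 0 = (jet u0)^T by rewrite /K (linear0 L) [_ + 0]addr0.
have TK : T *m (jet u0)^T = 0.
  by apply/sub_kermxP; rewrite eq_row_base diffmxSl.
have M0 x : L x = 0 -> M x = 1%:M by move=> Lx; rewrite /M /K Lx addr0.
(* Over u0 itself bb is already conormal and M = 1, so there is no correction. *)
have beta_line x : L x = 0 -> beta x = bb x.
  move=> Lx; rewrite /beta M0 // det1 scale1r /K Lx addr0 /bb mulmxDl bj0 add0r.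
  have -> : cvec x *m TT *m (jet u0)^T = 0.
    by rewrite /TT -mulmxA mul_col_mx mul0mx TK col_mx0 mulmx0.
  by rewrite !mul0mx subr0.
have beta0 : beta 0 = b0 by rewrite beta_line ?linear0 // /bb cvec0 mul0mx addr0.
pose B x := uncvec (beta x) : Cspace R N.+1.
have hB : holomorphic_on U' B by exact: holomorphic_uncvec.
have uL0 : u0 + L 0 = u0 by rewrite (linear0 L); exact: addr0.
have U'0 : U' 0 by rewrite /U' /preimage /= uL0.
have dB : differentiable B 0 by apply: (hB.1 1).1.
have B0 : cvec (B 0) = b0 by rewrite uncvecK.
have imm (v : Cspace R (r + d)) : cvec (dd B 0 v) \in <[cvec (B 0%R)]>%VS -> v = 0.
  rewrite B0 => /vlineP[c cE].
  (* Product rule for beta K = 0 at 0: the term c b0 K vanishes because b0 is conormal at u0, and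
     the other one is (L v) Q by [sffE]. *)
  have sffL : cvec (L v) *m sff u0 b0 = 0.
    rewrite sffE; apply/rowP => j; rewrite [RHS]mxE mxE; set i := rshift 1 j.
    have hBk k := hol_cdiff (hbeta 0 k) U'0.
    have hKk k := hol_cdiff (hK k i) U'0.
    have [_ E1] := cdiff_sum (index_enum _) v (P := xpredT)
      (fun k _ => (DcM v (hBk k) (hKk k)).1).
    have E0 : Dc (fun y => \sum_k beta y 0 k * K y k i) 0 v = 0.
      have -> : (fun y => \sum_k beta y 0 k * K y k i) = fun=> 0; last exact: Dc_cst.
      by apply/funext => y; have /matrixP/(_ 0 i) := betaK y; rewrite !mxE.
    move: E1; rewrite E0; under eq_bigr => k _.
      rewrite (DcM v (hBk k) (hKk k)).2.
      have -> : Dc (fun y => beta y 0 k) 0 v = c * b0 0 k.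
        have -> : (fun y => beta y 0 k) = (fun y => cvec (B y) 0 k).
          by apply/funext => y; rewrite uncvecK.
        by rewrite Dc_coord // cE mxE.
      rewrite beta0 (hol_aff u0 oU LJ (holmx_jet k i)).2 uL0 // mulrCA K0 [_ * b0 0 k]mulrC.
      over.
    rewrite big_split /= -mulr_sumr.
    have -> : \sum_k b0 0 k * (jet u0)^T k i = 0.
      by have /matrixP/(_ 0 i) := bj0; rewrite mxE [in RHS]mxE.
    by rewrite mulr0 addr0.
  set s := lsubmx (cvec v); set t := rsubmx (cvec v).
  have vE : cvec v = row_mx s t by rewrite hsubmxK.
  have s0 : s = 0.
    move: sffL; rewrite LE uncvecK vE mul_row_col mulmx0 addr0 -[sff u0 b0]mulmx_base.
    rewrite mulmxA -[s *m F *m _]mulmxA FE mulmx1 => sr.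
    by apply: (row_free_inj (row_base_free (sff u0 b0))); rewrite sr mul0mx.
  have Lv a : L (a *: v) = 0.
    by rewrite linearZ /= LE vE s0 mul_row_col mul0mx mulmx0 addr0 [uncvec _](_ : _ = 0) ?scaler0 //; apply: cvec_inj; rewrite uncvecK cvec0.
  have dBv : dd B 0 v = uncvec (t *m T).
    apply: dd_line => // a; rewrite addr0 /B beta_line // beta0 /bb.
    apply: cvec_inj; rewrite [RHS]cvecD [cvec (_ *: uncvec _)]cvecZ !uncvecK.
    congr (_ + _).
    by rewrite cvecZ -scalemxAl vE mul_row_col mulmx0 add0r.
  have tT : t *m T = 0.
    apply/eqP; rewrite -submx0 -(capmx_diff Kr b0) sub_capmx.
    have -> : (t *m T <= Kr :\: b0)%MS by rewrite (submx_trans (submxMl _ _)) // eq_row_base.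
    by move: cE; rewrite dBv uncvecK => ->; rewrite scalemx_sub.
  have t0 : t = 0.
    by apply: (row_free_inj (row_base_free (Kr :\: b0)%MS)); rewrite tT mul0mx.
  by apply: cvec_inj; rewrite vE s0 t0 row_mx0 cvec0.
have B0n : cvec (B 0) != 0 by rewrite B0.
have [U2 [oU2 U20 sU2 BU2 subS]] := immersed_germ_exists oU' U'0 hB B0n imm.
have rn : (r <= n)%N by exact: rank_leq_row.
have DN : (r + d < N.+1)%N by rewrite ltnS -dE addnC leq_add2l ltnW.
rewrite /codim; set m := \max_(_ < _ | _) _.
have mD : ((r + d).+1 <= m)%N.
  rewrite /m (bigD1 (Ordinal DN)) /=; first exact: leq_maxl.
  apply/asboolP; exists ((fun x => CPpt (cvec (B x))) @` U2); split=> //.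
    by exists (CPpt (cvec (B 0))); exists 0.
  move=> _ [x U2x <-]; apply: (@jet_dual_variety (u0 + L x)); first exact: sU2.
    exact: BU2.
  by rewrite uncvecK; exact: betaK.
(* By [dE], N - (r + d) = n + 1 - r. *)
apply: (@leq_trans (N.+1 - (r + d).+1 + r)); first by rewrite leq_add2r leq_sub2l.
rewrite subSS -{1}dE addnC [(r + d)%N]addnC subnDl.
by rewrite subnKC // ltnW.
Qed.

End SecondFundamentalForm.

Section MoreCodim.
Variables (R : realType) (N n : nat).
Variables (X : set (CP R N)) (U : set (Cspace R n)) (f : Cspace R n -> CP R N).
Variable (G : Cspace R n -> Cspace R N.+1).
Hypothesis chartf : chart X U f.
Hypothesis liftG : is_lift U f G.
Hypothesis immG : forall u, U u -> forall v,
  cvec (dd G u v) \in <[cvec (G u)]>%VS -> v = 0.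

(** Covers the situations in which no particular conormal vector is given. For n < N the jet has a
    nonzero one, and the rank is dropped from the bound; for N <= n the codimension is at most N + 1
    by definition. *)
Lemma codim_dual_variety_le u : U u -> (codim (dual_variety n X) <= n.+1)%N.
Proof.
move=> Uu; have fr := jet_free chartf liftG immG Uu.
have := rank_leq_col (jet G u); rewrite (eqP fr) add1n ltnS => nN.
have [nN1|] := ltnP n N; last first.
  by move=> Nn; rewrite /codim; apply: leq_trans (leq_subr _ _) _; rewrite ltnS.
have : kermx (jet G u)^T != 0.
  by rewrite -mxrank_eq0 mxrank_ker mxrank_tr (eqP fr) add1n subSS subn_eq0 -ltnNge.
move=> /rowV0Pn[b /sub_kermxP bj b0].
apply: leq_trans (codim_dual_variety chartf liftG immG Uu b0 bj).
exact: leq_addr.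
Qed.

End MoreCodim.

Lemma val_line (R : realType) N (p : CP R N) : <[vpick (val p)]>%VS = val p.
Proof.
have dp : \dim (val p) = 1%N by apply/eqP; exact: valP p.
apply/eqP; rewrite eqEdim -memvE memv_pick dim_vline vpick0 dp.
by case: eqP => // p0; rewrite p0 dimv0 in dp.
Qed.

Lemma vpick_neq0 (R : realType) N (p : CP R N) : vpick (val p) != 0.
Proof.
have := dim_vline (vpick (val p)); rewrite val_line.
have -> : \dim (val p) = 1%N by apply/eqP; exact: valP p.
by case: (_ != 0).
Qed.

(** * Open subsets of submanifolds *)

Section OpenSubset.
Variables (R : realType) (N n : nat).
Variables (X O : set (CP R N)).
Hypothesis oO : open O.

Lemma chart_openI (U : set (Cspace R n)) (f : Cspace R n -> CP R N) :
  chart (X `&` O) U f -> chart X U f.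
Proof.
case=> oU fU inj hom lft; split=> //; first by move=> p /fU[].
move=> V oV VU; have [A oA fV] := hom V oV VU.
by exists (O `&` A); [exact: openI|rewrite setIA].
Qed.

(** CP^N carries a quotient topology: the preimage of an open B under f is the preimage of the open
    set [cone B] under the continuous lift. *)
Lemma chart_lift_continuous (U : set (Cspace R n)) (f : Cspace R n -> CP R N)
    (psi : Cspace R n -> Cspace R N.+1) u : is_lift U f psi ->
  U u -> open U -> {for u, continuous f}.
Proof.
move=> [[hpsi _] spsi] Uu oU A.
rewrite nbhsE => -[B [oB Bf] BA].
have cu : cone B (psi u) by exists (f u) => //; exact: spsi.
have nB : nbhs (psi u) (cone B) by apply: open_nbhs_nbhs; split.
have nU : nbhs u U by exact: open_nbhs_nbhs.
have := hpsi 0 u Uu (cone B) nB; rewrite /nbhs /= => nC.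
apply: filterS2 nU nC => v Uv [q Bq qv]; apply: BA.
by have -> : f v = q by apply: val_inj; rewrite -qv spsi.
Qed.

Lemma chart_restrict (U W : set (Cspace R n)) (f : Cspace R n -> CP R N) :
  chart X U f -> open W ->
  (forall u, U u -> W u -> O (f u)) -> chart (X `&` O) (U `&` W) f.
Proof.
case=> oU fU inj hom [psi [hpsi spsi] imm] oW fW; split.
- exact: openI.
- by move=> _ [u [Uu Wu] <-]; split; [apply: fU; exists u|exact: fW].
- by move=> u v; rewrite !inE => -[Uu _] [Uv _]; apply: inj; rewrite inE.
- move=> V oV VU; have VU' : V `<=` U by move=> v /VU[].
  have [A oA fV] := hom V oV VU'; exists A => //.
  rewrite setIAC -fV; apply/seteqP; split=> p; last by case.
  by move=> fVp; split => //; case: fVp => v /VU[Uv Wv] <-; exact: fW.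
- exists psi; last by move=> u [Uu _]; exact: imm.
  split; last by move=> u [Uu _]; exact: spsi.
  by apply: holomorphic_sub hpsi => u [].
Qed.

Lemma submanifold_openI : complex_submanifold n X -> complex_submanifold n (X `&` O).
Proof.
move=> mX p [Xp Op]; have [U [f [u [cf Uu fu]]]] := mX p Xp.
have [oU _ _ _ [psi lpsi _]] := cf.
pose W := [set v | U v /\ O (f v)].
have oW : open W.
  rewrite openE => v [Uv Ov]; rewrite /interior.
  have nU : nbhs v U by exact: open_nbhs_nbhs.
  have nO : nbhs (f v) O by exact: open_nbhs_nbhs.
  have := chart_lift_continuous lpsi Uv oU nO; rewrite /nbhs /= => nfO.
  by apply: filterS2 nU nfO.
exists (U `&` W), f, u; split=> //.
  by apply: chart_restrict => // v _ [].
by split => //; split => //; rewrite fu.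
Qed.

End OpenSubset.

(** * The complement of a hyperplane *)

Section AffinePart.
Variables (R : realType) (N : nat) (a : CP R N).
Let E : normedModType R := Cspace R N.+1.

Definition alpha := vpick (val a).
Definition pairing (z : 'rV[R[i]]_N.+1) : R[i] := (z *m alpha^T) 0 0.

Lemma pairingZ c z : pairing (c *: z) = c * pairing z.
Proof. by rewrite /pairing -scalemxAl mxE. Qed.

Lemma hyperplaneE p z : <[z]>%VS = val p -> hyperplane a p <-> pairing z = 0.
Proof.
move=> zp; split=> [hp|pz].
  have zin : z \in val p by rewrite -zp memv_line.
  by rewrite /pairing (hp z zin) ?mxE // /alpha -{2}val_line memv_line.
move=> w; rewrite -zp => /vlineP[c ->] t; rewrite -val_line => /vlineP[d ->].
have z0 : z *m alpha^T = 0 by apply/rowP => i; rewrite ord1 [RHS]mxE.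
by rewrite -scalemxAl linearZ /= -scalemxAr z0 !scaler0.
Qed.

(* The representative z of p with z . alpha = 1; junk when p is on the
   hyperplane a. *)
Definition affine_rep (p : CP R N) : E :=
  uncvec ((pairing (vpick (val p)))^-1 *: vpick (val p)).

Lemma affine_repE p z : <[z]>%VS = val p ->
  cvec (affine_rep p) = (pairing z)^-1 *: z.
Proof.
move=> zp; rewrite uncvecK.
have [c c0 ->] : exists2 c, c != 0 & vpick (val p) = c *: z.
  by apply: eq_lineP; [exact: vpick_neq0|rewrite val_line].
by rewrite pairingZ scalerA invfM mulrAC mulVf // mul1r.
Qed.

Lemma affine_rep_pairing p : ~ hyperplane a p -> pairing (cvec (affine_rep p)) = 1.
Proof.
move=> hp; rewrite (affine_repE (val_line p)) pairingZ mulVf //.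
by apply/eqP => h; apply: hp; apply/(hyperplaneE (val_line p)).
Qed.

Lemma affine_rep_span p : ~ hyperplane a p -> <[cvec (affine_rep p)]>%VS = val p.
Proof.
move=> hp; rewrite (affine_repE (val_line p)) line_scale ?val_line // invr_eq0.
by apply/eqP => h; apply: hp; apply/(hyperplaneE (val_line p)).
Qed.

Lemma hol_pairing n (U : set (Cspace R n)) (psi : Cspace R n -> E) : open U ->
  holomorphic_on U psi -> hol U (fun u => pairing (cvec (psi u))).
Proof. by move=> oU hpsi; exact: hol_mulmx. Qed.

Lemma hyperplane_open : open (~` hyperplane a).
Proof.
rewrite /open /= /CP_open.
rewrite (_ : cone _ = [set z : E | setT z /\ pairing (cvec z) != 0]).
  apply: hol_neq0_open; first exact: openT.
  apply: hol_pairing; [exact: openT|exact: holomorphic_id].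
apply/seteqP; split=> z.
  case=> p hp zp; split=> //; apply/eqP => h; apply: hp.
  by apply/(hyperplaneE zp).
case=> _ pz; have z0 : cvec z != 0.
  by apply: contra_neq pz => ->; rewrite /pairing mul0mx mxE.
exists (CPpt (cvec z)); last by rewrite CPptE.
by move/(hyperplaneE (esym (CPptE z0))) => h; rewrite h eqxx in pz.
Qed.

Section ChartAffine.
Variables (n : nat) (X : set (CP R N)).
Let Y := X `&` ~` hyperplane a.
Variables (U : set (Cspace R n)) (f : Cspace R n -> CP R N).
Hypothesis cf : chart Y U f.
Let G : Cspace R n -> E := fun u => affine_rep (f u).

Let fnH u : U u -> ~ hyperplane a (f u).
Proof. by move=> Uu; case: cf => _ fU _ _ _; apply: (fU _ _).2; exists u. Qed.

Lemma affine_holomorphic : holomorphic_on U G.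
Proof.
have [oU _ _ _ [psi [hpsi spsi] _]] := cf.
have p0 u : U u -> pairing (cvec (psi u)) != 0.
  by move=> Uu; apply/eqP => /(hyperplaneE (spsi u Uu)); exact: fnH.
apply: holomorphic_coords => // j.
apply: (hol_eq oU (g := fun u => (pairing (cvec (psi u)))^-1 * cvec (psi u) 0 j)).
  by move=> u Uu; rewrite (affine_repE (spsi u Uu)) [RHS]mxE.
by apply: hol_mul => //; [apply: hol_inv => //; exact: hol_pairing|exact: hol_coord].
Qed.

Lemma affine_lift : is_lift U f G.
Proof. by split; [exact: affine_holomorphic|move=> u Uu; exact: affine_rep_span (fnH Uu)]. Qed.

Lemma affine_dG u v : U u -> pairing (cvec (dd G u v)) = 0.
Proof.
have [oU _ _ _ _] := cf => Uu.
have dG : differentiable G u by apply: (affine_holomorphic.1 1).1.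
have := Dc_mulmx alpha^T 0 v dG; rewrite /pairing => <-.
rewrite (Dc_eq _ oU Uu (g := fun=> 1)) ?Dc_cst //; last first.
  exact: hol_cdiff (hol_cst 1 oU) Uu.
by move=> y Uy; rewrite -[LHS](affine_rep_pairing (fnH Uy)).
Qed.

(** [chart] gives the immersion condition for some lift psi only. As pairing G = 1 is constant, dG v
    = c G forces c = 0; differentiating psi / pairing(psi) = G in the form psi = pairing(psi) G then
    makes the derivative of psi along v a multiple of psi. *)
Lemma affine_immersion u v : U u ->
  cvec (dd G u v) \in <[cvec (G u)]>%VS -> v = 0.
Proof.
move=> Uu /vlineP[c cE].
have [oU _ _ _ [psi [hpsi spsi] imm]] := cf.
have c0 : c = 0.
  have := affine_dG v Uu; rewrite cE pairingZ affine_rep_pairing ?mulr1 //.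
  exact: fnH.
apply: (imm u Uu); rewrite -ddE.
have dG : differentiable G u by apply: (affine_holomorphic.1 1).1.
have dpsi : differentiable psi u by apply: (hpsi.1 1).1.
have hp := hol_pairing oU hpsi.
apply/vlineP; exists (Dc (fun u => pairing (cvec (psi u))) u v * (pairing (cvec (psi u)))^-1).
have p0 : pairing (cvec (psi u)) != 0.
  by apply/eqP => /(hyperplaneE (spsi u Uu)); exact: fnH.
apply/rowP => j; rewrite [RHS]mxE -Dc_coord //.
have hG := hol_coord j oU affine_holomorphic.
have := (DcM v (hol_cdiff hp Uu) (hol_cdiff hG Uu)).2.
rewrite Dc_coord // cE c0 scale0r [(0 : 'rV__) _ _]mxE mulr0 add0r.
have GE : cvec (G u) 0 j = (pairing (cvec (psi u)))^-1 * cvec (psi u) 0 j.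
  by rewrite (affine_repE (spsi u Uu)) [LHS]mxE.
move=> E0; have := etrans E0 (congr1 (fun t => t * Dc (fun u => pairing (cvec (psi u))) u v) GE).
move=> E1.
rewrite -mulrA [RHS]mulrC -E1; apply: (Dc_eq _ oU Uu).
  move=> y Uy; rewrite (affine_repE (spsi y Uy)) [in LHS]mxE mulrA divff ?mul1r //.
  by apply/eqP => /(hyperplaneE (spsi y Uy)); exact: fnH.
exact: hol_cdiff (hol_mul oU hp hG) Uu.
Qed.

Lemma affine_immersion0 u v : U u -> dd G u v = 0 -> v = 0.
Proof. by move=> Uu dv; apply: (affine_immersion Uu); rewrite dv cvec0 mem0v. Qed.

End ChartAffine.

Lemma affine_rep_inj (X : set (CP R N)) : set_inj (X `&` ~` hyperplane a) affine_rep.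
Proof.
move=> p q; rewrite !inE => -[_ hp] [_ hq] pq; apply: val_inj.
by rewrite -(affine_rep_span hp) -(affine_rep_span hq) pq.
Qed.

End AffinePart.

(** * Properness and the Stein property *)

Section Properness.
Variables (R : realType) (N : nat) (X : set (CP R N)) (a : CP R N).
Hypothesis algX : algebraic_set X.
Let E : normedModType R := Cspace R N.+1.
Let Y := X `&` ~` hyperplane a.

Lemma closed_hol_zero (g : E -> R[i]) : hol setT g -> closed [set z | g z = 0].
Proof.
move=> hg; rewrite -[X in closed X]setCK; apply: open_closedC.
rewrite (_ : ~` _ = [set z | setT z /\ g z != 0]).
  by apply: hol_neq0_open => //; exact: openT.
apply/seteqP; split=> z /=; first by move=> gz; split=> //; exact/eqP.
by case=> _ /eqP.
Qed.

Lemma hol_exp (g : E -> R[i]) k : hol setT g -> hol setT (fun z => g z ^+ k).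
Proof.
move=> hg; elim: k => [|k IH].
  by under eq_fun do rewrite expr0; exact: (hol_cst 1 openT).
by under eq_fun do rewrite exprS; exact: (hol_mul openT).
Qed.

Lemma hol_meval (P : mpoly.mpoly N.+1 R[i]) (c : R[i]) :
  hol setT (fun z : E => mpoly.meval ((c *: cvec z) 0) P).
Proof.
under eq_fun do rewrite mpoly.mevalE.
apply: (@hol_sum R N.+1 setT _ (mpoly.msupp P) xpredT (fun m (x : E) => mpoly.mcoeff m P *
  \prod_i ((c *: cvec x) 0 i) ^+ mpoly.fun_of_multinom m i) openT) => m _; apply: (hol_mul openT); first exact: (hol_cst _ openT).
apply: (@hol_prod R N.+1 setT _ _ xpredT (fun i (x : E) => ((c *: cvec x) 0 i) ^+ mpoly.fun_of_multinom m i) openT) => i _.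
apply: hol_exp.
apply: (hol_eq openT (g := fun z => c * cvec z 0 i)); first by move=> z _; rewrite [RHS]mxE.
apply: (hol_mul openT); first exact: (hol_cst _ openT).
exact: (hol_coord i openT (@holomorphic_id R N.+1)).
Qed.

Lemma CPpt_continuous (z : E) : cvec z != 0 ->
  {for z, continuous (fun z : E => CPpt (cvec z))}.
Proof.
move=> z0 A; rewrite nbhsE => -[B [oB Bz] BA].
have cz : cone B z by exists (CPpt (cvec z)) => //; rewrite CPptE.
have : nbhs z (cone B) by exact: open_nbhs_nbhs.
rewrite /nbhs /=; apply: filterS => t [q Bq qt]; apply: BA.
have t0 : cvec t != 0.
  have := dim_vline (cvec t); rewrite qt (eqP (valP q)).
  by case: (_ != 0).
by have -> : CPpt (cvec t) = q by apply: val_inj; rewrite CPptE.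
Qed.

(** The set is the image under z |-> [z] of the part of K that lies on the cone over X and on the
    affine hyperplane pairing = 1. Both are closed, the cone because X is algebraic, so that part is
    compact. *)
Lemma affine_rep_proper (K : set E) : compact K ->
  compact (Y `&` affine_rep a @^-1` K).
Proof.
move=> cK; have [s _ XE] := algX.
(* [algebraic_set] tests every vector of the line, hence all multiples c z. *)
pose Z := \bigcap_(c in [set: R[i]]) \bigcap_(P in [set P | P \in s])
  [set z : E | mpoly.meval ((c *: cvec z) 0) P = 0].
have cZ : closed Z.
  by apply: closed_bigI => c _; apply: closed_bigI => P _; exact/closed_hol_zero/hol_meval.
pose Z1 := [set z : E | pairing a (cvec z) - 1 = 0].
have cZ1 : closed Z1.
  apply: closed_hol_zero; apply: (hol_add openT); last exact: (hol_cst (-1) openT).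
  exact: hol_pairing openT (@holomorphic_id R N.+1).
pose C := K `&` (Z `&` Z1).
have cC : compact C by apply: compact_closedI => //; exact: closedI.
have Z1_neq0 z : Z1 z -> cvec z != 0.
  move=> /eqP; rewrite /Z1 /= subr_eq0 => /eqP p1; apply/eqP => z0.
  by move: p1; rewrite z0 /pairing mul0mx mxE => /esym/eqP; rewrite oner_eq0.
rewrite (_ : _ `&` _ = (fun z : E => CPpt (cvec z)) @` C).
  apply: continuous_compact => //; apply: continuous_in_subspaceT => z.
  by rewrite inE => -[_ [_ /Z1_neq0 z0]]; exact: CPpt_continuous.
apply/seteqP; split=> p.
  case=> -[Xp hp] Kp; exists (affine_rep a p); last first.
    apply: val_inj; rewrite CPptE; first exact: affine_rep_span hp.
    by apply: Z1_neq0; rewrite /Z1 /= affine_rep_pairing // subrr.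
  split=> //; split; last by rewrite /Z1 /= affine_rep_pairing // subrr.
  move=> c _ P Ps /=; move: Xp; rewrite XE => /(_ (c *: cvec (affine_rep a p))).
  by apply => //; rewrite -(affine_rep_span hp) memvZ // memv_line.
case=> z [Kz [Zz Z1z]] <-; have z0 := Z1_neq0 z Z1z.
have zE := CPptE z0.
have p1 : pairing a (cvec z) = 1 by apply/eqP; rewrite -subr_eq0; apply/eqP; exact: Z1z.
have hp : ~ hyperplane a (CPpt (cvec z)).
  by move=> /(hyperplaneE a (esym zE)) /eqP; rewrite p1 oner_eq0.
split.
  split=> //; rewrite XE => w; rewrite zE => /vlineP[c ->] P Ps; exact: Zz.
rewrite /preimage /= (_ : affine_rep a _ = z) //.
by apply: cvec_inj; rewrite (affine_repE a (esym zE)) p1 invr1 scale1r.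
Qed.

Lemma stein_complement n : complex_submanifold n X -> stein n Y.
Proof.
move=> mX; split; first by apply: submanifold_openI => //; exact: hyperplane_open.
exists N.+1, (affine_rep a); split.
- move=> U f cf; split; first exact: affine_holomorphic cf.
  by move=> u Uu v; rewrite -ddE; exact: (affine_immersion0 cf).
- exact: affine_rep_inj.
- exact: affine_rep_proper.
Qed.

End Properness.

(** * Squared distance functions *)

Section KahlerPotential.
Variables (R : realType) (n : nat).
Let V : normedModType R := Cspace R n.
Implicit Types (U : set V) (q : V -> R) (x u v w : V).

Definition hess q x u v : R := dd (fun y => dd q y v) x u.

Lemma hessianE q x u v : hessian q x u v = hess q x u v.
Proof.
by rewrite /hessian /hess ddE ddfE.
Qed.

Lemma dCE q y v : dC q y v = dd q y (Jmul v).
Proof. by rewrite /dC ddE. Qed.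

Lemma omegaE q x u v : - ext1 (dC q) x u v = hess q x v (Jmul u) - hess q x u (Jmul v).
Proof.
have e w : (fun y => dC q y w) = (fun y => dd q y (Jmul w)).
  by apply/funext => y; exact: dCE.
by rewrite /ext1 -!ddE opprB !e.
Qed.

Section Smooth.
Variables (U : set V) (q : V -> R).
Hypotheses (oU : open U) (sq : smooth_on U q).

Lemma hess_sym x u v : U x -> hess q x u v = hess q x v u.
Proof. by move=> Ux; apply: (smooth_schwarz _ _ oU Ux). Qed.

Lemma hessDl x u v w : hess q x (u + v) w = hess q x u w + hess q x v w.
Proof. exact: ddDl. Qed.

Lemma hessZl x a u w : hess q x (a *: u) w = a * hess q x u w.
Proof. exact: ddZl. Qed.

Lemma hess_smooth u v : smooth_on U (fun x => hess q x u v).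
Proof. by apply: smooth_dd; exact: smooth_dd. Qed.

Let T x w u v := dd (fun y => hess q y u v) x w.

Let T_swap x w u v : U x -> T x w u v = T x u w v.
Proof. by move=> Ux; apply: (smooth_schwarz _ _ oU Ux); exact: smooth_dd. Qed.

(** Closedness is the symmetry of third derivatives: the six terms cancel in pairs. Invariance under
    J and the value Hess(v, v) + Hess(Jv, Jv) on (v, Jv) follow from J^2 = -1. *)
Lemma kahler_potential :
  (forall x, U x -> forall v, v != 0 -> 0 < hess q x v v + hess q x (Jmul v) (Jmul v)) ->
  kahler_form U (fun x u v => - ext1 (dC q) x u v).
Proof.
move=> pos.
have oE : (fun x u v => - ext1 (dC q) x u v) =
    fun x u v => hess q x v (Jmul u) - hess q x u (Jmul v).
  by apply/funext => x; apply/funext => u; apply/funext => v; exact: omegaE.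
rewrite oE {oE}.
have sw u v : smooth_on U (fun x => hess q x v (Jmul u) - hess q x u (Jmul v)).
  by move=> k; apply: Ck_add => //; [exact: hess_smooth|apply: Ck_opp => //; exact: hess_smooth].
split.
- exact: sw.
- move=> x Ux u v a w; split; last by rewrite opprB.
  rewrite JmulD JmulZ hess_sym // hessDl hessZl (hess_sym (Jmul u) v Ux) (hess_sym (Jmul w) v Ux).
  by rewrite hessDl hessZl; ring.
- move=> x Ux u v w; rewrite /ext2 -!ddE.
  have D a b c : dd (fun y => hess q y b (Jmul a) - hess q y a (Jmul b)) x c =
      T x c b (Jmul a) - T x c a (Jmul b).
    have d1 := smooth_differentiable (hess_smooth b (Jmul a)) Ux.
    have d2 := smooth_differentiable (hess_smooth a (Jmul b)) Ux.
    by rewrite ddD //; [rewrite ddN|exact: differentiableN].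
  rewrite !D (T_swap u v) // (T_swap u w) // (T_swap v w) //; ring.
- move=> x Ux u v; rewrite !JmulK.
  have N (y z : V) : hess q x y (- z) = - hess q x y z.
    by rewrite hess_sym // -scaleN1r hessZl mulN1r hess_sym.
  by rewrite !N opprK addrC [in RHS]hess_sym // [X in _ - X]hess_sym //; ring.
- move=> x Ux v v0; rewrite JmulK.
  have N : hess q x v (- v) = - hess q x v v.
    by rewrite hess_sym // -scaleN1r hessZl mulN1r.
  by rewrite N opprK addrC; exact: pos.
Qed.

End Smooth.
End KahlerPotential.

Section SquaredDistance.
Variables (R : realType) (n m : nat).
Let V : normedModType R := Cspace R n.
Let E : normedModType R := Cspace R m.

(** The Euclidean distance is written in coordinates because the norm of [Cspace] is a maximum norm;
    the center is a row vector, the type to which [Baire_rV] applies. *)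
Definition sqdist (c : 'rV[R]_(m + m)) (z : E) : R := \sum_k (crd k z - c 0 k) ^+ 2.

Variables (U : set V) (G : V -> E) (c : 'rV[R]_(m + m)).
Hypotheses (oU : open U) (hG : holomorphic_on U G).

Let q u := sqdist c (G u).
Let g k u := crd k (G u).

Lemma crd_smooth k : smooth_on U (g k).
Proof. by move=> p; apply: Ck_crd => //; exact: hG.1. Qed.

Let dg k x : U x -> differentiable (g k) x.
Proof. by move=> Ux; exact: smooth_differentiable (crd_smooth k) Ux. Qed.

Let ddg k v x : U x -> differentiable (fun y => dd (g k) y v) x.
Proof. by move=> Ux; exact: smooth_differentiable (smooth_dd v (crd_smooth k)) Ux. Qed.

Lemma sqdist_smooth : smooth_on U q.
Proof.
move=> p; apply: Ck_sum => // k _.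
have C : Ck p U (fun x => g k x - c 0 k).
  by apply: Ck_add => //; [exact: crd_smooth|exact: Ck_cst].
apply: (Ck_eq oU) (Ck_mul oU C C) => x _; by rewrite expr2.
Qed.

Lemma dd_sqdist x v : U x ->
  dd q x v = 2 * \sum_k (g k x - c 0 k) * dd (g k) x v.
Proof.
move=> Ux; have dk k : differentiable (fun y => g k y - c 0 k) x.
  by apply: differentiableB; [exact: dg|exact: differentiable_cst].
have E1 : q = fun y => \sum_k (g k y - c 0 k) * (g k y - c 0 k).
  by apply/funext => y; apply: eq_bigr => k _; rewrite expr2.
rewrite E1 dd_sum; last by move=> k _; exact: differentiableM.
rewrite mulr_sumr; apply: eq_bigr => k _; rewrite ddM //.
rewrite ddD ?dd_cst ?addr0; [|exact: dg|exact: differentiable_cst].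
by rewrite mulrA mulr_natl mulrnAl mulr2n.
Qed.

Lemma hess_sqdist x u v : U x -> hess q x u v =
  2 * \sum_k (dd (g k) x u * dd (g k) x v +
              (g k x - c 0 k) * dd (fun y => dd (g k) y v) x u).
Proof.
move=> Ux; rewrite /hess.
have dk k : differentiable (fun y => g k y - c 0 k) x.
  by apply: differentiableB; [exact: dg|exact: differentiable_cst].
have dp k : differentiable (fun y => (g k y - c 0 k) * dd (g k) y v) x.
  by apply: differentiableM; [exact: dk|exact: ddg].
have ds : differentiable (fun y => \sum_k (g k y - c 0 k) * dd (g k) y v) x.
  exact: differentiable_bigsum.
have [_ ->] := dd_eq_on u oU Ux (fun y Uy => esym (dd_sqdist v Uy))
  (differentiableM (differentiable_cst (2 : R) x) ds).
rewrite ddM ?dd_cst ?mulr0 ?addr0 //; congr (2 * _).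
have E1 k : dd (fun y => (g k y - c 0 k) * dd (g k) y v) x u =
    dd (g k) x u * dd (g k) x v + (g k x - c 0 k) * dd (fun y => dd (g k) y v) x u.
  rewrite ddM //; last exact: ddg.
  rewrite ddD ?dd_cst ?addr0; [|exact: dg|exact: differentiable_cst].
  by rewrite addrC mulrC.
rewrite dd_sum; first by apply: eq_bigr => k _; exact: E1.
by move=> k _; exact: dp.
Qed.

(* sum_j conj(G - c)_j d^2 G_j, the second fundamental form in the direction
   of the conormal vector conj(G - c) when x is a critical point. *)
Definition sffc x u v : R[i] := \sum_j Complex (g (lshift m j) x - c 0 (lshift m j))
   (- (g (rshift m j) x - c 0 (rshift m j))) *
   Dc (fun y => Dc (fun z => cvec (G z) 0 j) y v) x u.

Lemma Re_sffc x u v : complex.Re (sffc x u v) =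
  \sum_k (g k x - c 0 k) * dd (fun y => dd (g k) y v) x u.
Proof.
rewrite /sffc (big_morph (@complex.Re R) (@cReD R) (erefl _)) big_split_ord /= -big_split /=.
have re j : (fun z => complex.Re (cvec (G z) 0 j)) = g (lshift m j).
  by apply/funext => z; rewrite mxE /g crd_lshift.
have im j : (fun z => complex.Im (cvec (G z) 0 j)) = g (rshift m j).
  by apply/funext => z; rewrite mxE /g crd_rshift.
have re' j : cRe (fun y => Dc (fun z => cvec (G z) 0 j) y v) =
    fun y => dd (g (lshift m j)) y v.
  by apply/funext => y; rewrite /cRe /Dc /= /cRe re.
have im' j : cIm (fun y => Dc (fun z => cvec (G z) 0 j) y v) =
    fun y => dd (g (rshift m j)) y v.
  by apply/funext => y; rewrite /cIm /Dc /= /cIm im.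
by apply: eq_bigr => j _; rewrite re' im' mulNr opprK.
Qed.

Lemma sffc_sym x u v : U x -> sffc x u v = sffc x v u.
Proof.
move=> Ux; apply: eq_bigr => j _; congr (_ * _).
have [sr si _] := hol_coord j oU hG.
by rewrite /Dc; congr Complex; apply: (smooth_schwarz _ _ oU Ux).
Qed.

Lemma sffc_cbase x u v : U x -> sffc x u v =
  (cvec u *m (\matrix_(i, j) sffc x (cbase R i) (cbase R j)) *m (cvec v)^T) 0 0.
Proof.
have lin1 u' v' : U x -> sffc x u' v' = \sum_i cvec u' 0 i * sffc x (cbase R i) v'.
  move=> Ux; rewrite /sffc; under [RHS]eq_bigr => i _ do rewrite mulr_sumr.
  rewrite exchange_big /=; apply: eq_bigr => j _.
  have hj := hol_Dc v' oU (hol_coord j oU hG).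
  by rewrite (Dc_cbase u' hj Ux) mulr_sumr; apply: eq_bigr => i _; rewrite mulrCA.
move=> Ux; rewrite (lin1 u v Ux).
under eq_bigr => i _ do rewrite (sffc_sym _ _ Ux) (lin1 v _ Ux) mulr_sumr.
rewrite exchange_big mxE; apply: eq_bigr => j _.
rewrite [X in X * _]mxE [X in _ * X]mxE mulr_suml; apply: eq_bigr => i _.
rewrite [(\matrix_(_, _) _) i j]mxE (sffc_sym (cbase R j) _ Ux).
by rewrite [cvec v 0 j * _]mulrC mulrA.
Qed.

Lemma sffcJ x u v : U x -> sffc x (Jmul u) (Jmul v) = - sffc x u v.
Proof.
move=> Ux; rewrite (sffc_cbase (Jmul u)) // (sffc_cbase u v Ux) !cvecJ.
have ii : iC * iC = -1 :> R[i].
  by apply: cplx_ext => /=; rewrite !(mul0r, mulr0, mulr1, sub0r, addr0, oppr0).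
rewrite [(iC *: cvec v)^T]linearZ /= -scalemxAr -!scalemxAl scalerA ii.
by rewrite [LHS]mxE mulN1r.
Qed.

Lemma hess_sqdist_sff x u v : U x -> hess q x u v =
  2 * (\sum_k dd (g k) x u * dd (g k) x v + complex.Re (sffc x u v)).
Proof. by move=> Ux; rewrite hess_sqdist // Re_sffc big_split. Qed.

Hypothesis immG : forall x v, U x -> dd G x v = 0 -> v = 0.

Lemma metric_gt0 x v : U x -> v != 0 -> 0 < \sum_k dd (g k) x v * dd (g k) x v.
Proof.
move=> Ux v0; rewrite lt_def; apply/andP; split; last first.
  by apply: sumr_ge0 => k _; rewrite -expr2 sqr_ge0.
apply: contra_neq v0 => /eqP s0; apply: (immG Ux); apply: crd_ext => k.
rewrite linear0 -dd_crd; last by apply: (hG.1 1).1.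
move: s0; rewrite psumr_eq0 => [/allP /(_ k)|l _]; last by rewrite -expr2 sqr_ge0.
by rewrite mem_index_enum mulf_eq0 orbb => /(_ isT) /eqP.
Qed.

(** The second fundamental form cancels between v and Jv by [sffcJ]; only the metric terms
    remain. *)
Lemma sqdist_levi x v : U x -> v != 0 ->
  0 < hess q x v v + hess q x (Jmul v) (Jmul v).
Proof.
move=> Ux v0; rewrite !hess_sqdist_sff // sffcJ // cReN -mulrDr.
rewrite addrACA subrr addr0 mulr_gt0 // ltr_pwDl ?metric_gt0 //.
by apply: sumr_ge0 => k _; rewrite -expr2 sqr_ge0.
Qed.

Lemma sqdist_kahler : kahler_form U (fun x u v => - ext1 (dC q) x u v).
Proof.
apply: kahler_potential => //; first exact: sqdist_smooth.
by move=> x Ux v; exact: sqdist_levi.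
Qed.

End SquaredDistance.

Section Exhausting.
Variables (R : realType) (m : nat) (c : 'rV[R]_(m + m)).

Lemma sqdist_continuous : continuous (sqdist c).
Proof.
have s := sqdist_smooth c openT (@holomorphic_id R m).
by move=> z; exact: (s 0 z).
Qed.

Lemma sqdist_ge0 z : 0 <= sqdist c z.
Proof. by apply: sumr_ge0 => k _; exact: sqr_ge0. Qed.

Lemma sqdist_proper (K : set R) : compact K -> compact (sqdist c @^-1` K).
Proof.
move=> cK; have [M [_ HM]] := compact_bounded cK.
have M1 : M < `|M| + 1 by apply: le_lt_trans (ler_norm M) _; rewrite ltrDl.
have {HM} := HM _ M1; set B := `|M| + 1 => KB.
(* B is at least 1 so that |t|^2 <= B implies |t| <= B. *)
have B1 : 1 <= B by rewrite /B lerDr.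
apply: (subclosed_compact _ (@closed_box_compact R m (of_crd c) B)).
  apply: preimage_closed => [z _|]; first exact: sqdist_continuous.
  by apply: compact_closed => //; exact: Rhausdorff.
move=> z Kz; have zB : sqdist c z <= B by exact: le_trans (ler_norm _) (KB _ Kz).
apply: norm_crd => [|k]; first exact: le_trans ler01 B1.
rewrite linearB /= crd_of; set t := _ - _.
have kB : `|t| ^+ 2 <= B.
  rewrite real_normK ?num_real //; apply: le_trans zB; rewrite /sqdist (bigD1 k) //= lerDl.
  by apply: sumr_ge0 => l _; exact: sqr_ge0.
rewrite leNgt; apply/negP => lt; move: kB; rewrite leNgt => /negP; apply.
apply: (lt_le_trans lt); rewrite expr2 ler_peMl //.
by rewrite ltW // (le_lt_trans B1 lt).
Qed.

End Exhausting.

(** * The Morse index *)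

Lemma wide_kernel (F : fieldType) p q (M : 'M[F]_(p, q)) : (q < p)%N ->
  exists2 x : 'rV[F]_p, x != 0 & x *m M = 0.
Proof.
move=> qp; have : kermx M != 0.
  rewrite -mxrank_eq0 mxrank_ker subn_eq0 -ltnNge.
  exact: leq_ltn_trans (rank_leq_col M) qp.
by move=> /rowV0Pn[x /sub_kermxP xM x0]; exists x.
Qed.

(* If 2 dim W exceeded 2 rank Q, the real-linear map (w1, w2) |-> (w1 + i w2) Q
   into the row space of Q would vanish somewhere on W x W; there w1 and i w2
   have the same value under Re Q, which is negative on W and positive on i W. *)
Lemma negative_subspace_rank (R : realType) (n : nat) (Q : 'M[R[i]]_n)
    (W : {vspace Cspace R n}) : Q^T = Q ->
  (forall w, w \in W -> w != 0 ->
     complex.Re ((cvec w *m Q *m (cvec w)^T) 0 0) < 0) ->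
  (\dim W <= \rank Q)%N.
Proof.
move=> symQ neg; set k := \dim W; set r := \rank Q.
rewrite leqNgt; apply/negP => rk.
pose b := vbasis W.
pose Z (v : Cspace R n) : Cspace R r := uncvec (cvec v *m col_base Q).
have Z_lin a v w : Z (a *: v + w) = a *: Z v + Z w.
  apply: cvec_inj; rewrite uncvecK [RHS]cvecD [cvec (_ *: Z _)]cvecZ !uncvecK.
  by rewrite cvecD cvecZ mulmxDl -scalemxAl.
pose Pm (v : Cspace R n) : 'rV[R]_(r + r) := row_mx (Z v).1 (Z v).2.
have Pm_lin : linear Pm.
  by move=> a v w; rewrite /Pm Z_lin /= -add_row_mx -scale_row_mx.
pose P := mklinear Pm_lin.
have PE v : P v = Pm v by [].
have P0 v : P v = 0 -> cvec v *m Q = 0.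
  rewrite PE /Pm -[RHS](row_mx0 R 1 r r) => /eq_row_mx[re im].
  have z0 : cvec v *m col_base Q = 0.
    rewrite -[LHS]uncvecK -/(Z v) (_ : Z v = 0) ?cvec0 //.
    by rewrite [Z v]surjective_pairing re im.
  by rewrite -[Q]mulmx_base mulmxA z0 mul0mx.
pose M : 'M[R]_(k + k, r + r) :=
  col_mx (\matrix_i P b`_i) (\matrix_i P (Jmul b`_i)).
have [|x x0] := wide_kernel M; first by rewrite -addSn leq_add // ltnW.
rewrite -(hsubmxK x) mul_row_col; set y := lsubmx x; set z := rsubmx x => xM.
pose comb (t : 'rV[R]_k) := \sum_i t 0 i *: b`_i.
have combW t : comb t \in W.
  apply: memv_suml => i _; apply/memvZ/vbasis_mem/mem_nth.
  by rewrite size_tuple.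
have comb0 t : comb t = 0 -> t = 0.
  move=> t0; apply/rowP => i; rewrite [RHS]mxE.
  have fb : free b by exact: basis_free (vbasisP W).
  exact: (freeP fb (fun i => t 0 i) t0 i).
have combP (f : {linear Cspace R n -> 'rV[R]_(r + r)}) (t : 'rV[R]_k) :
    t *m (\matrix_i f b`_i) = f (comb t).
  rewrite mulmx_sum_row linear_sum; apply: eq_bigr => i _.
  by rewrite rowK linearZ.
have J_lin : linear (fun v : Cspace R n => Pm (Jmul v)).
  by move=> a v w; rewrite JmulD JmulZ Pm_lin.
have PK : P (comb y + Jmul (comb z)) = 0.
  by rewrite linearD -(combP P) -[P (Jmul _)]/(mklinear J_lin (comb z)) -(combP (mklinear J_lin)).
have K0 := P0 _ PK; set K := comb y + Jmul (comb z) in K0.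
pose S v w := (cvec v *m Q *m (cvec w)^T) 0 0.
have SE : S (comb y) (comb y) = - S (comb z) (comb z).
  have yE : cvec (comb y) = cvec K - iC *: cvec (comb z).
    by rewrite /K cvecD cvecJ addrK.
  have QK : Q *m (cvec K)^T = 0 by apply: trmx_inj; rewrite trmx_mul trmxK symQ K0 trmx0.
  rewrite /S yE mulmxBl K0 sub0r linearB /= mulmxBr mulNmx -mulmxA.
  rewrite -scalemxAl -mulmxA QK mulmx0 scaler0 oppr0 sub0r.
  rewrite [(iC *: _)^T]linearZ /= mulNmx opprK -!scalemxAr -!scalemxAl scalerA.
  have ii : iC * iC = -1 :> R[i].
    by apply: cplx_ext => /=; rewrite !(mul0r, mulr0, mulr1, sub0r, addr0, oppr0).
  by rewrite ii -mulmxA [LHS]mxE mulN1r.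
have y0 : comb y = 0.
  apply/eqP/negPn/negP => yn0; have := neg _ (combW y) yn0.
  rewrite -/(S (comb y) (comb y)) SE cReN oppr_lt0.
  have [-> |zn0] := eqVneq (comb z) 0.
    by rewrite /S cvec0 mul0mx mul0mx mxE ltxx.
  by move=> lt; have := lt_trans lt (neg _ (combW z) zn0); rewrite ltxx.
have z0 : comb z = 0.
  apply/eqP/negPn/negP => zn0; have := neg _ (combW z) zn0.
  rewrite -/(S (comb z) (comb z)) -oppr_gt0 -cReN -SE y0.
  by rewrite /S cvec0 mul0mx mul0mx mxE ltxx.
by move/eqP: x0; apply; rewrite -(hsubmxK x) -/y -/z (comb0 _ y0) (comb0 _ z0) row_mx0.
Qed.

Section MorseIndex.
Variables (R : realType) (N n : nat) (X : set (CP R N)) (a : CP R N).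
Let Y := X `&` ~` hyperplane a.
Variables (U : set (Cspace R n)) (f : Cspace R n -> CP R N).
Hypothesis cf : chart Y U f.
Variable c : 'rV[R]_(N.+1 + N.+1).
Let G u := affine_rep a (f u).
Let q u := sqdist c (G u).

(** The affine conormal vector conj(G - c) is completed to a homogeneous vector b annihilating the
    whole jet at x; the bound on the dual variety then applies to Q in the direction b, whose rank
    is at least the index. *)
Lemma morse_index_codim x : U x -> critical q x ->
  (codim (dual_variety n X) + morse_index q x <= n.+1)%N.
Proof.
move=> Ux crit.
have [oU _ _ _ _] := cf.
have hG := affine_holomorphic cf.
have imm u (Uu : U u) v := @affine_immersion _ _ _ _ _ _ _ cf u v Uu.
have imm0 u v : U u -> dd G u v = 0 -> v = 0 by move=> Uu; exact: (affine_immersion0 cf Uu).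
have cX : chart X U f by apply: chart_openI cf; exact: hyperplane_open.
have lG := affine_lift cf.
have dG : differentiable G x by apply: (hG.1 1).1.
have fnH : ~ hyperplane a (f x) by case: cf => _ fU _ _ _; apply: (fU _ _).2; exists x.
pose w j : R[i] := Complex (crd (lshift N.+1 j) (G x) - c 0 (lshift N.+1 j))
   (- (crd (rshift N.+1 j) (G x) - c 0 (rshift N.+1 j))).
pose Pc v : R[i] := \sum_j w j * Dc (fun y => cvec (G y) 0 j) x v.
have RePc v : complex.Re (Pc v) = 0.
  have := crit v; rewrite -ddE (dd_sqdist c oU hG) // => /eqP.
  rewrite mulf_eq0 pnatr_eq0 /= => /eqP <-.
  rewrite /Pc (big_morph (@complex.Re R) (@cReD R) (erefl _)) big_split_ord /= -big_split /=.
  have re j : cRe (fun y => cvec (G y) 0 j) = fun y => crd (lshift N.+1 j) (G y).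
    by apply/funext => y; rewrite /cRe mxE crd_lshift.
  have im j : cIm (fun y => cvec (G y) 0 j) = fun y => crd (rshift N.+1 j) (G y).
    by apply/funext => y; rewrite /cIm mxE crd_rshift.
  by apply: eq_bigr => j _; rewrite re im mulNr opprK.
have PcJ v : Pc (Jmul v) = iC * Pc v.
  rewrite /Pc mulr_sumr; apply: eq_bigr => j _.
  by have [_ _ ->] := hol_coord j oU hG; rewrite // mulrCA.
(* Pc satisfies Pc (Jv) = i Pc v, so a vanishing real part makes it vanish. *)
have Pc0 v : Pc v = 0.
  apply: cplx_ext; first exact: RePc.
  have := RePc (Jmul v); rewrite PcJ cReM /= mul0r mul1r sub0r => /eqP.
  by rewrite oppr_eq0 => /eqP.
(* alpha pairs to 1 with G x and to 0 with dG, so subtracting lam alpha makes b vanish on G x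
   without changing it on tangent vectors. *)
pose lam : R[i] := \sum_j w j * cvec (G x) 0 j.
pose b : 'rV[R[i]]_N.+1 := \row_j w j - lam *: alpha a.
have rowT (z : 'rV[R[i]]_N.+1) : (z *m b^T) 0 0 =
    \sum_j w j * z 0 j - lam * pairing a z.
  rewrite /b linearB /= mulmxBr linearZ /= -scalemxAr [LHS]mxE [X in _ + X]mxE.
  rewrite [X in _ - X]mxE; congr (_ - _); rewrite mxE; apply: eq_bigr => j _.
  by rewrite !mxE mulrC.
have b1 : cvec (G x) *m b^T = 0.
  apply/rowP => i; rewrite ord1 rowT affine_rep_pairing // mulr1 subrr.
  by rewrite mxE.
have b2 v : cvec (dd G x v) *m b^T = 0.
  apply/rowP => i; rewrite ord1 rowT (affine_dG cf v Ux) mulr0 subr0 [RHS]mxE.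
  by rewrite -[RHS](Pc0 v); apply: eq_bigr => j _; rewrite Dc_coord.
(* The term lam alpha does not contribute: pairing G = 1 on the chart, so its second derivatives
   vanish. *)
have sffb : sff G x b = \matrix_(i, j) sffc G c x (cbase R i) (cbase R j).
  apply/matrixP => i j; rewrite !mxE /sffc.
  pose D2 k := Dc (fun y => Dc (fun z => cvec (G z) 0 k) y (cbase R j)) x (cbase R i).
  have D20 : \sum_k alpha a 0 k * D2 k = 0.
    have hk k : hol U (fun y => Dc (fun z => cvec (G z) 0 k) y (cbase R j)).
      by apply: hol_Dc => //; exact: hol_coord.
    have ck k : cdiff (fun _ : Cspace R n => alpha a 0 k) x.
      by split; exact: differentiable_cst.
    have [_ E1] := cdiff_sum (index_enum _) (cbase R i) (P := xpredT)
      (fun k _ => (DcM (cbase R i) (ck k) (hol_cdiff (hk k) Ux)).1).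
    have : \sum_k Dc (fun y => alpha a 0 k * Dc (fun z => cvec (G z) 0 k) y (cbase R j)) x (cbase R i) = 0.
      rewrite -E1 (Dc_eq _ oU Ux (g := fun=> 0)) ?Dc_cst //; last exact: hol_cdiff (hol_cst 0 oU) Ux.
      move=> y Uy; have := affine_dG cf (cbase R j) Uy; rewrite /pairing mxE => E2.
      rewrite -[LHS]E2.
      apply: eq_bigr => k _; rewrite Dc_coord; last by apply: (hG.1 1).1.
      by rewrite [(alpha a)^T _ _]mxE mulrC.
    move=> E3; rewrite -[RHS]E3; apply: eq_bigr => k _.
    by rewrite (DcM _ (ck k) (hol_cdiff (hk k) Ux)).2 Dc_cst mulr0 addr0.
  have -> : \sum_k b 0 k * D2 k = \sum_k w k * D2 k - lam * \sum_k alpha a 0 k * D2 k.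
    rewrite mulr_sumr -sumrB; apply: eq_bigr => k _.
    by rewrite !mxE mulrBl mulrA.
  by rewrite D20 mulr0 subr0.
(* The metric part of the Hessian is nonnegative, so a negative Hessian forces Re Q < 0. *)
have idx : (morse_index q x <= \rank (sff G x b))%N.
  apply/bigmax_leqP => k /asboolP[W Wk neg].
  rewrite -Wk; apply: negative_subspace_rank.
    rewrite sffb; apply/matrixP => i j; rewrite !mxE.
    exact: (sffc_sym c oU hG).
  move=> v vW v0; rewrite sffb -(sffc_cbase c oU hG) //.
  have := neg v vW v0; rewrite hessianE (hess_sqdist_sff c oU hG) // pmulr_rlt0 //.
  apply: le_lt_trans; rewrite lerDr; apply: sumr_ge0 => l _.
  by rewrite -expr2 sqr_ge0.
(* If b = 0 there is no tangent hyperplane to move, but then Q = 0 and the index is 0. *)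
have [b0|b0] := eqVneq b 0.
  move: idx; rewrite (_ : sff G x b = 0) ?mxrank0 ?leqn0.
    by move=> /eqP ->; rewrite addn0; exact: (codim_dual_variety_le cX lG imm Ux).
  by apply/matrixP => i j; rewrite !mxE big1 // => k _; rewrite b0 mxE mul0r.
have bj := tangent_jet b1 b2.
apply: leq_trans (codim_dual_variety cX lG imm Ux b0 bj).
by rewrite leq_add2l.
Qed.

End MorseIndex.

(** * Changes of charts *)

(** Near u the increments of h and of the identity differ by a small multiple of |z - u|. Continuity
    of tau allows z = tau y, and h (tau y) = k y then transfers the linear expansion of k to tau. *)
Lemma inverse_diff (R : realType) (V W : normedModType R) (h : V -> V)
    (k : W -> V) (tau : W -> V) (u : V) (x : W) :
  differentiable h u -> (forall v, dd h u v = v) -> differentiable k x ->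
  {for x, continuous tau} -> tau x = u -> (\forall y \near x, h (tau y) = k y) ->
  is_diff x tau ('d k x).
Proof.
move=> dh dhu dk ct tx hk.
have hkx : h u = k x by have := nbhs_singleton hk; rewrite tx.
have ck : continuous ('d k x) by exact: diff_continuous.
have [C C0 HC] := linear_lipschitz ck.
have near_tau (e : R) : 0 < e -> \forall y \near (0 : W),
    `|k (y + x) - k x - (tau (y + x) - u)| <= e * `|tau (y + x) - u|.
  move=> e0; have [d d0 Hd] := diff_epsD dh e0.
  have nt : \forall y \near x, `|tau y - u| < d.
    have ct' : `|tau y - u| @[y --> x] --> `|tau x - u|.
      by apply: cvg_norm; apply: cvgB; [exact: ct|exact: cvg_cst].
    by apply: (cvgr_lt _ ct'); rewrite tx subrr normr0.
  have : \forall y \near x, `|k y - k x - (tau y - u)| <= e * `|tau y - u|.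
    apply: filterS2 nt hk => y ty hy.
    by have := Hd _ ty; rewrite subrK hy hkx dhu.
  rewrite (near_shift 0 x) /=; apply: filterS => y.
  by rewrite subr0.
have near_k (e : R) : 0 < e -> \forall y \near (0 : W),
    `|k (y + x) - k x - 'd k x y| <= e * `|y| by exact: diff_eps.
apply: eps_diff => // e e0.
(* The increment of tau is at most twice that of k, as e1 <= 1/2, and the increment of k is at most
   C + 1 times |y|, by its expansion with error 1; the last 1 is the error in the expansion of k. *)
pose K := 2 * (C + 1) + 1.
have K0 : 0 < K by rewrite /K; lra.
pose e1 := Num.min (e / K) 2^-1.
have e10 : 0 < e1 by rewrite /e1 lt_min divr_gt0 //= invr_gt0.
have e1e : e1 * K <= e by rewrite -ler_pdivlMr // /e1 ge_min lexx.
have e12 : e1 <= 2^-1 by rewrite /e1 ge_min lexx orbT.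
have N1 := near_tau _ e10; have N2 := near_k _ e10; have N3 := near_k _ (@ltr01 R).
apply: filterS3 N1 N2 N3 => y; rewrite tx.
set a := k (y + x) - k x; set b := tau (y + x) - u; set l := 'd k x y => H1 H2 H3.
have l1 : `|l| <= C * `|y| by exact: HC.
have a1 : `|a| <= (C + 1) * `|y|.
  have := ler_normD (a - l) l; rewrite subrK => /le_trans; apply.
  by rewrite mulrDl addrC; apply: lerD => //; rewrite mul1r in H3 *.
have b1 : `|b| <= 2 * `|a|.
  have := ler_normB a (a - b); rewrite opprB addrC subrK => H.
  have : `|b| <= `|a| + 2^-1 * `|b|.
    apply: (le_trans H); rewrite lerD2l; apply: (le_trans H1).
    by apply: ler_wpM2r.
  lra.
have := ler_normD (b - a) (a - l); rewrite addrA subrK => /le_trans; apply.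
rewrite distrC; apply: (@le_trans _ _ (e1 * (2 * ((C + 1) * `|y|)) + e1 * `|y|)).
  apply: lerD => //; apply: (le_trans H1); apply: ler_wpM2l; first exact: ltW.
  by apply: (le_trans b1); rewrite ler_pM2l.
apply: (@le_trans _ _ (e1 * K * `|y|)); last by apply: ler_wpM2r.
by rewrite /K; lra.
Qed.

Section Transition.
Variables (R : realType) (N n : nat) (X : set (CP R N)) (a : CP R N).
Let Y := X `&` ~` hyperplane a.
Let V : normedModType R := Cspace R n.
Variables (U U' : set V) (f f' : V -> CP R N) (u x : V).
Hypotheses (cf : chart Y U f) (cf' : chart Y U' f').
Hypotheses (Uu : U u) (Ux : U' x) (fux : f u = f' x).
Let G u := affine_rep a (f u).
Let G' u := affine_rep a (f' u).

Let oU : open U. Proof. by case: cf. Qed.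
Let oU' : open U'. Proof. by case: cf'. Qed.
Let hG : holomorphic_on U G. Proof. exact: affine_holomorphic cf. Qed.
Let hG' : holomorphic_on U' G'. Proof. exact: affine_holomorphic cf'. Qed.
Let dG : differentiable G u. Proof. by apply: (hG.1 1).1. Qed.
Let dG' : differentiable G' x. Proof. by apply: (hG'.1 1).1. Qed.

Lemma transition_exists : exists tau : V -> V,
  [/\ tau x = u, {for x, continuous tau} &
      \forall y \near x, U (tau y) /\ f (tau y) = f' y].
Proof.
(* tau chooses preimages under f of the points f' y; its values are arbitrary where there are
   none. *)
have ex y : exists w, (exists w', U w' /\ f w' = f' y) -> U w /\ f w = f' y.
  have [[w' H]|H] := pselect (exists w', U w' /\ f w' = f' y); first by exists w'.
  by exists u.
have [tau Htau] := choice ex.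
have [_ fU inj hom _] := cf.
have [_ fU' _ _ [psi lpsi _]] := cf'.
have tx : tau x = u.
  have [Ut ft] := Htau x (ex_intro _ u (conj Uu fux)).
  by apply: inj; rewrite ?inE // ft.
(* [hom] makes the image of W open in Y, and f' is continuous, so f' y stays in this image for y
   near x. *)
have nW W : open W -> W `<=` U -> W u ->
    \forall y \near x, W (tau y) /\ f (tau y) = f' y.
  move=> oW sW Wu; have [A oA fW] := hom W oW sW.
  have Ax : A (f' x).
    have : (f @` W) (f u) by exists u.
    by rewrite fW -fux => -[].
  have nA : nbhs (f' x) A by exact: open_nbhs_nbhs.
  have n1 : \forall y \near x, A (f' y).
    by have := chart_lift_continuous lpsi Ux oU' nA; rewrite /nbhs /=.
  have n2 : nbhs x U' by exact: open_nbhs_nbhs.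
  apply: filterS2 n1 n2 => y Ay U'y.
  have : (Y `&` A) (f' y) by split=> //; apply: fU'; exists y.
  rewrite -fW => -[w Ww fw]; have Uw := sW _ Ww.
  have [Ut ft] := Htau y (ex_intro _ w (conj Uw fw)).
  have -> : tau y = w by apply: inj; rewrite ?inE // ft.
  by split.
exists tau; split=> //; last exact: nW.
move=> B; rewrite tx nbhsE => -[W [oW Wu] WB].
have := nW (W `&` U) (openI oW oU) (@subIsetr _ _ _) (conj Wu Uu).
by apply: filterS => y [[Wy _] _]; exact: WB.
Qed.

(** Let P be a left inverse of dG at u. Then P G has the identity as differential at u, and
    [inverse_diff] applies to P G tau = P G'. T is invertible because a vector that it kills is also
    killed by dG' = dG dtau. *)
Lemma transition_diff : exists tau : V -> V, exists T : 'M[R[i]]_n,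
  [/\ tau x = u, differentiable tau x,
      forall v, cvec (dd tau x v) = cvec v *m T, T \in unitmx &
      \forall y \near x, U (tau y) /\ f (tau y) = f' y].
Proof.
have [tau [tx ct nt]] := transition_exists.
pose D := \matrix_(i < n) cvec (dd G u (cbase R i)).
pose D' := \matrix_(i < n) cvec (dd G' x (cbase R i)).
have DE v : cvec (dd G u v) = cvec v *m D by exact: cvec_dd_sum oU Uu hG.
have DE' v : cvec (dd G' x v) = cvec v *m D' by exact: cvec_dd_sum oU' Ux hG'.
have Dfree : row_free D.
  rewrite -kermx_eq0; apply/rowV0P => c /sub_kermxP cD.
  rewrite -[c]uncvecK (_ : uncvec c = 0) ?cvec0 //.
  apply: (affine_immersion0 cf Uu); apply: cvec_inj.
  by rewrite -/G DE uncvecK cD cvec0.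
have [Q DQ] := row_freeP Dfree.
have P_lin : linear (fun z : Cspace R N.+1 => uncvec (cvec z *m Q) : V).
  move=> c y z; apply: cvec_inj; rewrite uncvecK [RHS]cvecD [cvec (_ *: uncvec _)]cvecZ !uncvecK.
  by rewrite cvecD cvecZ mulmxDl scalemxAl.
pose P := mklinear P_lin.
have PE z : cvec (P z) = cvec z *m Q by rewrite -[LHS]/(cvec (uncvec _)) uncvecK.
have Pc : continuous P by exact: lin_cont.
have dh : differentiable (fun w => P (G w)) u by exact: differentiable_lin_comp.
have dk : differentiable (fun w => P (G' w)) x by exact: differentiable_lin_comp.
have dhu v : dd (fun w => P (G w)) u v = v.
  by rewrite dd_lin //; apply: cvec_inj; rewrite PE DE -mulmxA DQ mulmx1.
have hk : \forall y \near x, P (G (tau y)) = P (G' y).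
  by apply: filterS nt => y [_ fy]; rewrite /G fy.
have dt := inverse_diff dh dhu dk ct tx hk.
have dtau : differentiable tau x by exact: ex_diff.
have tT v : cvec (dd tau x v) = cvec v *m (D' *m Q).
  by rewrite ddE diff_val -ddE dd_lin // PE DE' mulmxA.
exists tau, (D' *m Q); split=> //.
rewrite -row_free_unit -kermx_eq0; apply/rowV0P => c /sub_kermxP cT.
rewrite -[c]uncvecK (_ : uncvec c = 0) ?cvec0 //.
apply: (affine_immersion0 cf' Ux); rewrite -/G'.
have nG : \forall y \near x, G (tau y) = G' y.
  by apply: filterS nt => y [_ fy]; rewrite /G fy.
have dGt : differentiable G (tau x) by rewrite tx.
have dGtau : differentiable (fun y => G (tau y)) x by exact: (differentiable_comp dtau dGt).
have e1 := near_eq_is_diff nG dGtau.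
rewrite ddE diff_val -ddE dd_comp //.
have -> : dd tau x (uncvec c) = 0.
  by apply: cvec_inj; rewrite tT uncvecK cT cvec0.
exact: dd0l.
Qed.

End Transition.

(** * Hessians at critical points under a change of chart *)

Section HessianTransfer.
Variables (R : realType) (n : nat).
Let V : normedModType R := Cspace R n.
Implicit Types (U : set V) (q : V -> R).

(** Mean value theorem along the segment for q minus its expected quadratic part; as the first
    derivatives vanish at u, the derivative of this difference is controlled by their
    differentiability at u. *)
Lemma taylor_critical U q u : open U -> U u -> smooth_on U q ->
  (forall v, dd q u v = 0) -> forall e : R, 0 < e ->
  exists2 d : R, 0 < d & forall h, `|h| < d ->
    `|q (h + u) - q u - 2^-1 * hess q u h h| <= e * `|h| ^+ 2.
Proof.
move=> oU Uu sq crit e e0.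
pose e' := e / (n + n).+1%:R; have e'0 : 0 < e' by rewrite divr_gt0.
have [d1 d10 H1] : exists2 d : R, 0 < d & forall (k : 'I_(n + n)) h, `|h| < d ->
    `|dd q (h + u) (ebase R k) - hess q u h (ebase R k)| <= e' * `|h|.
  pose P (k : 'I_(n + n)) (d : R) := forall h, `|h| < d ->
    `|dd q (h + u) (ebase R k) - hess q u h (ebase R k)| <= e' * `|h|.
  have [||d d0 H] := @finite_radius _ _ P.
  - by move=> i r s s0 sr Pr h hs; apply: Pr; exact: lt_le_trans sr.
  - move=> k; have dk := smooth_differentiable (smooth_dd (ebase R k) sq) Uu.
    have [d d0 Hd] := diff_epsD dk e'0; exists d => // h hd.
    by have := Hd h hd; rewrite crit subr0.
  - by exists d.
have /nbhs_normP[d2 d20 H2] : nbhs u U by exact: open_nbhs_nbhs.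
exists (Num.min d1 d2); first by rewrite lt_min d10.
move=> h; rewrite lt_min => /andP[hd1 hd2].
pose H := hess q u h h.
pose F (s : R) := q (u + s *: h) - 2^-1 * H * (s * s).
have inU (s : R) : 0 <= s <= 1 -> U (u + s *: h).
  move=> /andP[s0 s1]; apply: H2 => /=; rewrite opprD addNKr normrN normrZ ger0_norm //.
  by apply: le_lt_trans hd2; rewrite ler_piMl.
have dF (s : R) : 0 <= s <= 1 -> differentiable F s /\
    dd F s 1 = dd q (u + s *: h) h - H * s.
  move=> s01; have dq := smooth_differentiable sq (inU s s01).
  have dl : is_diff s (fun s : R => u + s *: h) (fun s => s *: h).
    have := is_diffD (@is_diff_cst _ _ _ u s) (is_diff_scalel s h).
    by rewrite add0r.
  have dfs : differentiable (fun s : R => q (u + s *: h)) s.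
    by apply: (@differentiable_comp _ _ _ _ (fun s : R => u + s *: h) q).
  have did : differentiable (fun s : R => s) s by exact: ex_diff.
  have dss : differentiable (fun s : R => s * s) s by exact: differentiableM.
  have d3 : differentiable (fun s : R => 2^-1 * H * (s * s)) s.
    by apply: differentiableM => //; exact: differentiable_cst.
  have dl1 : dd (fun s : R => u + s *: h) s 1 = h by rewrite ddE diff_val scale1r.
  have d4 : differentiable (fun s : R => - (2^-1 * H * (s * s))) s by exact: differentiableN.
  split; first exact: differentiableD.
  rewrite (ddD _ dfs d4) ddN // (dd_comp (f := fun s : R => u + s *: h)) //.
  rewrite dl1.
  have dc : differentiable (fun _ : R => 2^-1 * H) s by exact: differentiable_cst.
  rewrite (ddM _ dc dss) dd_cst (ddM _ did did).
  have -> : dd (fun s : R => s) s 1 = 1 by rewrite ddE diff_val.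
  by congr (_ - _); field.
have [|s s01] := @mvt_line _ _ F 0 1.
  by move=> s s01; rewrite add0r [s *: 1]mulr1; exact: (dF s s01).1.
rewrite !add0r [s *: 1]mulr1 (dF s s01).2 /F scale1r scale0r addr0 !mulr1 !mulr0 subr0.
rewrite [h + u]addrC => E1.
have -> : q (u + h) - q u - 2^-1 * H = dd q (u + s *: h) h - H * s.
  by rewrite -E1; ring.
have symm v w := hess_sym oU sq v w Uu.
have -> : H * s = dd (fun y => dd q y (s *: h)) u h.
  by rewrite -[RHS]/(hess q u h (s *: h)) symm hessZl mulrC.
apply: (le_trans (lin_subR (dd q (u + s *: h)) (dd (fun y => dd q y (s *: h)) u) h)).
rewrite expr2 mulrA; apply: ler_wpM2r => //.
case/andP: s01 => s0 s1.
have sh : `|s *: h| <= `|h| by rewrite normrZ ger0_norm // ler_piMl.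
apply: (@le_trans _ _ (\sum_(k < n + n) e' * `|h|)).
  apply: ler_sum => k _.
  have hk : dd (fun y => dd q y (s *: h)) u (ebase R k) = hess q u (s *: h) (ebase R k).
    exact: symm.
  have := H1 k _ (le_lt_trans sh hd1); rewrite -hk [_ + u]addrC => /le_trans; apply.
  by apply: ler_wpM2l => //; exact: ltW.
rewrite sumr_const card_ord -mulr_natl mulrA; apply: ler_wpM2r => //.
by rewrite /e' mulrCA ler_piMr ?(ltW e0) // ler_pdivrMr // mul1r ler_nat.
Qed.

Lemma hess_bound q u : exists2 B : R, 0 <= B & forall v w,
  (forall v w, hess q u v w = hess q u w v) -> `|hess q u v w| <= B * `|v| * `|w|.
Proof.
pose S := \sum_k \sum_l `|hess q u (ebase R l) (ebase R k)|.
have S0 : 0 <= S by apply: sumr_ge0 => k _; apply: sumr_ge0.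
exists ((n + n)%:R * ((n + n)%:R * S)); first by rewrite !mulr_ge0.
move=> v w symm.
have bl k : `|hess q u v (ebase R k)| <= (n + n)%:R * S * `|v|.
  apply: (@lin_boundR _ _ (dd (fun y => dd q y (ebase R k)) u)) => l.
  rewrite /S (bigD1 k) //= (bigD1 l) //= -addrA lerDl addr_ge0 //.
    by apply: sumr_ge0.
  by apply: sumr_ge0 => i _; apply: sumr_ge0.
rewrite symm.
have := @lin_boundR _ _ (dd (fun y => dd q y v) u) ((n + n)%:R * S * `|v|) _ w.
rewrite !mulrA; apply=> k.
by have := bl k; rewrite symm.
Qed.

(** tau is differentiable at x only, so it cannot be differentiated twice. Instead, the second-order
    expansions of q' at x along s v and of q at u along tau (s v + x) - u = s A + o(s) are equated
    and divided by s^2. *)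
Lemma hess_pullback U U' q q' (tau : V -> V) u x :
  open U -> U u -> smooth_on U q -> open U' -> U' x -> smooth_on U' q' ->
  tau x = u -> differentiable tau x -> (\forall y \near x, q (tau y) = q' y) ->
  (forall v, dd q u v = 0) -> (forall v, dd q' x v = 0) ->
  forall v, hess q' x v v = hess q u (dd tau x v) (dd tau x v).
Proof.
move=> oU Uu sq oU' Ux sq' tx dtau qq' cq cq' v.
have [B B0 HB] := hess_bound q u.
have symm v' w := hess_sym oU sq v' w Uu.
have hess_dif y z : hess q u y y - hess q u z z = hess q u (y - z) y + hess q u (y - z) z.
  rewrite -[- z]scaleN1r !hessDl !hessZl (symm y z); ring.
set A := dd tau x v.
pose b := `|v|; pose c := `|A|.
(* In units of e s^2: twice the two Taylor remainders, because of the factor 1/2 before the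
   Hessians, plus the cost of replacing the increment of tau by s A in the quadratic form. *)
pose K := 2 * (b ^+ 2 + (c + b) ^+ 2) + B * b * (c + b + c).
have b0 : 0 <= b by exact: normr_ge0.
have c0 : 0 <= c by exact: normr_ge0.
have K0 : 0 <= K by rewrite /K !(addr_ge0, mulr_ge0, sqr_ge0).
have main e : 0 < e -> e <= 1 -> `|hess q' x v v - hess q u A A| <= K * e.
  move=> e0 e1.
  have [d1 d10 T1] := taylor_critical oU Uu sq cq e0.
  have [d2 d20 T2] := taylor_critical oU' Ux sq' cq' e0.
  have [d3 d30 T3] := diff_epsD dtau e0.
  have /nbhs_normP[d4 d40 T4] := qq'.
  pose d := Num.min (Num.min (d1 / (c + b + 1)) d2) (Num.min d3 d4).
  have cb : 0 < c + b + 1 by lra.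
  have d0 : 0 < d by rewrite !lt_min d20 d30 d40 divr_gt0.
  pose s := d / (b + 1) / 2.
  have s0 : 0 < s by rewrite !divr_gt0 // ltr_wpDl.
  have sb : s * (b + 1) < d.
    by rewrite /s mulrAC divfK ?gt_eqF ?ltr_wpDl // ltr_pdivrMr // ltr_pMr // ltr1n.
  have svE : `|s *: v| = s * b by rewrite normrZ gtr0_norm.
  have svd : `|s *: v| < d by rewrite svE; apply: le_lt_trans sb; nra.
  have [[v1 v2] [v3 v4]] : (s * (b + 1) < d1 / (c + b + 1) /\ `|s *: v| < d2) /\
      (`|s *: v| < d3 /\ `|s *: v| < d4).
    move: svd sb; rewrite /d !lt_min.
    by move=> /andP[/andP[_ ->] /andP[-> ->]] /andP[/andP[-> _] _].
  pose k := tau (s *: v + x) - u.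
  have kE : `|k - s *: A| <= e * (s * b).
    by have := T3 _ v3; rewrite tx ddZl svE.
  have kn : `|k| <= s * (c + b).
    have := ler_normD (k - s *: A) (s *: A); rewrite subrK => /le_trans; apply.
    have : e * (s * b) <= s * b by rewrite ler_piMl // mulr_ge0 // ltW.
    rewrite normrZ gtr0_norm // -/c; lra.
  have kd : `|k| < d1.
    apply: (le_lt_trans kn); apply: (@le_lt_trans _ _ (s * (b + 1) * (c + b + 1))).
      rewrite -mulrA; apply: ler_wpM2l; first exact: ltW.
      have : 0 <= b * (c + b + 1) by rewrite mulr_ge0 // ltW.
      lra.
    by rewrite -ltr_pdivlMr.
  have E1 := T1 _ kd; rewrite /k subrK -/k in E1.
  have E2 := T2 _ v2; rewrite svE in E2.
  have q1 : q (tau (s *: v + x)) = q' (s *: v + x).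
    by apply: T4 => /=; rewrite opprD addrCA subrr addr0 normrN.
  have q2 : q u = q' x by rewrite -tx; exact: (nbhs_singleton qq').
  rewrite q1 q2 in E1.
  have hE : hess q' x (s *: v) (s *: v) = s ^+ 2 * hess q' x v v.
    rewrite hessZl (hess_sym oU' sq' _ _ Ux) hessZl; ring.
  have hA : hess q u (s *: A) (s *: A) = s ^+ 2 * hess q u A A.
    by rewrite hessZl symm hessZl; ring.
  have hk : `|hess q u k k - s ^+ 2 * hess q u A A| <= B * (e * (s * b)) * (s * (c + b) + s * c).
    have -> : hess q u k k - s ^+ 2 * hess q u A A =
        hess q u (k - s *: A) k + hess q u (k - s *: A) (s *: A).
      by rewrite -hA hess_dif.
    apply: (le_trans (ler_normD _ _)).
    have B1 := HB (k - s *: A) k symm; have B2 := HB (k - s *: A) (s *: A) symm.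
    rewrite mulrDr; apply: lerD.
      apply: (le_trans B1); apply: ler_pM => //; first by rewrite mulr_ge0.
      by apply: ler_wpM2l.
    apply: (le_trans B2); apply: ler_pM => //; first by rewrite mulr_ge0.
      by apply: ler_wpM2l.
    by rewrite normrZ gtr0_norm.
  rewrite hE in E2.
  have s20 : 0 < s ^+ 2 by rewrite exprn_gt0.
  rewrite -(ler_pM2l s20) -{1}(gtr0_norm s20) -normrM.
  have kk : e * `|k| ^+ 2 <= e * (s * (c + b)) ^+ 2.
    apply: ler_wpM2l; first exact: ltW.
    by apply: lerXn2r kn; rewrite nnegrE // mulr_ge0 ?addr_ge0 // ltW.
  move: E1 E2 hk kk; rewrite /K.
  move: (hess q' x v v) (hess q u A A) (hess q u k k) (q' (s *: v + x)) (q' x) => h1 h2 h3 y1 y2.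
  rewrite mulrBr !ler_norml => /andP[E1 E1'] /andP[E2 E2'] /andP[E3 E3'] kk.
  apply/andP; split; lra.
apply/eqP; rewrite -subr_eq0 -normr_le0 leNgt; apply/negP => D0.
set D := `|_| in D0; pose e := Num.min 1 (D / (2 * (K + 1))).
have K1 : 0 < 2 * (K + 1) by lra.
have e0 : 0 < e by rewrite lt_min ltr01 divr_gt0.
have e1 : e <= 1 by rewrite ge_min lexx.
have := main e e0 e1; rewrite -/D.
have : e <= D / (2 * (K + 1)) by rewrite ge_min lexx orbT.
by rewrite ler_pdivlMr //; nra.
Qed.

End HessianTransfer.

Section MorseTransfer.
Variables (R : realType) (N n : nat) (X : set (CP R N)) (a : CP R N).
Let Y := X `&` ~` hyperplane a.
Let V : normedModType R := Cspace R n.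
Variables (U U' : set V) (f f' : V -> CP R N) (u x : V).
Hypotheses (cf : chart Y U f) (cf' : chart Y U' f').
Hypotheses (Uu : U u) (Ux : U' x) (fux : f u = f' x).
Variable phi : CP R N -> R.
Hypotheses (sq : smooth_on U (phi \o f)) (sq' : smooth_on U' (phi \o f')).

(** dtau is onto, so criticality passes from f' to f; polarizing [hess_pullback] identifies the two
    Hessians through the bijection dtau. *)
Lemma nondegenerate_transfer : critical (phi \o f') x ->
  critical (phi \o f) u /\
  (Defs.nondegenerate (phi \o f) u -> Defs.nondegenerate (phi \o f') x).
Proof.
set q := phi \o f; set q' := phi \o f' => crit'.
have cq' v : dd q' x v = 0 by rewrite ddE; exact: crit'.
have [tau [T [tx dtau tT Tu nt]]] := transition_diff cf cf' Uu Ux fux.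
have [oU _ _ _ _] := cf; have [oU' _ _ _ _] := cf'.
have nq : \forall y \near x, q (tau y) = q' y.
  by apply: filterS nt => y [_ fy]; rewrite /q /q' /= fy.
have dq : differentiable q (tau x) by rewrite tx; exact: smooth_differentiable sq Uu.
have dqt : differentiable (fun y => q (tau y)) x by exact: (differentiable_comp dtau dq).
have surj w : exists v, dd tau x v = w.
  exists (uncvec (cvec w *m invmx T)); apply: cvec_inj.
  by rewrite tT uncvecK mulmxKV.
have cq w : dd q u w = 0.
  have [v <-] := surj w; have e1 := near_eq_is_diff nq dqt.
  have e2 : dd q' x v = dd (fun y => q (tau y)) x v by rewrite ddE diff_val -ddE.
  by have := cq' v; rewrite e2 (dd_comp _ dtau dq) tx.
split=> [w|nd v Hv]; first by rewrite -ddE cq.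
have hp := hess_pullback oU Uu sq oU' Ux sq' tx dtau nq cq cq'.
have symm v' w := hess_sym oU sq v' w Uu.
have symm' v' w := hess_sym oU' sq' v' w Ux.
have hpv w : hess q' x v w = hess q u (dd tau x v) (dd tau x w).
  have s1 := symm (dd tau x w) (dd tau x v); have s2 := symm' w v.
  have := hp (v + w); rewrite ddDl !hessDl ![hess _ x _ (v + w)]symm'.
  rewrite ![hess _ u _ (_ + _)]symm !hessDl s2 !hp.
  rewrite s1 /q /q'; lra.
have tv0 : dd tau x v = 0.
  apply: nd => w; rewrite hessianE; have [z <-] := surj w.
  by rewrite -hpv -hessianE.
apply: cvec_inj; rewrite cvec0; apply: (can_inj (mulmxK Tu)).
by rewrite -tT tv0 cvec0 mul0mx.
Qed.

End MorseTransfer.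

(** * Sard's theorem *)

Section DiscreteSard.
Variable R : realType.

Lemma modn_close (L a b : nat) : (a %% L = b %% L)%N ->
  `|a%:R - b%:R| < L%:R :> R -> a = b.
Proof.
wlog ab : a b / (a <= b)%N.
  move=> H e1 e2; have [ab|/ltnW ba] := leqP a b; first exact: H.
  by apply/esym/H => //; rewrite distrC.
move=> e1; rewrite distrC -natrB // normr_nat ltr_nat => lt.
have /eqP : (b = a %[mod L])%N by [].
rewrite eqn_mod_dvd // => /dvdnP[q bq].
have q0 : q = 0%N by case: q bq => // q bq; move: lt; rewrite bq mulSn ltnNge leq_addr.
by apply/eqP; rewrite eqn_leq ab /= -subn_eq0 bq q0.
Qed.

Lemma trunc_close (x y : R) : 0 <= x -> 0 <= y ->
  Num.truncn x = Num.truncn y -> `|x - y| <= 1.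
Proof.
move=> /truncn_itv/andP[x1 x2] /truncn_itv/andP[y1 y2] E.
rewrite E -natr1 in x1 x2; rewrite -natr1 in y2.
by rewrite ler_norml; apply/andP; split; lra.
Qed.

(* s t is a critical point with value t, and lam t annihilates the image of the
   differential there.  The values whose critical points share a cell of size b
   lie in a slab of size C b and thickness C b^2, so that b^-m cells are too few
   to cover a grid of b^(-2m) points. *)
Lemma discrete_sard (m : nat) (r C d : R) (s lam : 'rV[R]_m -> 'rV[R]_m) :
  (0 < m)%N -> 0 <= r -> 0 <= C -> 0 < d ->
  let Q (t : 'rV[R]_m) := forall l, 0 <= t 0 l <= d in
  (forall t, Q t -> forall k, `|s t 0 k| <= r) ->
  (forall t, Q t -> exists k, 1 <= `|lam t 0 k|) ->
  (forall t t' b, Q t -> Q t' -> 0 <= b -> (forall k, `|s t' 0 k - s t 0 k| <= b) ->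
     (forall l, `|t' 0 l - t 0 l| <= C * b) /\
     `|\sum_l lam t 0 l * (t' 0 l - t 0 l)| <= C * b ^+ 2) ->
  False.
Proof.
case: m s lam => // m s lam _ r0 C0 d0 Q Hs Hl Hst.
pose A := 2 * r + 1; have A0 : 0 < A by rewrite /A; lra.
(* The grid has spacing d / K and M^2 = K points per axis; cells have size A / M, and A > 2 r keeps
   their indices below M. In grid steps a slab has size below L = M C4 and thickness below C3. P
   collects the factors independent of M, and M exceeds it. *)
pose C4 := (Num.truncn (C * A / d)).+1; pose C3 := (Num.truncn (C * A ^+ 2 / d)).+1.
pose P := (m.+1 * C3 * C4 ^ m)%N; pose M := P.+1; pose K := (M ^ 2)%N.
pose L := (M * C4)%N.
have M0 : 0 < M%:R :> R by rewrite ltr0n.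
have K0 : 0 < K%:R :> R by rewrite ltr0n expn_gt0.
have KE : K%:R = M%:R ^+ 2 :> R by rewrite /K natrX.
pose pt (x : {ffun 'I_m.+1 -> 'I_K}) : 'rV[R]_m.+1 := \row_l (d * (x l)%:R / K%:R).
have Qpt x : Q (pt x).
  move=> l; rewrite mxE divr_ge0 ?mulr_ge0 ?(ltW d0) //= ler_pdivrMr //.
  by apply: ler_wpM2l; [exact: ltW|rewrite ler_nat ltnW].
have [kk Hkk] := choice (fun x => Hl _ (Qpt x)).
pose c0 x k := (s (pt x) 0 k + r) * (M%:R / A).
have c0ge x k : 0 <= c0 x k.
  rewrite mulr_ge0 ?divr_ge0 ?(ltW M0) ?(ltW A0) //.
  by have := Hs _ (Qpt x) k; rewrite ler_norml => /andP[]; lra.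
have c0lt x k : (Num.truncn (c0 x k) < M)%N.
  rewrite truncn_lt_nat // /c0 mulrCA gtr_pMr // ltr_pdivrMr // mul1r.
  by have := Hs _ (Qpt x) k; rewrite ler_norml /A => /andP[]; lra.
have C30 : (0 < C3)%N by []. have L0 : (0 < L)%N by rewrite muln_gt0.
(* The cell, a direction in which lam is large, the position in that direction mod C3, and the other
   positions mod L. Within a cell the residues mod L determine the other positions; the slab bound
   and the residue mod C3 then determine the last one. *)
pose code x := ([ffun k => Ordinal (c0lt x k)], kk x, Ordinal (ltn_pmod (x (kk x)) C30),
  [ffun i : 'I_m => Ordinal (ltn_pmod (x (lift (kk x) i)) L0)]).
have code_inj : injective code.
  move=> x y [e1 e2 e3 e4].
  pose b := A / M%:R; have b0 : 0 <= b by rewrite divr_ge0 ?ltW.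
  have sb k : `|s (pt y) 0 k - s (pt x) 0 k| <= b.
    have : Num.truncn (c0 x k) = Num.truncn (c0 y k).
      by move/ffunP: e1 => /(_ k); rewrite !ffunE => -[].
    move=> /(trunc_close (c0ge _ _) (c0ge _ _)).
    rewrite -mulrBl normrM (ger0_norm (_ : 0 <= M%:R / A)); last by rewrite divr_ge0 ?ltW.
    by rewrite opprD addrACA subrr addr0 mulrA ler_pdivrMr // mul1r -ler_pdivlMr // distrC.
  have [t1 t2] := Hst _ _ _ (Qpt x) (Qpt y) b0 sb.
  have dE l : (pt y) 0 l - (pt x) 0 l = d / K%:R * ((y l)%:R - (x l)%:R).
    by rewrite !mxE; ring.
  have dK0 : 0 < d / K%:R by rewrite divr_gt0.
  have close l : `|(y l)%:R - (x l)%:R| < L%:R :> R.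
    have := t1 l; rewrite dE normrM gtr0_norm // => H.
    have H2 : `|(y l)%:R - (x l)%:R| <= M%:R * (C * A / d) :> R.
      rewrite -(ler_pM2l dK0); apply: (le_trans H).
      by rewrite le_eqVlt; apply/orP; left; apply/eqP; rewrite /b KE; field; rewrite !gt_eqF.
    by apply: (le_lt_trans H2); rewrite /L natrM ltr_pM2l // truncnS_gt.
  have eqo l : l != kk x -> x l = y l.
    case: (unliftP (kk x) l) => [i li _|->]; last by rewrite eqxx.
    apply: ord_inj; apply: (@modn_close L); last by rewrite distrC.
    move/ffunP: e4 => /(_ i); rewrite !ffunE => -[].
    by rewrite -e2 -li.
  apply/ffunP => l; have [->|/eqo//] := eqVneq l (kk x).
  apply: ord_inj; apply: (@modn_close C3); first by rewrite [in RHS]e2.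
  move: t2; rewrite (bigD1 (kk x)) //= big1 ?addr0; last first.
    by move=> i ik; rewrite dE eqo // subrr !mulr0.
  rewrite dE normrM [`|d / _ * _|]normrM (gtr0_norm dK0) => H.
  have H1 : d / K%:R * `|(y (kk x))%:R - (x (kk x))%:R| <= C * b ^+ 2 :> R.
    apply: le_trans H; rewrite ler_peMl // mulr_ge0 //; exact: ltW.
  have H2 : `|(y (kk x))%:R - (x (kk x))%:R| <= C * A ^+ 2 / d :> R.
    rewrite -(ler_pM2l dK0); apply: (le_trans H1).
    by rewrite le_eqVlt; apply/orP; left; apply/eqP; rewrite /b KE; field; rewrite !gt_eqF.
  by rewrite distrC; apply: (le_lt_trans H2); exact: truncnS_gt.
(* There are M^(2m+1) P codes for M^(2m+2) grid points, and P < M. *)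
have := leq_card code code_inj.
rewrite !card_prod !card_ffun !card_ord leqNgt => /negP; apply.
rewrite /L expnMn /K -expnM mul2n -addnn.
have -> : (M ^ m.+1 * m.+1 * C3 * (M ^ m * C4 ^ m) = M ^ m.+1 * M ^ m * P)%N by rewrite -(mulnA (M ^ m.+1)%N) mulnACA /P !mulnA.
by rewrite expnD -mulnA ltn_pmul2l ?expn_gt0 // expnSr ltn_pmul2l ?expn_gt0.
Qed.

End DiscreteSard.

Section ParametricSard.
Variables (R : realType) (n : nat).
Let V : normedModType R := Cspace R n.

Lemma sum_crd_bound (v : V) (x : 'I_(n + n) -> R) (e : R) : (forall k, `|x k| <= e) ->
  `|\sum_k crd k v * x k| <= (n + n)%:R * e * `|v|.
Proof.
move=> H; apply: (le_trans (ler_norm_sum _ _ _)).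
apply: (@le_trans _ _ (\sum_(k < n + n) e * `|v|)).
  apply: ler_sum => k _; rewrite normrM mulrC.
  by apply: ler_pM => //; exact: crd_le.
by rewrite sumr_const card_ord -[leLHS]mulr_natl mulrA.
Qed.

Lemma taylor_family (I : finType) (U : set V) (u0 : V) (r : R) (f : I -> V -> R) :
  open U -> closed_box u0 r `<=` U -> (forall i, smooth_on U (f i)) ->
  exists2 C : R, 0 <= C & forall i x y, closed_box u0 r x -> closed_box u0 r y ->
    `|f i y - f i x| <= C * `|y - x| /\
    `|f i y - f i x - dd (f i) x (y - x)| <= C * `|y - x| ^+ 2.
Proof.
move=> oU KU sf.
have H i : exists C : R, 0 <= C /\ forall x y, closed_box u0 r x -> closed_box u0 r y ->
    `|f i y - f i x| <= C * `|y - x| /\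
    `|f i y - f i x - dd (f i) x (y - x)| <= C * `|y - x| ^+ 2.
  have [C1 C10 H1] := lipschitz_box oU KU (sf i 1).
  have [C2 C20 H2] := taylor_box oU KU (sf i 2).
  exists (C1 + C2); split=> [|x y xr yr]; first exact: addr_ge0.
  split.
    by apply: (le_trans (H1 _ _ xr yr)); apply: ler_wpM2r => //; rewrite lerDl.
  by apply: (le_trans (H2 _ _ xr yr)); apply: ler_wpM2r; rewrite ?sqr_ge0 // lerDr.
have [C HC] := choice H.
have C0 i : 0 <= C i by exact: (HC i).1.
exists (\sum_i C i); first by apply: sumr_ge0.
have Ci i : C i <= \sum_i C i by rewrite (bigD1 i) //= lerDl sumr_ge0.
move=> i x y xr yr; have [H1 H2] := (HC i).2 x y xr yr; split.
  by apply: (le_trans H1); apply: ler_wpM2r.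
by apply: (le_trans H2); apply: ler_wpM2r; rewrite ?sqr_ge0.
Qed.

(* Sard's theorem for the map B^-1 p, with values t. *)
Lemma parametric_sard (U : set V) (u0 : V) (r kappa delta : R)
    (p : 'I_(n + n) -> V -> R) (B : 'I_(n + n) -> 'I_(n + n) -> V -> R) :
  (0 < n)%N -> open U -> closed_box u0 r `<=` U -> 0 <= r ->
  (forall k, smooth_on U (p k)) -> (forall k l, smooth_on U (B k l)) ->
  0 < kappa ->
  (forall u, closed_box u0 r u -> forall w,
     kappa * `|w| ^+ 2 <= \sum_k crd k w * \sum_l crd l w * B k l u) ->
  0 < delta ->
  exists2 t : 'rV[R]_(n + n), (forall l, 0 <= t 0 l <= delta) &
    forall u, closed_box u0 r u -> (forall k, p k u = \sum_l t 0 l * B k l u) ->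
    forall v, (forall w, \sum_k crd k v *
                 (dd (p k) u w - \sum_l t 0 l * dd (B k l) u w) = 0) -> v = 0.
Proof.
move=> n0 oU KU r0 sp sB k0 coer d0.
pose dm : R := (n + n)%:R.
have dm0 : 0 < dm by rewrite ltr0n addn_gt0 n0.
have [Cp Cp0 HCp] := taylor_family oU KU sp.
have [CB CB0 HCB] := @taylor_family ('I_(n + n) * 'I_(n + n))%type U u0 r
  (fun kl => B kl.1 kl.2) oU KU (fun kl => sB kl.1 kl.2).
(* d <= 1 bounds the coefficients of t, which makes the Taylor constants of F below uniform in t. *)
pose d := Num.min delta 1.
have dd0 : 0 < d by rewrite lt_min d0 ltr01.
(* With |v| = dm / kappa, coercivity gives B^T v an entry of absolute value at least 1, as
   [discrete_sard] demands of lam. *)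
pose good (t : 'rV[R]_(n + n)) u v := [/\ closed_box u0 r u,
  forall k, p k u = \sum_l t 0 l * B k l u, `|v| = dm / kappa &
  forall w, \sum_k crd k v * (dd (p k) u w - \sum_l t 0 l * dd (B k l) u w) = 0].
pose Q (t : 'rV[R]_(n + n)) := forall l, 0 <= t 0 l <= d.
apply: contrapT => bad.
have ex t : exists uv : V * V, Q t -> good t uv.1 uv.2.
  have [Qt|nQ] := pselect (Q t); last by exists (0, 0).
  have [[[u v] H]|nH] := pselect (exists uv : V * V, good t uv.1 uv.2); first by exists (u, v).
  exfalso; apply: bad; exists t => [l|u Ku Hu v Hv].
    by have /andP[-> /le_trans->//] := Qt l; rewrite ge_min lexx.
  apply: contrapT => /eqP v0; apply: nH; exists (u, (dm / kappa / `|v|) *: v); split=> //=.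
    by rewrite normrZ normrM normfV normr_id divfK ?normr_eq0 // gtr0_norm // divr_gt0.
  move=> w; have /(congr1 ( *%R (dm / kappa / `|v|))) := Hv w.
  rewrite mulr0 mulr_sumr; apply: etrans.
  by apply: eq_bigr => k _; rewrite linearZ /= mulrA.
have {ex} [uv Huv] := choice ex.
(* F t vanishes at the point chosen for t, and the vector chosen for t annihilates its differential
   there. *)
pose F (t : 'rV[R]_(n + n)) k y := p k y - \sum_l t 0 l * B k l y.
pose CF := Cp + dm * CB.
have CF0 : 0 <= CF by rewrite addr_ge0 // mulr_ge0 // ltW.
have t1 t : Q t -> forall l, `|t 0 l| <= 1.
  by move=> Qt l; have /andP[t0 td] := Qt l; rewrite ger0_norm // (le_trans td) // ge_min lexx orbT.
have sumt t (X : 'I_(n + n) -> R) e : Q t -> 0 <= e -> (forall l, `|X l| <= e) ->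
    `|\sum_l t 0 l * X l| <= dm * e.
  move=> Qt e0 HX; apply: (le_trans (ler_norm_sum _ _ _)).
  apply: (@le_trans _ _ (\sum_(l < n + n) e)); last by rewrite sumr_const card_ord -mulr_natl.
  apply: ler_sum => l _; rewrite normrM -[e]mul1r; apply: ler_pM => //; exact: t1.
have F1 t k x y : Q t -> closed_box u0 r x -> closed_box u0 r y ->
    `|F t k y - F t k x| <= CF * `|y - x|.
  move=> Qt Kx Ky.
  have -> : F t k y - F t k x = (p k y - p k x) - \sum_l t 0 l * (B k l y - B k l x).
    rewrite /F; under [in RHS]eq_bigr => l _ do rewrite mulrBr.
    rewrite sumrB; ring.
  apply: (le_trans (ler_normB _ _)); rewrite /CF mulrDl; apply: lerD.
    by have [] := HCp k x y Kx Ky.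
  rewrite -mulrA; apply: sumt => // [|l]; first by rewrite mulr_ge0.
  by have [] := HCB (k, l) x y Kx Ky.
have F2 t k x y : Q t -> closed_box u0 r x -> closed_box u0 r y ->
    `|F t k y - F t k x - (dd (p k) x (y - x) - \sum_l t 0 l * dd (B k l) x (y - x))|
      <= CF * `|y - x| ^+ 2.
  move=> Qt Kx Ky.
  set z := y - x.
  have -> : F t k y - F t k x - (dd (p k) x z - \sum_l t 0 l * dd (B k l) x z) =
     (p k y - p k x - dd (p k) x z) - \sum_l t 0 l * (B k l y - B k l x - dd (B k l) x z).
    rewrite /F; under [in RHS]eq_bigr => l _ do rewrite !mulrBr.
    rewrite !sumrB; ring.
  apply: (le_trans (ler_normB _ _)); rewrite /CF mulrDl; apply: lerD.
    by have [] := HCp k x y Kx Ky.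
  rewrite -mulrA; apply: sumt => // [|l]; first by rewrite mulr_ge0 // sqr_ge0.
  by have [] := HCB (k, l) x y Kx Ky.
(* C1 bounds t' - t by C1 b, because B(u') (t' - t) = F t u' is O(b) and B(u') is coercive; C2 is
   the constant of the quadratic bound on lam (t' - t). *)
pose C1 := dm * CF / kappa.
have C10 : 0 <= C1 by rewrite !mulr_ge0 // ?invr_ge0 ltW.
pose C2 := dm * CF * (dm / kappa) + dm * (dm * CB * C1) * (dm / kappa).
have C20 : 0 <= C2.
  by rewrite addr_ge0 // !mulr_ge0 // ?invr_ge0 ltW.
apply: (@discrete_sard R (n + n) r (C1 + C2) d
  (fun t => \row_k crd k ((uv t).1 - u0))
  (fun t => \row_l \sum_k crd k (uv t).2 * B k l (uv t).1)) => //.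
- by rewrite addn_gt0 n0.
- exact: addr_ge0.
- move=> t Qt k; have [Ku _ _ _] := Huv t Qt; rewrite mxE.
  exact: le_trans (crd_le _ _) Ku.
- move=> t Qt; have [Ku _ nv _] := Huv t Qt.
  move: (uv t).1 (uv t).2 Ku nv => u v Ku nv.
  apply: contrapT => /forallNP small.
  have small' l : `|\sum_k crd k v * B k l u| < 1.
    by have /negP := small l; rewrite mxE -ltNge.
  have := coer u Ku v.
  have -> : \sum_k crd k v * \sum_l crd l v * B k l u = \sum_l crd l v * \sum_k crd k v * B k l u.
    under eq_bigr => k _ do rewrite mulr_sumr.
    rewrite exchange_big /=; apply: eq_bigr => l _; rewrite mulr_sumr.
    by apply: eq_bigr => k _; rewrite mulrCA.
  apply/negP; rewrite -ltNge.
  apply: (@le_lt_trans _ _ (\sum_l `|v| * `|\sum_k crd k v * B k l u|)).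
    apply: ler_sum => l _; apply: (le_trans (ler_norm _)); rewrite normrM.
    by apply: ler_wpM2r => //; exact: crd_le.
  have v0 : 0 < `|v| by rewrite nv divr_gt0.
  apply: (@lt_le_trans _ _ (\sum_(l < n + n) `|v|)); last first.
    by rewrite sumr_const card_ord -mulr_natl -/dm expr2 mulrA {2}nv mulrCA divff ?gt_eqF // mulr1 mulrC.
  apply: ltr_sum => [|l _]; last by rewrite gtr_pMr.
  have nn0 : (0 < n + n)%N by rewrite addn_gt0 n0.
  by apply/hasP; exists (Ordinal nn0); rewrite ?mem_index_enum.
move=> t t' b Qt Qt' b0 Hb.
have [Ku eqt nv deg] := Huv t Qt; have [Ku' eqt' _ _] := Huv t' Qt'.
move: (uv t) (uv t') Ku eqt nv deg Ku' eqt' Hb => [u v] [u' v'] /= Ku eqt nv deg Ku' eqt' Hb.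
have ub : `|u' - u| <= b.
  apply: norm_crd => // k; have := Hb k.
  by rewrite !mxE -linearB /= opprB addrA subrK.
pose w : V := of_crd (t' - t).
have wE l : crd l w = t' 0 l - t 0 l by rewrite crd_of !mxE.
have FE k : F t k u' = \sum_l crd l w * B k l u'.
  rewrite /F eqt' -sumrB; apply: eq_bigr => l _; by rewrite wE mulrBl.
have Fu k : F t k u = 0 by rewrite /F eqt subrr.
have wb : `|w| <= C1 * b.
  have H1 : `|\sum_k crd k w * F t k u'| <= dm * (CF * b) * `|w|.
    apply: sum_crd_bound => k; rewrite -[F t k u']subr0 -(Fu k).
    by apply: (le_trans (F1 _ _ _ _ Qt Ku Ku')); apply: ler_wpM2l.
  have H2 : kappa * `|w| ^+ 2 <= dm * (CF * b) * `|w|.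
    apply: (le_trans (coer _ Ku' w)); apply: (le_trans (ler_norm _)).
    by apply: le_trans H1; rewrite le_eqVlt; apply/orP; left; apply/eqP; congr `|_|;
      apply: eq_bigr => k _; rewrite FE.
  have [->|w0] := eqVneq `|w| 0; first by rewrite mulr_ge0.
  have w0' : 0 < `|w| by rewrite lt_def w0 normr_ge0.
  move: H2; rewrite expr2 (mulrA kappa) ler_pM2r // => H2.
  by rewrite /C1 mulrAC ler_pdivlMr // mulrC; apply: (le_trans H2); rewrite mulrA.
split=> [l|].
  rewrite -wE; apply: (le_trans (crd_le _ _)); apply: (le_trans wb).
  by apply: ler_wpM2r => //; rewrite lerDl.
(* lam (t' - t) = v F_t(u') + v (B(u) - B(u')) (t' - t): the first term is quadratic in b by the
   choice of v, the second is a product of two factors linear in b. *)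
have -> : \sum_l (\row_l0 \sum_k crd k v * B k l0 u) 0 l * (t' 0 l - t 0 l) =
   \sum_k crd k v * F t k u' + \sum_k crd k v * \sum_l crd l w * (B k l u - B k l u').
  rewrite -big_split /=.
  under eq_bigr => l _ do rewrite mxE -wE mulr_suml.
  rewrite exchange_big /=; apply: eq_bigr => k _.
  rewrite FE -mulrDr -big_split /= mulr_sumr; apply: eq_bigr => l _.
  by rewrite -mulrDr subrKC mulrAC mulrA.
have S1 : `|\sum_k crd k v * F t k u'| <= dm * (CF * b ^+ 2) * (dm / kappa).
  have -> : \sum_k crd k v * F t k u' = \sum_k crd k v * (F t k u' - F t k u -
      (dd (p k) u (u' - u) - \sum_l t 0 l * dd (B k l) u (u' - u))).
    rewrite -[LHS]subr0 -[X in _ - X](deg (u' - u)) -sumrB.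
    by apply: eq_bigr => k _; rewrite Fu subr0 -mulrBr.
  rewrite -nv; apply: sum_crd_bound => k.
  apply: (le_trans (F2 _ _ _ _ Qt Ku Ku')); apply: ler_wpM2l => //.
  by apply: lerXn2r ub; rewrite nnegrE.
have S2 : `|\sum_k crd k v * \sum_l crd l w * (B k l u - B k l u')| <=
    dm * (dm * (CB * b) * (C1 * b)) * (dm / kappa).
  rewrite -nv; apply: sum_crd_bound => k.
  apply: (@le_trans _ _ (dm * (CB * b) * `|w|)).
    apply: sum_crd_bound => l; rewrite distrC.
    have [H _] := HCB (k, l) u u' Ku Ku'.
    by apply: (le_trans H); apply: ler_wpM2l.
  by apply: ler_wpM2l => //; rewrite !mulr_ge0 // ltW.
apply: (le_trans (ler_normD _ _)); apply: (le_trans (lerD S1 S2)).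
apply: (@le_trans _ _ (C2 * b ^+ 2)).
  by rewrite le_eqVlt; apply/orP; left; apply/eqP; rewrite /C2; ring.
by apply: ler_wpM2r; rewrite ?sqr_ge0 // lerDr.
Qed.

End ParametricSard.

(** * Generic centers *)

Section GenericCenter.
Variable R : realType.

Lemma cvg_sum_fin (T I : Type) (F : set_system T) (s : seq I) (f : I -> T -> R) (l : I -> R) :
  Filter F -> (forall i, f i z @[z --> F] --> l i) ->
  (\sum_(i <- s) f i z) @[z --> F] --> \sum_(i <- s) l i.
Proof.
move=> FF H; elim: s => [|i s IH].
  rewrite (_ : (fun z => _) = fun _ => 0); last by apply/funext => z; rewrite big_nil.
  by rewrite big_nil; exact: cvg_cst.
rewrite (_ : (fun z => _) = fun z => f i z + \sum_(j <- s) f j z); last first.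
  by apply/funext => z; rewrite big_cons.
by rewrite big_cons; apply: cvgD.
Qed.

Lemma sphere_compact n : compact [set w : Cspace R n | `|w| = 1].
Proof.
apply: (subclosed_compact _ (@closed_box_compact R n 0 1)).
  have c1 : closed [set x : R | x = 1] by exact: closed_eq.
  by apply: (closed_comp _ c1) => x _; exact: norm_continuous.
by move=> w /= w1; rewrite /closed_box /= subr0 w1.
Qed.

Variables (n m : nat).
Let V : normedModType R := Cspace R n.
Let E : normedModType R := Cspace R m.
Variables (U : set V) (G : V -> E).
Hypotheses (oU : open U) (hG : holomorphic_on U G).
Hypothesis immG : forall x v, U x -> dd G x v = 0 -> v = 0.
Let g k u := crd k (G u).
Let q (c : 'rV[R]_(m + m)) u := sqdist c (G u).

Let sg j : smooth_on U (g j). Proof. exact: crd_smooth. Qed.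

(** By homogeneity the minimum on the compact unit sphere serves as kappa; it is positive because G
    is an immersion. *)
Lemma metric_coercive_at u0 : U u0 -> exists2 kappa : R, 0 < kappa &
  forall w, kappa * `|w| ^+ 2 <= \sum_j dd (g j) u0 w * dd (g j) u0 w.
Proof.
move=> Uu; pose S := [set w : V | `|w| = 1].
pose f w := \sum_j dd (g j) u0 w * dd (g j) u0 w.
have fZ a w : f (a *: w) = a ^+ 2 * f w.
  rewrite /f mulr_sumr; apply: eq_bigr => j _.
  have -> : dd (g j) u0 (a *: w) = a * dd (g j) u0 w by exact: ddZl.
  by ring.
have cf : continuous f.
  move=> w; apply: cvg_sum_fin => j.
  by apply: cvgM; exact: lin_cont.
have [[w0 Sw0]|S0] := pselect (S !=set0); last first.
  exists 1 => // w; have [->|w0] := eqVneq w 0.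
    rewrite normr0 expr0n /= mulr0; apply: sumr_ge0 => j _; exact: sqr_ge0.
  exfalso; apply: S0; exists (`|w|^-1 *: w).
  by rewrite /S /= normrZ normfV normr_id mulVf // normr_eq0.
have cfS : {within S, continuous f} by apply: continuous_subspaceT.
have [c /[!inE] Sc H] := compact_EVT_min (ex_intro _ w0 Sw0) (@sphere_compact n) cfS.
have c0 : c != 0 by apply/eqP => c0; move: Sc; rewrite /S /= c0 normr0 => /eqP; rewrite eq_sym oner_eq0.
exists (f c); first exact: (metric_gt0 hG immG).
move=> w; have [->|w1] := eqVneq w 0.
  rewrite normr0 expr0n /= mulr0; apply: sumr_ge0 => j _; exact: sqr_ge0.
have nw : `|w| != 0 by rewrite normr_eq0.
rewrite -[leRHS]/(f w) -[w in leRHS](scalerKV nw) fZ mulrC.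
apply: ler_wpM2l; first exact: sqr_ge0.
by apply: H; rewrite inE /S /= normrZ normfV normr_id mulVf.
Qed.

(** The form is mixed because centers are moved along the tangent vectors at the fixed point u0
    while the critical point u varies. Near u0 it is a small perturbation of the metric at u0, and
    half of the constant survives. *)
Lemma metric_coercive u0 : U u0 -> exists2 r : R, 0 < r & closed_box u0 r `<=` U /\
  exists2 kappa : R, 0 < kappa & forall u, closed_box u0 r u ->
    forall w, kappa * `|w| ^+ 2 <= \sum_j dd (g j) u w * dd (g j) u0 w.
Proof.
move=> Uu; have [k k0 Hk] := metric_coercive_at Uu.
have [r1 r10 H1] := open_closed_box oU Uu.
pose dn : R := (n + n)%:R; pose dm : R := (m + m)%:R.
pose S := \sum_j \sum_l `|dd (g j) u0 (ebase R l)|.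
have S0 : 0 <= S by apply: sumr_ge0 => j _; apply: sumr_ge0.
have dn0 : 0 <= dn by []. have dm0 : 0 <= dm by [].
pose e := k / 2 / (dm * (dn * (dn * S)) + 1).
have D0 : 0 < dm * (dn * (dn * S)) + 1 by rewrite ltr_wpDl // !mulr_ge0.
have e0 : 0 < e by rewrite !divr_gt0.
pose P (jl : 'I_(m + m) * 'I_(n + n)) (r : R) := forall u, closed_box u0 r u ->
  `|dd (g jl.1) u (ebase R jl.2) - dd (g jl.1) u0 (ebase R jl.2)| <= e.
have [||r2 r20 H2] := @finite_radius _ _ P.
- by move=> i r s s0 sr Pr u us; apply: Pr; exact: le_trans us sr.
- move=> [j l]; have sd := smooth_dd (ebase R l) (sg j).
  have cd : dd (g j) u (ebase R l) @[u --> u0] --> dd (g j) u0 (ebase R l) by exact: (sd 0 u0 Uu).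
  have /nbhs_normP[r r0 Hr] : \forall u \near u0,
      `|dd (g j) u0 (ebase R l) - dd (g j) u (ebase R l)| <= e by move/cvgrPdist_le: cd; apply.
  exists (r / 2); first by rewrite divr_gt0.
  move=> u ur; rewrite distrC; apply: Hr => /=; rewrite distrC; apply: (le_lt_trans ur).
  by rewrite ltr_pdivrMr // ltr_pMr // ltr1n.
exists (Num.min r1 r2); first by rewrite lt_min r10.
split; first by move=> u; rewrite /closed_box /= le_min => /andP[ur _]; exact: H1.
exists (k / 2); first by rewrite divr_gt0.
move=> u; rewrite /closed_box /= le_min => /andP[_ ur] w.
have diff : `|\sum_j dd (g j) u w * dd (g j) u0 w - \sum_j dd (g j) u0 w * dd (g j) u0 w|
    <= k / 2 * `|w| ^+ 2.
  rewrite -sumrB; apply: (le_trans (ler_norm_sum _ _ _)).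
  apply: (@le_trans _ _ (\sum_(j < m + m) (dn * e * `|w|) * (dn * S * `|w|))).
    apply: ler_sum => j _; rewrite -mulrBl normrM; apply: ler_pM => //.
      apply: (le_trans (lin_subR _ _ _)); apply: ler_wpM2r => //.
      apply: (@le_trans _ _ (\sum_(l < n + n) e)).
        by apply: ler_sum => l _; exact: (H2 (j, l)).
      by rewrite sumr_const card_ord -[leLHS]mulr_natl.
    apply: lin_boundR => l; rewrite /S (bigD1 j) //= (bigD1 l) //= -addrA lerDl addr_ge0 //.
      by apply: sumr_ge0.
    by apply: sumr_ge0 => i _; apply: sumr_ge0.
  rewrite sumr_const card_ord -[leLHS]mulr_natl -/dm.
  have -> : dm * (dn * e * `|w| * (dn * S * `|w|)) = e * (dm * (dn * (dn * S))) * `|w| ^+ 2 by ring.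
  apply: ler_wpM2r; first exact: sqr_ge0.
  rewrite /e mulrAC ler_pdivrMr // ler_pM2l ?divr_gt0 //; lra.
have := Hk w; move: diff; rewrite ler_norml => /andP[]; lra.
Qed.

Definition good_center (K : set V) (c : 'rV[R]_(m + m)) : Prop :=
  forall u, K u -> (forall v, dd (q c) u v = 0) ->
  forall v, (forall w, hess (q c) u v w = 0) -> v = 0.

(** The center is moved along the tangent space at u0 only: for c = c0 + sum_l t_l dG(u0) e_l, a
    point u of the box is critical iff p(u) = B(u) t, and [parametric_sard] provides arbitrarily
    small good t. *)
Lemma good_center_dense u0 : U u0 -> exists2 r : R, 0 < r & closed_box u0 r `<=` U /\
  dense (good_center (closed_box u0 r)).
Proof.
move=> Uu; have [r r0 [rU [kappa k0 coer]]] := metric_coercive Uu.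
exists r => //; split=> // O [c0 Oc0] oO.
have [n0|n0] := posnP n.
  exists c0; split=> // u _ _ v _; apply: crd_ext => k; exfalso.
  by case: k => k; rewrite n0.
have /nbhs_normP[e e0 HO] : nbhs c0 O by exact: open_nbhs_nbhs.
pose p k y := \sum_j (g j y - c0 0 j) * dd (g j) y (ebase R k).
pose B k l y := \sum_j dd (g j) y (ebase R k) * dd (g j) u0 (ebase R l).
have sp k : smooth_on U (p k).
  move=> N; apply: Ck_sum => // j _; apply: Ck_mul => //.
    by apply: Ck_add => //; [exact: sg|exact: Ck_cst].
  exact: (smooth_dd (ebase R k) (@sg j)).
have sB k l : smooth_on U (B k l).
  move=> N; apply: Ck_sum => // j _; apply: Ck_mul => //; last exact: Ck_cst.
  exact: (smooth_dd (ebase R k) (@sg j)).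
have coerB u : closed_box u0 r u -> forall w : V,
    kappa * `|w| ^+ 2 <= \sum_k crd k w * \sum_l crd l w * B k l u.
  move=> ur w; apply: (le_trans (coer u ur w)); rewrite le_eqVlt; apply/orP; left; apply/eqP.
  transitivity (\sum_j \sum_k \sum_l crd k w * (crd l w *
      (dd (g j) u (ebase R k) * dd (g j) u0 (ebase R l)))).
    apply: eq_bigr => j _.
    rewrite (lin_crdR (dd (g j) u)) (lin_crdR (dd (g j) u0)) mulr_suml.
    apply: eq_bigr => k _; rewrite mulr_sumr; apply: eq_bigr => l _; ring.
  rewrite exchange_big /=; apply: eq_bigr => k _; rewrite exchange_big /= mulr_sumr.
  by apply: eq_bigr => l _; rewrite /B -!mulr_sumr.
pose S := \sum_j \sum_l `|dd (g j) u0 (ebase R l)|.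
have S0 : 0 <= S by apply: sumr_ge0 => j _; apply: sumr_ge0.
pose delta := e / 2 / (S + 1).
have S1 : 0 < S + 1 by rewrite ltr_wpDl.
have d0 : 0 < delta by rewrite !divr_gt0.
have [t Ht good] := parametric_sard n0 oU rU (ltW r0) sp sB k0 coerB d0.
pose c := c0 + \row_j \sum_l t 0 l * dd (g j) u0 (ebase R l).
have cE j : c 0 j = c0 0 j + \sum_l t 0 l * dd (g j) u0 (ebase R l) by rewrite !mxE.
have Oc : O c.
  apply: HO => /=; rewrite opprD addrA subrr sub0r normrN.
  apply: (@le_lt_trans _ _ (e / 2)); last by rewrite ltr_pdivrMr // ltr_pMr // ltr1n.
  apply: mx_norm_le => [|j]; first by rewrite divr_ge0 // ltW.
  rewrite mxE; apply: (le_trans (ler_norm_sum _ _ _)).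
  apply: (@le_trans _ _ (delta * \sum_l `|dd (g j) u0 (ebase R l)|)).
    rewrite mulr_sumr; apply: ler_sum => l _; rewrite normrM; apply: ler_wpM2r => //.
    by have /andP[t0 t1] := Ht l; rewrite ger0_norm.
  apply: (@le_trans _ _ (delta * S)).
    apply: ler_wpM2l; first exact: ltW.
    rewrite /S (bigD1 j) //= lerDl; apply: sumr_ge0 => i _; exact: sumr_ge0.
  by rewrite /delta mulrAC ler_pdivrMr // ler_pM2l ?divr_gt0 // lerDl.
exists c; split=> // u ur crit v deg.
have Uu' := rU _ ur.
have ddq y k : U y -> dd (q c) y (ebase R k) = 2 * (p k y - \sum_l t 0 l * B k l y).
  move=> Uy; rewrite (dd_sqdist c oU hG) //; congr (2 * _).
  have -> : \sum_l t 0 l * B k l y =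
      \sum_j (\sum_l t 0 l * dd (g j) u0 (ebase R l)) * dd (g j) y (ebase R k).
    under [RHS]eq_bigr => j _ do rewrite mulr_suml.
    rewrite exchange_big /=; apply: eq_bigr => l _; rewrite mulr_sumr.
    by apply: eq_bigr => j _; rewrite mulrAC mulrA.
  rewrite -sumrB; apply: eq_bigr => j _; rewrite cE -mulrBl; congr (_ * _); rewrite /g; ring.
apply: (good u ur) => [k|w].
  have := ddq u k Uu'; rewrite crit => /esym/eqP.
  by rewrite mulf_eq0 pnatr_eq0 /= subr_eq0 => /eqP.
have sq := sqdist_smooth c oU hG.
have dp k : differentiable (p k) u by exact: smooth_differentiable (sp k) Uu'.
have dB k l : differentiable (B k l) u by exact: smooth_differentiable (sB k l) Uu'.
have hE k : hess (q c) u w (ebase R k) = 2 * (dd (p k) u w - \sum_l t 0 l * dd (B k l) u w).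
  have dtB l : differentiable (fun y => t 0 l * B k l y) u.
    by apply: differentiableM => //; exact: differentiable_cst.
  have dS : differentiable (fun y => \sum_l t 0 l * B k l y) u by exact: differentiable_bigsum.
  have dNS : differentiable (fun y => - \sum_l t 0 l * B k l y) u by exact: differentiableN.
  have dF : differentiable (fun y => p k y - \sum_l t 0 l * B k l y) u by exact: differentiableD.
  have d2F : differentiable (fun y => 2 * (p k y - \sum_l t 0 l * B k l y)) u.
    by apply: differentiableM => //; exact: differentiable_cst.
  have eq y : U y -> 2 * (p k y - \sum_l t 0 l * B k l y) = dd (q c) y (ebase R k).
    by move=> Uy; rewrite ddq.
  rewrite /hess (dd_eq_on w oU Uu' eq d2F).2.
  have dc2 : differentiable (fun _ : V => 2 : R) u by exact: differentiable_cst.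
  rewrite (ddM _ dc2 dF) dd_cst mulr0 addr0; congr (2 * _).
  rewrite (ddD _ (dp k) dNS) (ddN _ dS).
  have -> : dd (fun y => \sum_l t 0 l * B k l y) u w = \sum_l dd (fun y => t 0 l * B k l y) u w.
    by apply: dd_sum => l _; exact: dtB.
  congr (_ - _); apply: eq_bigr => l _.
  have dct : differentiable (fun _ : V => t 0 l) u by exact: differentiable_cst.
  by rewrite (ddM _ dct (dB k l)) dd_cst mulr0 addr0.
have : 2 * \sum_k crd k v * (dd (p k) u w - \sum_l t 0 l * dd (B k l) u w) = 0.
  rewrite mulr_sumr -[RHS](deg w) /hess (lin_crdR (dd (fun y => dd (q c) y w) u)).
  apply: eq_bigr => k _; rewrite mulrCA -hE; congr (_ * _).
  exact: (hess_sym oU sq _ _ Uu').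
by move/eqP; rewrite mulf_eq0 pnatr_eq0 /= => /eqP.
Qed.

(** A center is good iff, for every u in the box and unit vector v, some first derivative at u or
    some Hess(v, e_k) is nonzero. This condition is open in (c, u, v) jointly, and compactness of
    box times sphere makes it open in c. *)
Lemma good_center_open u0 (r : R) : closed_box u0 r `<=` U ->
  open (good_center (closed_box u0 r)).
Proof.
move=> rU; rewrite openE => c good; rewrite /interior.
pose S := [set w : V | `|w| = 1].
pose A k (c : 'rV[R]_(m + m)) u := \sum_j (g j u - c 0 j) * dd (g j) u (ebase R k).
pose H k (c : 'rV[R]_(m + m)) u v := \sum_j ((\sum_l crd l v * dd (g j) u (ebase R l)) * dd (g j) u (ebase R k)
  + (g j u - c 0 j) * \sum_l crd l v * dd (fun y => dd (g j) y (ebase R k)) u (ebase R l)).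
have AE k b u : U u -> dd (q b) u (ebase R k) = 2 * A k b u.
  by move=> Uu; rewrite (dd_sqdist b oU hG).
have HE k b u v : U u -> hess (q b) u v (ebase R k) = 2 * H k b u v.
  move=> Uu; rewrite (hess_sqdist b oU hG) //; congr (2 * _); apply: eq_bigr => j _.
  by rewrite (lin_crdR (dd (g j) u)) (lin_crdR (dd (fun y => dd (g j) y (ebase R k)) u)).
pose P (b : 'rV[R]_(m + m)) (z : V * V) := (exists k, A k b z.1 != 0) \/ (exists k, H k b z.1 z.2 != 0).
have K_P b : closed_box u0 r `*` S `<=` P b -> good_center (closed_box u0 r) b.
  move=> HP u ur crit v deg; apply: contrapT => /eqP v0.
  have Uu := rU _ ur.
  have [] := HP (u, `|v|^-1 *: v).
  - by split=> //=; rewrite /S /= normrZ normfV normr_id mulVf // normr_eq0.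
  - move=> [k] /eqP; apply; have := AE k b u Uu.
    by rewrite crit => /esym/eqP; rewrite mulf_eq0 pnatr_eq0 /= => /eqP.
  - move=> [k] /eqP; apply; have := HE k b u (`|v|^-1 *: v) Uu.
    by rewrite hessZl deg mulr0 => /esym/eqP; rewrite mulf_eq0 pnatr_eq0 /= => /eqP.
have P_K z : (closed_box u0 r `*` S) z -> P c z.
  case: z => u v [/= ur v1]; have Uu := rU _ ur.
  apply: contrapT => /not_orP[/forallNP nA /forallNP nH].
  have A0 k : A k c u = 0 by apply/eqP/negPn/negP; exact: nA.
  have H0 k : H k c u v = 0 by apply/eqP/negPn/negP; exact: nH.
  have v0 : v = 0.
    apply: (good u ur) => w.
      have -> : dd (q c) u w = \sum_k crd k w * dd (q c) u (ebase R k) by exact: lin_crdR.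
      by rewrite big1 // => k _; rewrite (AE k c u Uu) A0 !mulr0.
    have sq := sqdist_smooth c oU hG.
    rewrite (hess_sym oU sq _ _ Uu).
    have -> : hess (q c) u w v = \sum_k crd k w * hess (q c) u (ebase R k) v by exact: lin_crdR.
    by rewrite big1 // => k _; rewrite (hess_sym oU sq _ _ Uu) (HE k c u v Uu) H0 !mulr0.
  by move: v1; rewrite /S /= v0 normr0 => /eqP; rewrite eq_sym oner_eq0.
have cK : compact (closed_box u0 r `*` S).
  by apply: compact_setX; [exact: closed_box_compact|exact: sphere_compact].
have /compact_near_coveringP/(_ _ (nbhs c) P _) cov := cK.
suff : \forall b \near c, closed_box u0 r `*` S `<=` P b.
  by apply: filterS => b; exact: K_P.
apply: cov => -[u v] uvK; have Uu := rU _ uvK.1.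
have := P_K _ uvK.
have cu (h : V -> R) : {for u, continuous h} ->
    h z.1.1 @[z --> ((u, v), c)] --> h u.
  move=> ch; apply: (@cvg_comp _ _ _ (fun z : (V * V) * 'rV[R]_(m + m) => z.1.1) h _ (nbhs u)) => //.
  apply: (@cvg_comp _ _ _ fst fst _ (nbhs (u, v))); first exact: cvg_fst.
  exact: cvg_fst.
have cg j : {for u, continuous (g j)} by exact: (@sg j 0 u Uu).
have cdg j k : {for u, continuous (fun y => dd (g j) y (ebase R k))}.
  exact: (smooth_dd (ebase R k) (@sg j) 0 u Uu).
have cddg j k l : {for u, continuous (fun y => dd (fun y => dd (g j) y (ebase R k)) y (ebase R l))}.
  exact: (smooth_dd (ebase R l) (smooth_dd (ebase R k) (@sg j)) 0 u Uu).
have cc j : (z.2 : 'rV[R]_(m + m)) 0 j @[z --> ((u, v), c)] --> c 0 j.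
  apply: (@cvg_comp _ _ _ (fun z : (V * V) * 'rV[R]_(m + m) => z.2) (fun b => b 0 j) _ (nbhs c)).
    exact: cvg_snd.
  exact: coord_continuous.
have cv l : crd l z.1.2 @[z --> ((u, v), c)] --> crd l v.
  apply: (@cvg_comp _ _ _ (fun z : (V * V) * 'rV[R]_(m + m) => z.1.2) (crd l) _ (nbhs v)).
    apply: (@cvg_comp _ _ _ fst snd _ (nbhs (u, v))); first exact: cvg_fst.
    exact: cvg_snd.
  exact: lin_cont.
case=> -[k /= nz].
  have cA : A k z.2 z.1.1 @[z --> ((u, v), c)] --> A k c u.
    apply: cvg_sum_fin => j; apply: cvgM; last exact: (cu _ (cdg j k)).
    by apply: cvgB; [exact: (cu _ (cg j))|exact: cc].
  have nzA : \forall z \near nbhs ((u, v), c), A k z.2 z.1.1 != 0.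
    exact: (cvgr_neq0 _ cA nz).
  by apply: filterS nzA => z Az; left; exists k.
have cH : H k z.2 z.1.1 z.1.2 @[z --> ((u, v), c)] --> H k c u v.
  apply: cvg_sum_fin => j; apply: cvgD; apply: cvgM.
  - apply: cvg_sum_fin => l; apply: cvgM; [exact: cv|exact: (cu _ (cdg j l))].
  - exact: (cu _ (cdg j k)).
  - by apply: cvgB; [exact: (cu _ (cg j))|exact: cc].
  - apply: cvg_sum_fin => l; apply: cvgM; [exact: cv|exact: (cu _ (cddg j k l))].
have nzH : \forall z \near nbhs ((u, v), c), H k z.2 z.1.1 z.1.2 != 0.
  exact: (cvgr_neq0 _ cH nz).
by apply: filterS nzH => z Hz; right; exists k.
Qed.

End GenericCenter.

Lemma compact_finite_subcover (T : topologicalType) (I : eqType) (K : set T) (f : I -> set T) :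
  compact K -> (forall i, open (f i)) -> (forall x, K x -> exists i, f i x) ->
  exists s : seq I, forall x, K x -> exists2 i, i \in s & f i x.
Proof.
move=> /compact_near_coveringP cK of_ Kf.
(* Finite families directed by inclusion: a property holds near this filter when it holds for all
   families containing some fixed one. *)
pose F := filter_from setT (fun s0 : seq I => [set s : seq I | {subset s0 <= s}]).
have FF : Filter F.
  apply: filter_from_filter; first by exists [::].
  move=> s t _ _; exists (s ++ t) => // r H; split=> i Hi; apply: H; rewrite mem_cat Hi ?orbT //.
suff /(cK _ F _ FF)[s0 _ H] : forall x, K x -> \forall y \near x & s \near F, exists2 i, i \in s & f i y.
  by exists s0; exact: (H s0).
move=> x /Kf[i fix_].
exists (f i, [set s : seq I | i \in s]) => /=; last by move=> [y s] [/= fy si]; exists i.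
split; first by apply: open_nbhs_nbhs.
by exists [:: i] => // s /(_ i); apply; rewrite mem_head.
Qed.

Lemma Baire_rV (R : realType) k (F : nat -> set 'rV[R]_k) :
  (forall i, open (F i) /\ dense (F i)) -> exists c, forall i, F i c.
Proof.
pose T := HB.pack_for (completeNormedModType R) 'rV[R]_k
  (NormedModule.on 'rV[R]_k) (Complete.on 'rV[R]_k).
move=> H; have [c [_ Fc]] := @Baire R T F H setT (ex_intro _ 0 I) openT.
by exists c => i; exact: Fc.
Qed.

Lemma nbhs_closed_box (R : realType) n (u : Cspace R n) (r : R) : 0 < r ->
  nbhs u (closed_box u r).
Proof.
move=> r0; apply/(@nbhs_normP R (Cspace R n)); exists r => // y /= yr.
by rewrite /closed_box /= distrC ltW.
Qed.

(** * A Morse distance function on the complement *)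

Section MorseCenter.
Variables (R : realType) (N n : nat) (X : set (CP R N)) (a : CP R N).
Hypotheses (algX : algebraic_set X) (smX : complex_submanifold n X).
Let Y := X `&` ~` hyperplane a.
Let V : normedModType R := Cspace R n.
Local Notation C := 'rV[R]_(N.+1 + N.+1).

Definition sqdist_from (c : 'rV[R]_(N.+1 + N.+1)) (p : CP R N) : R :=
  sqdist c (affine_rep a p).

Let smY : complex_submanifold n Y := (stein_complement a algX smX).1.

Lemma sqdist_from_smooth (U : set V) f c : chart Y U f -> smooth_on U (sqdist_from c \o f).
Proof.
move=> cf; have [oU _ _ _ _] := cf.
exact: (sqdist_smooth c oU (affine_holomorphic cf)).
Qed.

(** W is cut out by the image of a box in one chart around p. A critical point in W seen in any
    other chart is moved to this one by [nondegenerate_transfer], so a single open dense set of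
    centers serves all charts. *)
Lemma generic_chart p : Y p -> exists W : set (CP R N), exists GC : set C,
  [/\ open W, W p, open GC, dense GC &
   forall c, GC c -> forall (U : set V) f x, chart Y U f -> U x -> W (f x) ->
     critical (sqdist_from c \o f) x -> Defs.nondegenerate (sqdist_from c \o f) x].
Proof.
move=> Yp; have [U [f [u [cf Uu fu]]]] := smY Yp.
have [oU _ _ hom _] := cf.
have hG := affine_holomorphic cf.
have imm x v (Ux : U x) := @affine_immersion0 _ _ _ _ _ _ _ cf x v Ux.
have [r r0 [rU dn]] := good_center_dense oU hG imm Uu.
have op := good_center_open oU hG rU.
have oI : open (closed_box u r)° by exact: open_interior.
have sI : (closed_box u r)° `<=` U by apply: subset_trans rU; exact: interior_subset.
have [W oW fW] := hom _ oI sI.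
have Iu : (closed_box u r)° u.
  exact: (nbhs_closed_box u r0).
exists W, (good_center (fun x => affine_rep a (f x)) (closed_box u r)); split=> //.
  have : (f @` (closed_box u r)°) p by exists u.
  by rewrite fW => -[].
move=> c good U' f' x cf' U'x Wx crit.
have [_ fU' _ _ _] := cf'.
have : (Y `&` W) (f' x) by split=> //; apply: fU'; exists x.
rewrite -fW => -[y Iy fy]; have yr := interior_subset Iy; have Uy := rU _ yr.
have [crity] := nondegenerate_transfer cf cf' Uy U'x fy
  (sqdist_from_smooth c cf) (sqdist_from_smooth c cf') crit.
apply=> v deg; apply: (good y yr) => w; first by rewrite ddE; exact: crity.
by rewrite -hessianE; exact: deg.
Qed.

(** Y is exhausted by the compact sets |affine_rep| <= k, each covered by finitely many W; the
    resulting countably many open dense sets of centers have a common point by Baire. *)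
Lemma morse_center_exists : exists c, morse n Y (sqdist_from c).
Proof.
have ex p : exists WG : set (CP R N) * set C, [/\ open WG.1, open WG.2, dense WG.2 & Y p -> WG.1 p /\
   forall c, WG.2 c -> forall (U : set V) f x, chart Y U f -> U x -> WG.1 (f x) ->
     critical (sqdist_from c \o f) x -> Defs.nondegenerate (sqdist_from c \o f) x].
  have [Yp|nY] := pselect (Y p).
    by have [W [GC [oW Wp oG dG H]]] := generic_chart Yp; exists (W, GC).
  exists (setT, setT); split=> //=; try exact: openT.
  by move=> O [c Oc] _; exists c.
have [WG HWG] := choice ex.
have cK k : compact (Y `&` affine_rep a @^-1` (closed_box 0 k%:R)).
  exact: (@affine_rep_proper R N X a algX _ (@closed_box_compact R _ _ _)).
have cov k : exists s : seq (CP R N), forall x, (Y `&` affine_rep a @^-1` (closed_box 0 k%:R)) x ->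
    exists2 p, p \in s & (WG p).1 x /\ Y p.
  apply: (@compact_finite_subcover _ _ _ (fun p => [set x | (WG p).1 x /\ Y p]) (cK k)) => [p|x [Yx _]].
    have [oW _ _ _] := HWG p; have [Yp|nY] := pselect (Y p).
      by rewrite (_ : [set x | _] = (WG p).1) //; apply/seteqP; split=> x //= [].
    by rewrite (_ : [set x | _] = set0); [exact: open0|apply/seteqP; split=> x //= []].
  by exists x; split=> //; have [_ _ _ /(_ Yx)[]] := HWG x.
have [s Hs] := choice cov.
(* Beyond the end of s k the default point a is used, which is harmless: every [(WG p).2] is open
   and dense. *)
pose F (i : nat) : set C := if unpickle i is Some (k, j) then (WG (nth a (s k) j)).2 else setT.
have HF i : open (F i) /\ dense (F i).
  rewrite /F; case: (unpickle i) => [[k j]|].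
    by have [_ oG dG _] := HWG (nth a (s k) j).
  by split; [exact: openT|move=> O [c Oc] _; exists c].
have [c Fc] := Baire_rV HF.
exists c => U f x cf Ux.
have [_ fU _ _ _] := cf.
have Yfx : Y (f x) by apply: fU; exists x.
pose k := (Num.truncn `|affine_rep a (f x)|).+1.
have Kfx : (Y `&` affine_rep a @^-1` (closed_box 0 k%:R)) (f x).
  by split=> //; rewrite /closed_box /= subr0 ltW // truncnS_gt.
have [p ps [Wp Yp]] := Hs k _ Kfx.
have [_ _ _ /(_ Yp)[_ H]] := HWG p.
apply: (H c _ U f x cf Ux Wp).
have := Fc (pickle (k, index p (s k))).
by rewrite /F pickleK nth_index.
Qed.

Lemma sqdist_from_psh_exhausting c : plurisubharmonic n Y (sqdist_from c) /\
  exhausting Y (sqdist_from c).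
Proof.
split=> [U f cf|].
  split; first exact: sqdist_from_smooth.
  have [oU _ _ _ _] := cf.
  apply: (sqdist_kahler c oU (affine_holomorphic cf)) => x v Ux.
  exact: (affine_immersion0 cf Ux).
split=> [K cK|]; last by exists 0 => p _; exact: sqdist_ge0.
rewrite (_ : Y `&` _ = X `&` ~` hyperplane a `&` affine_rep a @^-1` (sqdist c @^-1` K)) //.
exact: (@affine_rep_proper R N X a algX _ (@sqdist_proper R _ c K cK)).
Qed.

Lemma ind_max_sqdist c : X !=set0 ->
  (codim (dual_variety n X) + ind_max n Y (sqdist_from c) <= n.+1)%N.
Proof.
move=> X0.
(* If there are no critical points the maximum is 0, and this is the whole bound; otherwise it keeps
   the subtraction below from being truncated. *)
have cle : (codim (dual_variety n X) <= n.+1)%N.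
  have [p Xp] := X0; have [U [f [u [cf Uu _]]]] := smX Xp.
  have [_ _ _ _ [psi lpsi imm]] := cf.
  apply: (codim_dual_variety_le cf lpsi _ Uu) => x Ux v.
  by rewrite ddE; exact: imm.
rewrite -(subnKC cle) leq_add2l; apply/bigmax_leqP => k /asboolP[U [f [x [cf Ux crit <-]]]].
by rewrite leq_subRL //; exact: (morse_index_codim cf Ux crit).
Qed.

End MorseCenter.

Theorem theorem6 (R : realType) (N n : nat) (X Sigma : set (CP R N)) :
  projective_manifold n X ->
  small_dual n X ->
  smooth_hyperplane_section n X Sigma ->
  [/\ stein n (X `\` Sigma),
      subcritical n (X `\` Sigma) &
      exists2 d : nat, is_ind n (X `\` Sigma) d &
        d%:Z <= n%:Z - defect n X].
Proof.
move=> [X0 _ algX smX] sd [a -> _]; rewrite setDIr setDv set0U setDE.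
have [c Mc] := morse_center_exists a algX smX.
have [psh exh] := sqdist_from_psh_exhausting n a algX c.
set Y := X `&` ~` hyperplane a in Mc psh exh *.
(* The Morse distance function shows that the set of maximal indices is not empty, so its minimum
   exists. *)
have ex : exists d, `[< exists2 phi, psh_exhausting_morse n Y phi & ind_max n Y phi = d >].
  by exists (ind_max n Y (sqdist_from a c)); apply/asboolP; exists (sqdist_from a c).
have [d /asboolP Hd dmin] := ex_minnP ex.
have ind_d : is_ind n Y d.
  by split=> // phi pphi; apply: dmin; apply/asboolP; exists phi.
have dn : (codim (dual_variety n X) + d <= n.+1)%N.
  apply: leq_trans (ind_max_sqdist a smX c X0); rewrite leq_add2l.
  by apply: ind_d.2.
move: sd; rewrite /small_dual /defect subr_gt0 => sd.
have dE : d%:Z <= n%:Z - ((codim (dual_variety n X))%:Z - 1).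
  move: dn; rewrite -(ler_nat int) natrD -natr1 !natz; lra.
split; [exact: stein_complement|exists d => //|by exists d].
(* Positive defect means codim >= 2, so d + 2 <= n + 1. *)
by rewrite -ltnS; apply: leq_trans dn; rewrite -[d.+2]add2n leq_add2r -ltz_nat.
Qed.
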